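(* Let $\Omega\subset\mathbb{R}^N$ be a bounded domain, let $\alpha>0$, and suppose that $\partial\Omega$ is $(\log,\alpha)$ regular near every point of $\partial\Omega$. Let $0<\beta<1$ be such that $\alpha\beta>1$. Then there exists $b_{11}>0$ such that the log-Hardy inequality $|\log d|^{\alpha\beta}\le b_{11}(H_N+1)$ holds in the sense of quadratic forms, i.e. $$\int_\Omega|\log d(x)|^{\alpha\beta}|f(x)|^2\,d^Nx\le b_{11}\left(Q(f)+\|f\|_2^2\right)\quad\text{for all } f\in W^{1,2}(\Omega).$$ Moreover there exist constants $b_{12},b_{13},b_{14}>0$ and a function $\eta:(0,\infty)\to\mathbb{R}$ with $$\eta(\varepsilon)\le b_{12}\varepsilon^{-1/(\alpha\beta-1)}-b_{13}\log\varepsilon+b_{14}$$ such that the log-Sobolev inequality $$\int_\Omega f^2\log f\,d^Nx\le\varepsilon Q(f)+\eta(\varepsilon)\|f\|_2^2+\|f\|_2^2\log\|f\|_2$$ holds for all $0\le f\in W^{1,2}(\Omega)$ and all $\varepsilon>0$.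
   Context: A domain is a nonempty connected open set. $d(x)$ denotes the distance of $x\in\Omega$ from $\partial\Omega$. $Q(f)=\int_\Omega|\nabla f|^2\,d^Nx$ for $f\in W^{1,2}(\Omega)$, and $H_N$ is the Neumann Laplacian, the non-negative self-adjoint operator in $L^2(\Omega)$ associated with the quadratic form $Q$ with domain $W^{1,2}(\Omega)$. $\|\cdot\|_2$ is the norm of $L^2(\Omega)$. The convention $0\log0=0$ is used. Definition: for $\alpha>0$, $\partial\Omega$ is $(\log,\alpha)$ regular near $a\in\partial\Omega$ if there is an open neighbourhood $V$ of $a$ in $\mathbb{R}^N$ such that, after translation and rotation of coordinates, $\Omega\cap V=U$ where $$U=\{(x',x_N): x'\in B,\ 0<x_N<g(x')\},\qquad B=\{x'\in\mathbb{R}^{N-1}:|x'|<1/2\},$$ the point $a$ lies on the graph $\{(x',g(x')):x'\in B\}$, and $g:B\to(0,\infty)$ satisfies, for some constant $A$, $$|g(x')-g(y')|\le A\left|\log|x'-y'|\right|^{-\alpha}\quad\text{for all } x',y'\in B$$ (for $x'=y'$ the right-hand side is read as $0$).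
   Formalization: The bound on η is proved for 0<ε≤ε₀ with b₁₄ depending on ε₀ (any ε₀>0; b₁₂, b₁₃, η do not depend on it). With one b₁₄ for all ε>0 the claim is false: f=1 forces η(ε)≥-½log|Ω|, while the bound tends to -∞. *)

(* Defs.v *)
From HB Require Import structures.
From mathcomp Require Import all_boot all_order all_algebra.
From mathcomp Require Import all_classical all_reals all_analysis.

Set Implicit Arguments.
Unset Strict Implicit.
Unset Printing Implicit Defensive.

Import Order.TTheory GRing.Theory Num.Theory.
Import numFieldNormedType.Exports.

Local Open Scope classical_set_scope.
Local Open Scope ring_scope.

Definition rV_display : measure_display.
Proof. exact: default_measure_display. Qed.

(* The sigma-algebra generated by the coordinate functions, i.e. the Borel
   sigma-algebra of R^n. *)
Section rV_measurable.
Variables (R : realType) (n : nat).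

Let coord (i : 'I_n) (x : 'rV[R]_n) : measurableTypeR R := x ord0 i.

Let rV_set0 : g_sigma_preimage coord set0.
Proof. exact: sigma_algebra0. Qed.

Let rV_setC A : g_sigma_preimage coord A -> g_sigma_preimage coord (~` A).
Proof. exact: sigma_algebraC. Qed.

Let rV_bigcup (F : (set 'rV[R]_n)^nat) :
  (forall i, g_sigma_preimage coord (F i)) ->
  g_sigma_preimage coord (\bigcup_i (F i)).
Proof. exact: sigma_algebra_bigcup. Qed.

HB.instance Definition _ := @isMeasurable.Build rV_display
  'rV[R]_n (g_sigma_preimage coord) rV_set0 rV_setC rV_bigcup.

Lemma measurable_rV_coord (i : 'I_n) :
  measurable_fun [set: 'rV[R]_n] (fun x => x ord0 i : measurableTypeR R).
Proof.
move=> _ Y mY; rewrite setTI; apply: sub_sigma_algebra => /=.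
rewrite -bigcup_seq/=; exists i => /=; first by rewrite mem_index_enum.
by exists Y => //; rewrite setTI.
Qed.

Lemma measurable_fun_rVP d (T : measurableType d) (f : T -> 'rV[R]_n) :
  measurable_fun [set: T] f <->
  forall i, measurable_fun [set: T] (fun t => f t ord0 i : measurableTypeR R).
Proof.
split=> [mf i|mf].
  by apply: (measurableT_comp (measurable_rV_coord i)).
move=> _ A mA; rewrite setTI.
suff : g_sigma_preimage coord `<=` [set A | measurable (f @^-1` A)].
  by apply; exact: mA.
apply: smallest_sub.
  split => /=.
  - by rewrite preimage_set0; exact: measurable0.
  - by move=> B mB; rewrite setTD preimage_setC; exact: measurableC.
  - by move=> F mF; rewrite preimage_bigcup; exact: bigcup_measurable.
move=> B; rewrite -bigcup_seq/= => -[i _ [C mC <-]] /=.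
rewrite setTI -comp_preimage -[X in measurable X]setTI.
exact: (mf i).
Qed.

End rV_measurable.

(* R^(n+1) = R^n x R: x = (x', x_{n+1}). *)
Section rV_split.
Variables (R : Type) (n : nat).

Definition rV_init (x : 'rV[R]_n.+1) : 'rV[R]_n :=
  \row_i x ord0 (lift ord_max i).

Definition rV_last (x : 'rV[R]_n.+1) : R := x ord0 ord_max.

Definition rV_rcons (p : 'rV[R]_n * R) : 'rV[R]_n.+1 :=
  \row_j if unlift ord_max j is Some i then p.1 ord0 i else p.2.

Lemma rV_init_rcons p : rV_init (rV_rcons p) = p.1.
Proof. by apply/rowP => i; rewrite !mxE liftK. Qed.

Lemma rV_last_rcons p : rV_last (rV_rcons p) = p.2.
Proof. by rewrite /rV_last mxE unlift_none. Qed.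

Lemma rV_rconsK x : rV_rcons (rV_init x, rV_last x) = x.
Proof.
by apply/rowP => j; rewrite mxE; case: unliftP => [i|] -> /=; rewrite ?mxE.
Qed.

End rV_split.

Section lebesgue_rV.
Variable R : realType.

Lemma measurable_rV_rcons n :
  measurable_fun [set: 'rV[R]_n * measurableTypeR R] (@rV_rcons R n).
Proof.
apply/measurable_fun_rVP => j.
under eq_fun do rewrite mxE.
case: (unlift ord_max j) => [i|]; last exact: measurable_snd.
exact: (measurableT_comp (measurable_rV_coord i) measurable_fst).
Qed.

Lemma measurable_rV_init n :
  measurable_fun [set: 'rV[R]_n.+1] (@rV_init R n).
Proof.
apply/measurable_fun_rVP => i; under eq_fun do rewrite mxE.
exact: measurable_rV_coord.
Qed.

Section step.
Variables (n : nat) (mu : {sigma_finite_measure set 'rV[R]_n -> \bar R}).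

Definition lebesgue_rVS : set 'rV[R]_n.+1 -> \bar R :=
  pushforward (mu \x (@lebesgue_measure R))%E (@rV_rcons R n).

Let lebesgue_rVS_preimage (A : set 'rV[R]_n.+1) : measurable A ->
  measurable (@rV_rcons R n @^-1` A : set ('rV[R]_n * measurableTypeR R)).
Proof.
by move=> mA; rewrite -[X in measurable X]setTI; exact: measurable_rV_rcons.
Qed.

Let lebesgue_rVS0 : lebesgue_rVS set0 = 0%E.
Proof. by rewrite /lebesgue_rVS /pushforward preimage_set0 measure0. Qed.

Let lebesgue_rVS_ge0 A : (0 <= lebesgue_rVS A)%E.
Proof. by rewrite /lebesgue_rVS /pushforward. Qed.

Let lebesgue_rVS_sigma_additive : semi_sigma_additive lebesgue_rVS.
Proof.
move=> F mF tF mUF; rewrite /lebesgue_rVS /pushforward preimage_bigcup.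
apply: measure_semi_sigma_additive.
- by move=> k; exact: lebesgue_rVS_preimage.
- apply/trivIsetP => i j _ _ ij; rewrite -preimage_setI.
  by move/trivIsetP : tF => /(_ _ _ _ _ ij) ->//; rewrite preimage_set0.
- by rewrite -preimage_bigcup; exact: lebesgue_rVS_preimage.
Qed.

HB.instance Definition _ := isMeasure.Build _ _ _ lebesgue_rVS
  lebesgue_rVS0 lebesgue_rVS_ge0 lebesgue_rVS_sigma_additive.

Let lebesgue_rVS_sigma_finite : sigma_finite setT lebesgue_rVS.
Proof.
have [F FT mF] : sigma_finite setT (mu \x (@lebesgue_measure R))%E.
  have /sigma_finiteP[F [TF ndF Foo]] := sigma_finiteT mu.
  have /sigma_finiteP[G [TG ndG Goo]] := sigma_finiteT (@lebesgue_measure R).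
  exists (fun k => F k `*` G k).
    rewrite -setXTT TF TG predeqE => -[x y]; split.
      move=> [/= [i _ Fix] [k _ Gky]]; exists (maxn i k) => //; split.
      - by move: x Fix; exact/subsetPset/ndF/leq_maxl.
      - by move: y Gky; exact/subsetPset/ndG/leq_maxr.
    by move=> [i _ []/= ? ?]; split; exists i.
  move=> k; have [? ?] := Foo k; have [? ?] := Goo k.
  split; first exact: measurableX.
  by rewrite product_measure1E// lte_mul_pinfty// ge0_fin_numE.
pose split_last (x : 'rV[R]_n.+1) : 'rV[R]_n * measurableTypeR R :=
  (rV_init x, rV_last x).
have msplit : measurable_fun setT split_last.
  apply/measurable_fun_pairP; split; first exact: measurable_rV_init.
  exact: measurable_rV_coord.
exists (fun k => split_last @^-1` F k).
  by rewrite -preimage_bigcup -FT preimage_setT.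
move=> k; have [mFk Fk] := mF k; split.
  by rewrite -[X in measurable X]setTI; exact: msplit.
rewrite /lebesgue_rVS /pushforward -comp_preimage.
rewrite (_ : split_last \o @rV_rcons R n = id) ?preimage_id//.
by apply/funext => -[y t]; rewrite /= /split_last rV_init_rcons rV_last_rcons.
Qed.

HB.instance Definition _ := Measure_isSigmaFinite.Build _ _ _ lebesgue_rVS
  lebesgue_rVS_sigma_finite.

End step.

(* Iterated product of the Lebesgue measure on the line; on R^0 it is the unit
   mass at the only point. *)
Fixpoint lebesgue_rV (n : nat) : {sigma_finite_measure set 'rV[R]_n -> \bar R} :=
  match n with
  | 0%N => \d_ (0 : 'rV[R]_0)
  | m.+1 => lebesgue_rVS (lebesgue_rV m)
  end.

Lemma lebesgue_rV_box n (A : 'I_n -> set (measurableTypeR R)) :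
  (forall i, measurable (A i)) ->
  lebesgue_rV n [set x | forall i, A i (x ord0 i)] =
  (\prod_(i < n) lebesgue_measure (A i))%E.
Proof.
elim: n A => [A mA|n IH A mA].
  by rewrite big_ord0 /= diracE mem_set//= => -[].
rewrite /= /lebesgue_rVS /pushforward.
pose B := [set x : 'rV[R]_n | forall i, A (lift ord_max i) (x ord0 i)].
rewrite (_ : _ @^-1` _ = B `*` A ord_max); last first.
  apply/seteqP; split => -[y t] /=.
    move=> h; split => [i|].
      by have := h (lift ord_max i); rewrite mxE liftK.
    by have := h ord_max; rewrite mxE unlift_none.
  by move=> [By At] j; rewrite mxE; case: unliftP => [i|] ->; [exact: By|].
have mB : measurable B.
  rewrite (_ : B = \bigcap_(i in [set: 'I_n])
      (fun x : 'rV[R]_n => x ord0 i : measurableTypeR R) @^-1`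
        A (lift ord_max i)); last first.
    by apply/seteqP; split => [x Bx i _|x Bx i]; [exact: Bx|exact: (Bx i)].
  apply: fin_bigcap_measurable => // i _.
  by rewrite -[X in measurable X]setTI; exact: measurable_rV_coord.
have := IH (fun i => A (lift ord_max i)) (fun i => mA _).
rewrite product_measure1E// big_ord_recr/= => ->; congr (_ * _)%E.
by apply: eq_bigr => i _; congr (lebesgue_measure (A _)); apply/val_inj;
  rewrite /= /bump leqNgt ltn_ord.
Qed.

End lebesgue_rV.

Section euclidean.
Variable R : realType.

(* The norm of 'rV[R]_n in the library is the sup norm. *)
Definition enorm n (x : 'rV[R]_n) : R := Num.sqrt (\sum_i x ord0 i ^+ 2).

Definition domain n (Omega : set 'rV[R]_n) : Prop :=
  [/\ Omega !=set0, connected Omega & open Omega].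

Definition boundary n (Omega : set 'rV[R]_n) : set 'rV[R]_n :=
  closure Omega `\` interior Omega.

Definition dist_boundary n (Omega : set 'rV[R]_n) (x : 'rV[R]_n) : R :=
  inf [set enorm (x - y) | y in boundary Omega].

Definition half_ball n : set 'rV[R]_n := [set y | enorm y < 2^-1].

(* Rigid change of coordinates. The orthogonal matrix may have determinant -1:
   in dimension at least 2 this defines the same class of sets, since half_ball
   is invariant under reflections, and in dimension 1 it lets the graph be
   either end point of an interval. *)
Definition change_coord n (P : 'M[R]_n) (c x : 'rV[R]_n) : 'rV[R]_n :=
  (x - c) *m P.

(* For x' = y' the right-hand side of the bound on g is 0, since ln 0 = 0 and
   0 `^ s = 0 for s != 0. *)
Definition log_regular n (alpha : R) (Omega : set 'rV[R]_n.+1)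
    (a : 'rV[R]_n.+1) : Prop :=
  exists (V : set 'rV[R]_n.+1) (P : 'M[R]_n.+1) (c : 'rV[R]_n.+1)
         (g : 'rV[R]_n -> R) (A : R),
    let T := change_coord P c in
    [/\ open V /\ V a,
        P *m P^T = 1%:M,
        Omega `&` V = T @^-1` [set y | half_ball (rV_init y) /\
                                       0 < rV_last y < g (rV_init y)],
        half_ball (rV_init (T a)) /\ rV_last (T a) = g (rV_init (T a)) &
        (forall x', half_ball x' -> 0 < g x') /\
        (forall x' y', half_ball x' -> half_ball y' ->
          `|g x' - g y'| <= A * `|ln (enorm (x' - y'))| `^ (- alpha))].

End euclidean.

Section sobolev.
Variables (R : realType) (n : nat).
Implicit Types (Omega : set 'rV[R]_n) (f h phi : 'rV[R]_n -> R).

Local Notation mu := (lebesgue_rV R n).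

Definition partial (i : 'I_n) phi : 'rV[R]_n -> R :=
  fun x => 'D_(delta_mx ord0 i : 'rV[R]_n) phi x.

Fixpoint class_C (k : nat) phi : Prop :=
  continuous phi /\
  match k with
  | 0%N => True
  | m.+1 => forall i : 'I_n,
      (forall x, derivable phi x (delta_mx ord0 i)) /\ class_C m (partial i phi)
  end.

Definition support phi : set 'rV[R]_n := closure [set x | phi x != 0].

Definition test_function Omega phi : Prop :=
  [/\ forall k, class_C k phi, compact (support phi) & support phi `<=` Omega].

Definition square_integrable Omega f : Prop :=
  measurable_fun Omega f /\ (\int[mu]_(x in Omega) (f x ^+ 2)%:E < +oo)%E.

Definition weak_partial Omega f (i : 'I_n) h : Prop :=
  forall phi, test_function Omega phi ->
    \int[mu]_(x in Omega) (f x * partial i phi x) =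
    - \int[mu]_(x in Omega) (h x * phi x).

Definition weak_gradient Omega f (G : 'I_n -> 'rV[R]_n -> R) : Prop :=
  forall i, square_integrable Omega (G i) /\ weak_partial Omega f i (G i).

Definition W12 Omega f : Prop :=
  square_integrable Omega f /\ exists G, weak_gradient Omega f G.

(* Determined up to a null set when f is in W12; zero if there is none. *)
Definition grad Omega f : 'I_n -> 'rV[R]_n -> R :=
  xget (fun _ _ => 0) [set G | weak_gradient Omega f G].

Definition dirichlet_form Omega f : R :=
  \int[mu]_(x in Omega) \sum_i grad Omega f i x ^+ 2.

Definition L2_norm Omega f : R :=
  Num.sqrt (\int[mu]_(x in Omega) (f x ^+ 2)).

End sobolev.

(* Main.v *)
(* Near a boundary point, let s be the distance to the boundary along the
   graph direction e.  The modulus of continuity of the graph gives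
   s <= C |log d|^-alpha, hence |log d|^(alpha beta) <= C s^-beta, which is
   integrable along lines parallel to e because beta < 1.  For f in W^{1,2},
   f(x + te) - f(x) is almost everywhere the integral of the directional weak
   derivative (tested against products of one-dimensional cutoffs), so for a
   weight w whose line integrals are at most M,
     int w (f(x + te) - f(x))^2 <= t M int (e . grad f)^2.
   Averaging f(x)^2 <= 2 f(x + te)^2 + 2 (f(x + te) - f(x))^2 over t gives the
   log-Hardy inequality near the boundary, and compactness gives it globally.

   For the log-Sobolev inequality, normalize ||f||_2 = 1.  Averaging the
   translation estimate over a cube of side t ~ 2^-k shows that, on the set
   where d > 2^-k and f exceeds a multiple of t^(-N/2), the integral of f^2 is
   at most C 4^-k Q(f).  Summing over the layers k >= k0,
     int f^2 log f <= C k0 + C 4^-k0 Q(f) + C int f^2 #{k >= k0 : d <= 2^-k},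
   where the last count is at most C k0^(1-p) |log d|^p with p = alpha beta, so
   that the log-Hardy inequality applies; finally k0 ~ eps^(-1/(p-1)). *)
From HB Require Import structures.
Require Import Defs.
From mathcomp Require Import all_boot all_order all_algebra.
From mathcomp Require Import all_classical all_reals all_analysis.
From mathcomp Require Import measurable_realfun ring lra.

Set Implicit Arguments.
Unset Strict Implicit.
Unset Printing Implicit Defensive.

Import Order.TTheory GRing.Theory Num.Theory.
Import numFieldNormedType.Exports.

Local Open Scope classical_set_scope.
Local Open Scope ring_scope.

(** * Boxes and the Borel sets of the row space *)

(** The graph is merely log-continuous, so straightening it is not a Lipschitz change of variables;
    only translations in one fixed direction are used near each boundary point. The modulus controls
    s through the horizontal distance to some boundary point within sqrt d of x: a square root
    inside the logarithm costs only a factor 2^alpha, so the infimum defining d need not be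
    attained. No density of smooth functions in W^{1,2} enters. Tensor products of one-dimensional
    cutoffs suffice as test functions: their translates and partial derivatives are again tensors of
    compactly supported smooth factors, and their limits are indicators of boxes, which generate the
    Borel sets. In the log-Sobolev part the interior layers contribute 4^-k0, which is dominated by
    the boundary contribution k0^(1-p). Solving k0^(1-p) ~ eps therefore fixes the rate, and k0
    enters [eta] linearly because the logarithm of the threshold of layer k is affine in k. *)

Section boxes.
Variables (R : realType) (n : nat).
Implicit Types (a b x : 'rV[R]_n) (O : set 'rV[R]_n).

Definition box a b : set 'rV[R]_n :=
  [set x | forall i, a ord0 i < x ord0 i < b ord0 i].

Definition cbox a b : set 'rV[R]_n :=
  [set x | forall i, a ord0 i <= x ord0 i <= b ord0 i].

Lemma box_cbox a b : box a b `<=` cbox a b.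
Proof. by move=> x xab i; have /andP[/ltW -> /ltW ->] := xab i. Qed.

Lemma measurable_box a b : measurable (box a b).
Proof.
rewrite (_ : box a b = \bigcap_(i in [set: 'I_n])
  (fun x : 'rV[R]_n => x ord0 i : measurableTypeR R) @^-1`
    `]a ord0 i, b ord0 i[%classic); last first.
  apply/seteqP; split => x /=.
    by move=> xab i _ /=; rewrite in_itv /=.
  by move=> xab i; have := xab i I; rewrite /= in_itv.
apply: fin_bigcap_measurable => // i _.
by rewrite -[X in measurable X]setTI; exact: measurable_rV_coord.
Qed.

Lemma lebesgue_rV_itv (A : 'I_n -> interval R) :
  lebesgue_rV R n [set x | forall i, x ord0 i \in A i] =
  (\prod_(i < n) lebesgue_measure [set` A i])%E.
Proof.
by apply: (@lebesgue_rV_box R n (fun i => [set` A i])) => i.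
Qed.

Lemma lebesgue_rV_boxE a b : lebesgue_rV R n (box a b) =
  (\prod_(i < n) lebesgue_measure `]a ord0 i, b ord0 i[%classic)%E.
Proof.
by rewrite -lebesgue_rV_itv.
Qed.

Lemma prode_lty (I : finType) (F : I -> \bar R) :
  (forall i, 0 <= F i)%E -> (forall i, F i < +oo)%E ->
  (0 <= \prod_i F i < +oo)%E.
Proof.
move=> F0 Foo; elim/big_ind : _ => [|x y /andP[x0 xoo] /andP[y0 yoo]|i _].
- by rewrite lee01 ltry.
- by rewrite mule_ge0//= lte_mul_pinfty// ge0_fin_numE.
- by rewrite F0 Foo.
Qed.

Lemma lebesgue_rV_box_lty a b : (lebesgue_rV R n (box a b) < +oo)%E.
Proof.
rewrite lebesgue_rV_boxE.
suff /andP[] : (0 <= \prod_(i < n)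
  lebesgue_measure `]a ord0 i, b ord0 i[%classic < +oo)%E by [].
apply: prode_lty => i//; rewrite lebesgue_measure_itv/=.
by case: ifPn => _; rewrite ?ltry// -EFinB ltry.
Qed.

Lemma box_setI a b a' b' : box a b `&` box a' b' =
  box (\row_i Num.max (a ord0 i) (a' ord0 i))
      (\row_i Num.min (b ord0 i) (b' ord0 i)).
Proof.
apply/seteqP; split => x /=.
  move=> [xab xab'] i; rewrite !mxE gt_max lt_min.
  by have /andP[-> ->] := xab i; have /andP[-> ->] := xab' i.
move=> h; split => i; have := h i; rewrite !mxE gt_max lt_min;
  by move=> /andP[/andP[? ?] /andP[? ?]]; apply/andP.
Qed.

Definition sbox (k : nat) : set 'rV[R]_n :=
  box (const_mx (- k%:R)) (const_mx k%:R).

Lemma bigcup_sbox : \bigcup_k sbox k = setT.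
Proof.
apply/seteqP; split => // x _.
pose s := \sum_i `|x ord0 i|.
exists (Num.truncn s).+1 => // i; rewrite !mxE -ltr_norml.
have : s < (Num.truncn s).+1%:R by rewrite truncnS_gt.
apply: le_lt_trans; rewrite /s (bigD1 i)//= lerDl.
by apply: sumr_ge0 => j _.
Qed.

Definition boxes : set (set 'rV[R]_n) := [set A | exists a b, A = box a b].

(** Boxes form a pi-system of finite measure, so this generation later reduces uniqueness of
    measures and vanishing of integrals to boxes. The nontrivial inclusion rests on open intervals
    generating the Borel sets of the line. *)
Lemma measurable_boxes : measurable = <<s boxes >>.
Proof.
apply/seteqP; split; last first.
  apply: smallest_sub; first exact: sigma_algebra_measurable.
  by move=> _ [a [b ->]]; exact: measurable_box.
apply: smallest_sub; first exact: smallest_sigma_algebra.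
move=> A; rewrite -bigcup_seq/= => -[i _ [Y mY <-]]; rewrite setTI.
suff h : measurable `<=`
    [set Y : set (measurableTypeR R) |
      <<s boxes >> ((fun x : 'rV[R]_n => x ord0 i) @^-1` Y)].
  exact: h mY.
have -> : (measurable : set (set (measurableTypeR R))) = (@ocitv R).-sigma.-measurable by [].
rewrite RGenOpens.measurableE; apply: smallest_sub.
  have /= S := smallest_sigma_algebra setT boxes.
  split => /=.
  - by rewrite preimage_set0; case: S.
  - move=> B sB; rewrite setTD preimage_setC.
    by case: S => _ /(_ _ sB) + _; rewrite setTD.
  - by move=> F sF; rewrite preimage_bigcup; case: S => _ _; exact.
move=> _ /= [a [b ->]].
(* An open slab is unbounded in the other coordinates, so it is exhausted by boxes whose remaining
   sides are ]-k, k[. *)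
have -> : (fun x : 'rV[R]_n => x ord0 i) @^-1` `]a, b[%classic =
    \bigcup_k (box (\row_j (if j == i then a else - k%:R))
                   (\row_j (if j == i then b else k%:R))).
  apply/seteqP; split => x /=.
    rewrite in_itv /= => xab.
    have [k _ xk] : (\bigcup_k sbox k) x by rewrite bigcup_sbox.
    exists k => // j; rewrite !mxE; case: eqP => [->//|_].
    by have := xk j; rewrite !mxE.
  by move=> [k _ /(_ i)]; rewrite !mxE eqxx in_itv.
have [_ _] := smallest_sigma_algebra setT boxes; apply => k.
by apply: sub_sigma_algebra; do 2 eexists.
Qed.

Lemma measure_unique_box (m1 m2 : {measure set 'rV[R]_n -> \bar R}) :
  (forall a b, m1 (box a b) = m2 (box a b)) ->
  (forall a b, m1 (box a b) < +oo)%E ->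
  forall A, measurable A -> m1 A = m2 A.
Proof.
move=> m12 m1oo A mA.
apply: (measure_unique boxes sbox) => //.
- exact: measurable_boxes.
- by move=> _ _ [a [b ->]] [a' [b' ->]]; rewrite box_setI; do 2 eexists.
- by move=> k; do 2 eexists.
- exact: bigcup_sbox.
- by move=> _ [a [b ->]].
- by move=> k; exact: m1oo.
Qed.

Lemma ball_rVP x (e : R) y : 0 < e ->
  ball x e y <-> (forall i, `|x ord0 i - y ord0 i| < e).
Proof.
move=> e0; split => [[_ h] i|h].
  by have := h ord0 i; rewrite -ball_normE.
by split => // i j; rewrite (ord1 i) -ball_normE /=; exact: h.
Qed.

(** A countable list of cubes with rational centre and half-side 1/(m+1), so that null sets attached
    to them can be united. An index that decodes to nothing gets the dummy pair (0, 0), harmless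
    because covering only asks for some index. *)
Definition qbox (k : nat) : 'rV[R]_n * 'rV[R]_n :=
  if @unpickle ('rV[rat]_n * nat)%type k is Some (q, m)
  then (map_mx ratr q - const_mx m.+1%:R^-1, map_mx ratr q + const_mx m.+1%:R^-1)
  else (0, 0).

(** In each coordinate, [x] and any point of the closed cube are within 1/(m+1) of the rational
    centre, and 2/(m+1) < e. The closed cube has to lie in [O] so that cutoffs supported in it are
    admissible test functions. *)
Lemma qbox_cover O x : open O -> O x ->
  exists k, box (qbox k).1 (qbox k).2 x /\ cbox (qbox k).1 (qbox k).2 `<=` O.
Proof.
move=> oO Ox.
have /nbhs_ballP[e /= e0 xeO] : nbhs x O by exact: open_nbhs_nbhs.
have [m me] : exists m : nat, m.+1%:R^-1 < e / 2.
  exists (Num.truncn (e / 2)^-1); rewrite -[ltRHS]invrK ltf_pV2 ?posrE ?invr_gt0 ?divr_gt0//.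
  exact: truncnS_gt.
have m0 : 0 < m.+1%:R^-1 :> R by [].
have hq i : {q : rat | `|x ord0 i - ratr q| < m.+1%:R^-1}.
  have /cid[q] : exists q : rat, ratr q \in
      `](x ord0 i - m.+1%:R^-1), (x ord0 i + m.+1%:R^-1)[.
    have [|q qx] := @rat_in_itvoo R (x ord0 i - m.+1%:R^-1) (x ord0 i + m.+1%:R^-1).
      by rewrite ltrD2l (lt_trans _ m0)// oppr_lt0.
    by exists q.
  by rewrite in_itv /= => h; exists q; rewrite distrC ltr_distl.
pose q := \row_i sval (hq i).
exists (pickle (q, m)); rewrite /qbox pickleK; split => [i|y yq] /=.
  by rewrite !mxE -ltr_distl; case: (hq i).
apply: xeO; apply/ball_rVP => // i.
have := yq i; rewrite !mxE /= => /[1!andbC].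
have := svalP (hq i); set r := ratr _; move: me m0; set d := _^-1.
rewrite !ltr_norml => ? ? /andP[? ?] /andP[? ?].
by apply/andP; split; lra.
Qed.

Lemma open_measurable_rV O : open O -> measurable O.
Proof.
move=> oO.
rewrite (_ : O = \bigcup_(k in [set k | cbox (qbox k).1 (qbox k).2 `<=` O])
    box (qbox k).1 (qbox k).2).
  by apply: bigcup_measurable => k _; exact: measurable_box.
apply/seteqP; split => [x Ox|x [k /= kO /box_cbox /kO//]].
by have [k [kx kO]] := qbox_cover oO Ox; exists k.
Qed.

Lemma continuous_measurable_rV (f : 'rV[R]_n -> R) :
  continuous f -> measurable_fun setT (f : _ -> measurableTypeR R).
Proof.
move=> cf; apply: (@measurability _ _ 'rV[R]_n (measurableTypeR R) setT f _ (@RGenOpens.measurableE R)).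
move=> _ -[_ [a [b ->] <-]]; rewrite setTI; apply: open_measurable_rV.
by apply: open_comp => [? _|]; [exact: cf|exact: interval_open].
Qed.

Lemma bounded_sbox (O : set 'rV[R]_n) : bounded_set O ->
  exists k, O `<=` sbox k.
Proof.
move=> [M [Mr hM]].
have [k Mk] : exists k : nat, M + 1 < k%:R.
  by exists (Num.truncn (M + 1)).+1; exact: truncnS_gt.
exists k => x Ox i; have xM : `|x| <= M + 1 by apply: hM Ox; rewrite ltrDl.
rewrite !mxE -ltr_norml; apply: le_lt_trans Mk; apply: le_trans xM.
rewrite [leRHS]mx_normrE.
exact: (le_bigmax _ (fun ij : 'I_1 * 'I_n => `|x ij.1 ij.2|) (ord0, i)).
Qed.

Lemma bounded_lebesgue_lty (O : set 'rV[R]_n) : open O -> bounded_set O ->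
  (lebesgue_rV R n O < +oo)%E.
Proof.
move=> oO /bounded_sbox[k Ok].
apply: le_lt_trans (lebesgue_rV_box_lty (const_mx (- k%:R)) (const_mx k%:R)).
by apply: le_measure => //; rewrite inE; [exact: open_measurable_rV|exact: measurable_box].
Qed.

End boxes.

(** * Fubini for real integrals and translation invariance *)

Section Fubini_real.
Context d1 d2 (T1 : measurableType d1) (T2 : measurableType d2) (R : realType).
Variable m1 : {sigma_finite_measure set T1 -> \bar R}.
Variable m2 : {sigma_finite_measure set T2 -> \bar R}.
Variable f : T1 * T2 -> R.
Hypothesis mf : measurable_fun setT f.
Hypothesis fi : (\int[m2]_y \int[m1]_x `|f (x, y)|%:E < +oo)%E.

Lemma integrable_Fubini_real :
  (m1 \x m2)%E.-integrable setT (EFin \o f).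
Proof. by apply/integrable21ltyP => //; exact/measurable_EFinP. Qed.

(** The real inner integral is [fine] of the extended one and sends an infinite value to 0; by
    Fubini the slices that are not integrable form a null set. *)
Lemma ae_fine_Fubini1 : ae_eq m1 setT
  (fun x => (\int[m2]_y f (x, y))%:E) (fun x => \int[m2]_y (f (x, y))%:E)%E.
Proof.
have := ae_integrable1 integrable_Fubini_real.
apply: filterS => x ix _; rewrite fineK//.
exact: integrable_fin_num ix.
Qed.

Lemma ae_fine_Fubini2 : ae_eq m2 setT
  (fun y => (\int[m1]_x f (x, y))%:E) (fun y => \int[m1]_x (f (x, y))%:E)%E.
Proof.
have := ae_integrable2 integrable_Fubini_real.
apply: filterS => x ix _; rewrite fineK//.
exact: integrable_fin_num ix.
Qed.

Lemma measurable_Rintegral1 :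
  measurable_fun setT (fun x => \int[m2]_y f (x, y)).
Proof.
apply: measurableT_comp => //.
by have := measurable_fubini_F integrable_Fubini_real.
Qed.

Lemma measurable_Rintegral2 :
  measurable_fun setT (fun y => \int[m1]_x f (x, y)).
Proof.
apply: measurableT_comp => //.
by have := measurable_fubini_G integrable_Fubini_real.
Qed.

Lemma integrable_Rintegral1 :
  m1.-integrable setT (fun x => (\int[m2]_y f (x, y))%:E).
Proof.
have mF := measurable_fubini_F integrable_Fubini_real.
have mf1 : measurable_fun setT (fun x => (\int[m2]_y f (x, y))%:E).
  by apply/measurable_EFinP; exact: measurable_Rintegral1.
apply/integrableP; split => //.
have /integrableP[_] := integrable_fubini_F integrable_Fubini_real.
apply: le_lt_trans; rewrite le_eqVlt; apply/orP; left; apply/eqP.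
apply: ae_eq_integral => //; [exact: measurableT_comp|exact: measurableT_comp|].
exact: ae_eq_abse ae_fine_Fubini1.
Qed.

Lemma Fubini_Rintegral :
  \int[m1]_x \int[m2]_y f (x, y) = \int[m2]_y \int[m1]_x f (x, y).
Proof.
rewrite /Rintegral; congr fine.
have <- : (\int[m1]_x \int[m2]_y (f (x, y))%:E =
    \int[m1]_x (\int[m2]_y f (x, y))%:E)%E.
  apply: ae_eq_integral => //; last exact/ae_eq_sym/ae_fine_Fubini1.
    by have := measurable_fubini_F integrable_Fubini_real.
  by apply/measurable_EFinP; exact: measurable_Rintegral1.
have <- : (\int[m2]_y \int[m1]_x (f (x, y))%:E =
    \int[m2]_y (\int[m1]_x f (x, y))%:E)%E.
  apply: ae_eq_integral => //; last exact/ae_eq_sym/ae_fine_Fubini2.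
    by have := measurable_fubini_G integrable_Fubini_real.
  by apply/measurable_EFinP; exact: measurable_Rintegral2.
exact: (Fubini integrable_Fubini_real).
Qed.

End Fubini_real.

(** * Translation invariance of the Lebesgue measure *)

Section translation.
Variables (R : realType) (n : nat).
Local Notation mu := (lebesgue_rV R n).
Implicit Types (v e x : 'rV[R]_n).

Lemma measurable_rV_shift v : measurable_fun setT (fun x : 'rV[R]_n => x + v).
Proof.
apply/measurable_fun_rVP => i; under eq_fun do rewrite mxE.
by apply: measurable_funD; [exact: measurable_rV_coord|exact: measurable_cst].
Qed.

Lemma measurable_rV_addZ (e : 'rV[R]_n) : measurable_fun setT
  (fun p : 'rV[R]_n * measurableTypeR R => p.1 + p.2 *: e).
Proof.
apply/measurable_fun_rVP => i; under eq_fun do rewrite !mxE.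
apply: measurable_funD.
  exact: (measurableT_comp (measurable_rV_coord i) measurable_fst).
by apply: measurable_funM => //; exact: measurable_snd.
Qed.

Lemma measurable_rV_subZ (e : 'rV[R]_n) : measurable_fun setT
  (fun p : 'rV[R]_n * measurableTypeR R => p.1 - p.2 *: e).
Proof.
under eq_fun do rewrite -scalerN.
exact: measurable_rV_addZ.
Qed.

Lemma measurable_rV_add : measurable_fun setT
  (fun p : 'rV[R]_n * 'rV[R]_n => p.1 + p.2).
Proof.
apply/measurable_fun_rVP => i; under eq_fun do rewrite !mxE.
apply: measurable_funD.
  exact: (measurableT_comp (measurable_rV_coord i) measurable_fst).
exact: (measurableT_comp (measurable_rV_coord i) measurable_snd).
Qed.

Let shift_mixin v := isMeasurableFun.Build _ _ _ _ _ (measurable_rV_shift v).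
Let shift v : {mfun 'rV[R]_n >-> 'rV[R]_n} :=
  HB.pack (fun x : 'rV[R]_n => x + v) (shift_mixin v).

(** Translation maps boxes to boxes with the same side lengths, and a measure finite on boxes is
    determined by its values there. *)
Lemma lebesgue_rV_shift v A : measurable A ->
  pushforward mu (shift v) A = mu A.
Proof.
have pre a b : (fun x : 'rV[R]_n => x + v) @^-1` box a b = box (a - v) (b - v).
  by apply/seteqP; split => x /= h i; have := h i; rewrite !mxE;
    rewrite ltrBlDr ltrBrDr.
have E a b : pushforward mu (shift v) (box a b) = mu (box (a - v) (b - v)).
  by rewrite -pre.
move=> mA; apply: measure_unique_box mA => a b /=; rewrite E; last first.
  exact: lebesgue_rV_box_lty.
rewrite !lebesgue_rV_boxE; apply: eq_bigr => i _.
rewrite !lebesgue_measure_itv /= !mxE !lte_fin ltrD2r -!EFinB.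
by congr (if _ then _%:E else _); lra.
Qed.

Local Open Scope ereal_scope.

Lemma ge0_integral_shift v (f : 'rV[R]_n -> \bar R) :
  measurable_fun setT f -> (forall x, 0 <= f x) ->
  \int[mu]_x f (x + v)%R = \int[mu]_x f x.
Proof.
move=> mf f0.
have /= <- := @ge0_integral_pushforward _ _ _ _ R _ (measurable_rV_shift v) mu setT f
  measurableT mf (fun y _ => f0 y).
apply: (@eq_measure_integral _ _ R setT mu (pushforward mu (shift v))) => A mA _.
exact: lebesgue_rV_shift.
Qed.

Lemma integrable_shift v (f : 'rV[R]_n -> \bar R) :
  mu.-integrable setT f -> mu.-integrable setT (fun x => f (x + v)%R).
Proof.
move=> /integrableP[mf fi]; apply/integrableP; split.
  exact: (measurableT_comp mf (measurable_rV_shift v)).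
have mabs : measurable_fun setT (abse \o f) by exact: measurableT_comp.
have -> := ge0_integral_shift v mabs (fun x => abse_ge0 (f x)).
exact: fi.
Qed.

(** Positive and negative parts are shifted separately, so measurability suffices even when both
    have infinite integral. *)
Lemma integral_shift v (f : 'rV[R]_n -> \bar R) : measurable_fun setT f ->
  \int[mu]_x f (x + v)%R = \int[mu]_x f x.
Proof.
move=> mf; rewrite [LHS]integralE [RHS]integralE.
have <- := ge0_integral_shift v (measurable_funepos mf) (funepos_ge0 f).
have <- := ge0_integral_shift v (measurable_funeneg mf) (funeneg_ge0 f).
by congr (_ - _); apply: eq_integral => x _; rewrite ?funeposE ?funenegE.
Qed.

Lemma Rintegral_shift v (f : 'rV[R]_n -> R) : measurable_fun setT f ->
  (\int[mu]_x f (x + v) = \int[mu]_x f x)%R.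
Proof.
by move=> mf; congr fine; rewrite (integral_shift v (f := EFin \o f))//; exact/measurable_EFinP.
Qed.

End translation.

(** * Smooth cutoffs on the line *)

Section smooth_functions.
Variable R : realType.
Implicit Types (u v : R -> R) (x : R).

Fixpoint smooth (k : nat) u : Prop :=
  match k with
  | 0%N => continuous u
  | m.+1 => (forall x, derivable u x 1) /\ smooth m (derive1 u)
  end.

Lemma smooth_continuous k u : smooth k u -> continuous u.
Proof.
case: k => [//|k [du _]] x.
exact/differentiable_continuous/derivable1_diffP.
Qed.

Lemma smoothS k u : smooth k.+1 u -> smooth k u.
Proof.
elim: k u => [u /smooth_continuous//|k IH u [du su]].
by split => //; exact: IH.
Qed.

Lemma smooth_is_derive k u u' : (forall x, is_derive x 1 u (u' x)) ->
  smooth k u' -> smooth k.+1 u.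
Proof.
move=> du su'; split => [x|]; first exact: (@ex_derive _ _ _ _ _ _ _ (du x)).
rewrite (_ : (derive1 u) = u')//; apply/funext => x; rewrite derive1E.
exact: (@derive_val _ _ _ _ _ _ _ (du x)).
Qed.

Lemma derive1P u x : derivable u x 1 -> is_derive x 1 u ((derive1 u) x).
Proof. by move=> du; rewrite derive1E; exact: derivableP. Qed.

Lemma smoothD k u v : smooth k u -> smooth k v -> smooth k (u + v).
Proof.
elim: k u v => [u v /= cu cv x|k IH u v [du su] [dv sv]].
  exact: cvgD (cu x) (cv x).
apply: (@smooth_is_derive _ _ ((derive1 u) + (derive1 v))); last exact: IH.
by move=> x; apply: is_deriveD; exact: derive1P.
Qed.

Lemma smoothM k u v : smooth k u -> smooth k v -> smooth k (u * v).
Proof.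
elim: k u v => [u v /= cu cv x|k IH u v /[dup] su' [du su] /[dup] sv' [dv sv]].
  exact: cvgM (cu x) (cv x).
apply: (@smooth_is_derive _ _ (u * (derive1 v) + v * (derive1 u))); last first.
  by apply: smoothD; apply: IH => //; exact: smoothS.
by move=> x; apply: is_deriveM; exact: derive1P.
Qed.

Lemma smooth_cst k (c : R) : smooth k (cst c).
Proof.
elim: k c => [c x|k IH c]; first exact: cvg_cst.
apply: (@smooth_is_derive _ _ (cst 0)); last exact: IH.
Qed.

Lemma smooth_affine k u (c d : R) : smooth k u ->
  smooth k (fun x => u (c * x + d)).
Proof.
elim: k u => [u cu x|k IH u [du su]].
  apply: continuous_comp; last exact: cu.
  by apply: cvgD; [apply: cvgM; [exact: cvg_cst|exact: cvg_id]|exact: cvg_cst].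
apply: (@smooth_is_derive _ _ ((cst c) * (fun x => (derive1 u) (c * x + d)))); last first.
  by apply: smoothM; [exact: smooth_cst|exact: IH].
move=> x; rewrite (_ : (cst c * _) x = (derive1 u) (c * x + d) * c); last by rewrite mulrC.
apply: (@is_derive1_comp _ u (fun x => c * x + d)); first exact: derive1P.
rewrite (_ : (fun x => c * x + d) = c *: id + cst d)//.
by apply: is_derive_eq; rewrite addr0 /GRing.scale /= mulr1.
Qed.

(* The span of these functions is stable under differentiation. *)
Definition theta (j : nat) x : R :=
  if 0 < x then x^-1 ^+ j * expR (- x^-1) else 0.

Lemma theta_ge0 j x : 0 <= theta j x.
Proof.
by rewrite /theta; case: ifPn => // x0; rewrite mulr_ge0 ?expR_ge0// exprn_ge0// invr_ge0 ltW.
Qed.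

(** With y = 1/x > 0, the exponential series gives e^y >= y^(j+2)/(j+2)!, that is y^(j+1) e^(-y) <=
    (j+2)!/y. *)
Lemma theta_le j x : theta j.+1 x <= j.+2`!%:R * `|x|.
Proof.
rewrite /theta; case: ifPn => [x0|_]; last by rewrite mulr_ge0.
rewrite gtr0_norm// expRN ler_pdivrMr ?expR_gt0//.
have := @expR_ge1Dxn R (x^-1) j.+1.
rewrite invr_ge0 (ltW x0) => /(_ isT).
set k := j.+2`!%:R; have k0 : 0 < k by rewrite ltr0n fact_gt0.
move=> h.
have : x^-1 ^+ j.+2 / k <= expR x^-1 by apply: le_trans h; rewrite lerDr.
rewrite ler_pdivrMr// exprS mulrC ler_pdivrMr//.
move=> /le_trans; apply; rewrite le_eqVlt; apply/orP; left; apply/eqP.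
by ring.
Qed.

Lemma is_derive_theta j x :
  is_derive x 1 (theta j) (theta j.+2 x - j%:R * theta j.+1 x).
Proof.
have [x0|x0|<-] := ltgtP 0 x.
- have E : \near x, x^-1 ^+ j * expR (- x^-1) = theta j x.
    near=> z; rewrite /theta ifT//; near: z; exact: lt_nbhsr.
  apply: near_eq_is_derive E _.
  have xn0 : x != 0 by rewrite gt_eqF.
  have dV : is_derive x 1 (fun y : R => y^-1) (- x ^- 2).
    by have := @is_deriveV R id x 1 1 xn0 (is_derive_id _ _); rewrite [_ *: _]mulr1.
  have dX : is_derive x 1 (fun y : R => y^-1 ^+ j) (- (j%:R * x^-1 ^+ j.+1)).
    case: j => [|j]; first by rewrite mul0r oppr0; exact: is_derive_cst.
    have := @is_deriveX _ _ (fun y : R => y^-1) j.+1 x 1 _ dV.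
    rewrite /GRing.scale /= mulrN -exprVn -mulrA -exprD addn2.
    by congr is_derive; apply/funext => y; rewrite exprfctE.
  have dE : is_derive x 1 (fun y : R => expR (- y^-1)) (expR (- x^-1) * x ^- 2).
    apply: (@is_derive1_comp _ expR (fun y : R => - y^-1)).
    by have := @is_deriveN _ _ _ _ _ _ _ dV; rewrite opprK.
  have := is_deriveM dX dE; congr is_derive.
  rewrite /theta x0 /GRing.scale /= -exprVn.
  rewrite [x^-1 ^+ j.+2]exprSr [x^-1 ^+ j.+1]exprSr.
  ring.
- apply: (@near_eq_is_derive _ _ _ (cst 0)).
    by near=> z; rewrite /theta ifF//; apply/negbTE; rewrite -leNgt ltW//; near: z; exact: lt_nbhsl.
  by rewrite /theta ltNge (ltW x0)/= mulr0 subr0; exact: is_derive_cst.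
- rewrite [theta j.+2 0]/theta [theta j.+1 0]/theta ltxx mulr0 subr0.
  suff H : (fun h : R => h^-1 *: (theta j (h *: 1 + 0) - theta j 0)) @ 0^' --> (0 : R).
    apply: DeriveDef; first by apply/cvg_ex; exists 0.
    exact/cvg_lim.
  (* The difference quotient of [theta j] at 0 equals [theta j.+1 h] for h > 0 and 0 for h < 0, so
     [theta_le] makes it tend to 0. *)
  have H (h : R) : h != 0 -> `|h^-1 *: (theta j (h *: 1 + 0) - theta j 0)| <= j.+2`!%:R * `|h|.
    move=> h0; rewrite addr0 [h *: 1]mulr1 [X in _ - X]/theta ltxx subr0.
    apply: le_trans (theta_le j h); rewrite /GRing.scale /=.
    rewrite /theta; case: ifPn => [hp|_]; last by rewrite mulr0 normr0.
    by rewrite mulrA -exprS ger0_norm// mulr_ge0 ?expR_ge0// exprn_ge0// invr_ge0 ltW.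
  have C0 : 0 < j.+2`!%:R :> R by rewrite ltr0n fact_gt0.
  apply/cvgr0Pnorm_le => e e0; near=> h.
  have h0 : h != 0 by near: h; exact: nbhs_dnbhs_neq.
  apply: le_trans (H h h0) _; rewrite mulrC -ler_pdivlMr//.
  by near: h; apply: dnbhs0_le; rewrite divr_gt0.
Unshelve. all: by end_near. Qed.

Lemma smooth_theta k j : smooth k (theta j).
Proof.
elim: k j => [|k IH] j.
  move=> x; apply: differentiable_continuous; apply/derivable1_diffP.
  exact: (@ex_derive _ _ _ _ _ _ _ (is_derive_theta j x)).
apply: (@smooth_is_derive _ _ (theta j.+2 + cst (- j%:R) * theta j.+1)).
  by move=> x; have := is_derive_theta j x; rewrite -mulNr.
by apply: smoothD => //; apply: smoothM => //; exact: smooth_cst.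
Qed.

(** A product of two one-sided functions exp(-1/t), t > 0. It never equals 1; stretching the
    argument by m+1 makes it converge pointwise to the indicator of ]a, b[ while staying in [0, 1],
    which suits dominated convergence. *)
Definition cutoff (a b : R) (m : nat) x : R :=
  theta 0 (m.+1%:R * (x - a)) * theta 0 (m.+1%:R * (b - x)).

Lemma smooth_bump k a b m : smooth k (cutoff a b m).
Proof.
apply: smoothM.
  have := @smooth_affine k (theta 0) m.+1%:R (- (m.+1%:R * a)) (smooth_theta k 0).
  by under eq_fun do rewrite -mulrBr.
have := @smooth_affine k (theta 0) (- m.+1%:R) (m.+1%:R * b) (smooth_theta k 0).
by under eq_fun do rewrite mulNr addrC -mulrBr.
Qed.

Lemma theta0_le1 x : theta 0 x <= 1.
Proof.
rewrite /theta; case: ifPn => // x0.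
by rewrite mul1r -expR0 ler_expR oppr_le0 invr_ge0 ltW.
Qed.

Lemma bump_ge0 a b m x : 0 <= cutoff a b m x.
Proof. by rewrite mulr_ge0 ?theta_ge0. Qed.

Lemma bump_le1 a b m x : cutoff a b m x <= 1.
Proof. by rewrite mulr_ile1 ?theta_ge0 ?theta0_le1. Qed.

Lemma bump_neq0 a b m x : cutoff a b m x != 0 -> a < x < b.
Proof.
rewrite mulf_eq0 negb_or /theta => /andP[].
case: ifPn => [|_]; last by rewrite eqxx.
rewrite pmulr_rgt0// subr_gt0 => -> _.
case: ifPn => [|_]; last by rewrite eqxx.
by rewrite pmulr_rgt0// subr_gt0 => -> _.
Qed.

Lemma cvg_theta0 x : 0 < x -> theta 0 (m.+1%:R * x) @[m --> \oo] --> (1 : R).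
Proof.
move=> x0.
rewrite (_ : (fun m => _) = (fun m : nat => expR (- (m.+1%:R^-1 * x^-1)))).
  suff : expR (- (m.+1%:R^-1 * x^-1)) @[m --> \oo] --> expR (- (0 * x^-1)).
    by rewrite mul0r oppr0 expR0.
  apply: continuous_cvg; first exact: continuous_expR.
  apply: cvgN; apply: cvgM; last exact: cvg_cst.
  exact: cvg_harmonic.
apply/funext => m; rewrite /theta mulr_gt0// mul1r invfM//.
Qed.

Lemma cvg_bump a b x : cutoff a b m x @[m --> \oo] --> (\1_`]a, b[ x : R).
Proof.
rewrite indicE; have [|xab] := boolP (x \in `]a, b[%classic).
  rewrite inE /= in_itv /= => /andP[ax xb].
  by rewrite -[1%:R]mulr1; apply: cvgM; apply: cvg_theta0; rewrite subr_gt0.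
apply: cvg_near_cst; apply: nearW => m; apply/eqP; apply: contraNT xab => /bump_neq0.
by rewrite inE /= in_itv.
Qed.

End smooth_functions.

(** * Tensor products of cutoffs *)

Section tensor_products.
Variable R : realType.

Lemma is_derive_prod (V : normedModType R) (I : eqType) (s : seq I)
    (f : I -> V -> R) (df : I -> R) (x v : V) : uniq s ->
  (forall i, is_derive x v (f i) (df i)) ->
  is_derive x v (fun y => \prod_(i <- s) f i y)
    (\sum_(i <- s) \prod_(j <- s) (if j == i then df j else f j x)).
Proof.
move=> + dfx; elim: s => [_|i s IH /= /andP[si us]].
  under eq_fun do rewrite big_nil.
  by rewrite big_nil; exact: is_derive_cst.
under eq_fun do rewrite big_cons.
have := is_deriveM (dfx i) (IH us); congr is_derive.
rewrite big_cons big_cons eqxx addrC /GRing.scale /=; congr (_ + _).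
  rewrite mulrC; congr (_ * _); apply: eq_big_seq => j js.
  by case: eqP => // ji; move: si; rewrite -ji js.
rewrite mulr_sumr; apply: eq_big_seq => j js.
by rewrite big_cons; case: eqP => // ij; move: si; rewrite ij js.
Qed.

Variable n : nat.
Implicit Types (u : 'I_n -> R -> R) (x v w : 'rV[R]_n).

Lemma is_derive_line (u : R -> R) (x c : R) : derivable u x 1 ->
  is_derive x c u (c * derive1 u x).
Proof.
move=> du; have /derivable1_diffP d := du.
apply: DeriveDef; first exact: diff_derivable.
rewrite deriveE// derive1E' //.
have {1}-> : c = c *: 1 by rewrite /GRing.scale /= mulr1.
by rewrite linearZ.
Qed.

Lemma is_derive_coord (u : R -> R) x v i : derivable u (x ord0 i) 1 ->
  is_derive x v (fun y : 'rV[R]_n => u (y ord0 i))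
    (v ord0 i * derive1 u (x ord0 i)).
Proof.
move=> /(@is_derive_line _ _ (v ord0 i))[du dE].
have E : (fun h : R => h^-1 *: (((fun y : 'rV[R]_n => u (y ord0 i)) \o shift x) (h *: v) -
     u (x ord0 i))) =
   (fun h => h^-1 *: ((u \o shift (x ord0 i)) (h *: v ord0 i) - u (x ord0 i))).
  by apply/funext => h /=; rewrite !mxE.
apply: DeriveDef; first by rewrite /derivable E.
by rewrite -dE /derive E.
Qed.

Definition tensor u x : R := \prod_i u i (x ord0 i).

Definition dtensor (j : 'I_n) u : 'I_n -> R -> R :=
  fun i => if i == j then derive1 (u i) else u i.

Lemma is_derive_tensor u x v : (forall i t, derivable (u i) t 1) ->
  is_derive x v (tensor u) (\sum_j v ord0 j * tensor (dtensor j u) x).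
Proof.
move=> du.
have := @is_derive_prod _ _ (index_enum 'I_n)
  (fun i (y : 'rV[R]_n) => u i (y ord0 i)) (fun i => v ord0 i * derive1 (u i) (x ord0 i)) x v
  (index_enum_uniq _) (fun i => is_derive_coord v (du i _)).
congr is_derive; apply: eq_bigr => j _; rewrite /tensor (bigD1 j)//= eqxx.
rewrite [in RHS](bigD1 j)//= /dtensor eqxx mulrA; congr (_ * _).
by apply: eq_bigr => i /negPf ->.
Qed.

Lemma is_derive_tensor_line u (x e : 'rV[R]_n) (t : R) :
  (forall i t, derivable (u i) t 1) ->
  is_derive t 1 (fun t : R => tensor u (x - t *: e))
    (- \sum_j e ord0 j * tensor (dtensor j u) (x - t *: e)).
Proof.
move=> du; have [d dE] := is_derive_tensor (x - t *: e) (- e) du.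
have E : (fun h : R => h^-1 *: (((fun t : R => tensor u (x - t *: e)) \o shift t) (h *: 1) -
     tensor u (x - t *: e))) =
   (fun h => h^-1 *: ((tensor u \o shift (x - t *: e)) (h *: - e) - tensor u (x - t *: e))).
  have h1 (h : R) : h *: (1 : R) = h by rewrite /GRing.scale /= mulr1.
  apply/funext => h /=; rewrite h1; congr (_ *: (tensor u _ - _)).
  by rewrite scalerDl opprD scalerN addrCA addrC.
apply: DeriveDef; first by rewrite /derivable E.
transitivity ('D_(- e) (tensor u) (x - t *: e)); first by rewrite /derive E.
by rewrite dE -sumrN; apply: eq_bigr => j _; rewrite mxE mulNr.
Qed.

Lemma partial_tensor (j : 'I_n) u : (forall i t, derivable (u i) t 1) ->
  partial j (tensor u) = tensor (dtensor j u).
Proof.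
move=> du; apply/funext => x; rewrite /partial.
have [_ ->] := is_derive_tensor x (delta_mx ord0 j) du.
rewrite (bigD1 j)//= mxE !eqxx mul1r big1 ?addr0// => i ij.
by rewrite mxE (negPf ij) mul0r.
Qed.

Lemma continuous_tensor u : (forall i, continuous (u i)) -> continuous (tensor u).
Proof.
move=> cu; rewrite /tensor; elim: (index_enum _) => [|i s IH] x.
  rewrite (_ : (fun _ => _) = cst 1); first exact: cst_continuous.
  by apply/funext => y; rewrite big_nil.
rewrite (_ : (fun _ => _) = (fun y : 'rV[R]_n => u i (y ord0 i)) *
    (fun y : 'rV[R]_n => \prod_(j <- s) u j (y ord0 j))); last first.
  by apply/funext => y; rewrite big_cons.
apply: continuousM; last exact: IH.
apply: (@continuous_comp _ _ _ (fun x : 'rV[R]_n => x ord0 i)); last exact: cu.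
exact: coord_continuous.
Qed.

Lemma smooth_dtensor (j : 'I_n) u : (forall k i, smooth k (u i)) ->
  forall k i, smooth k (dtensor j u i).
Proof.
by move=> su k i; rewrite /dtensor; case: ifP => // _; case: (su k.+1 i).
Qed.

(** The induction on [k] ranges over all families [u], because a partial derivative of a tensor is
    the tensor of another smooth family, [dtensor j u]. *)
Lemma class_C_tensor k u : (forall k i, smooth k (u i)) -> class_C k (tensor u).
Proof.
elim: k u => [|k IH] u su /=.
  by split => //; apply: continuous_tensor => i; exact: smooth_continuous (su 0%N i).
split; first by apply: continuous_tensor => i; exact: smooth_continuous (su 0%N i).
have du i t : derivable (u i) t 1 by case: (su 1%N i).
move=> j; split => [x|]; first by have [] := is_derive_tensor x (delta_mx ord0 j) du.
by rewrite partial_tensor//; apply: IH; exact: smooth_dtensor.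
Qed.

Lemma compact_cbox (a b : 'rV[R]_n) : compact (cbox a b).
Proof.
have := @rV_compact R n (fun i => `[a ord0 i, b ord0 i]%classic)
  (fun i => @segment_compact R _ _).
congr compact; apply/seteqP; split => x /= h i; have := h i; by rewrite in_itv.
Qed.

Lemma test_tensor u (a b : 'rV[R]_n) (O : set 'rV[R]_n) :
  (forall k i, smooth k (u i)) ->
  (forall i t, u i t != 0 -> a ord0 i <= t <= b ord0 i) ->
  cbox a b `<=` O -> test_function O (tensor u).
Proof.
move=> su u0 abO.
have clo : closed (cbox a b).
  by apply: compact_closed; [exact: norm_hausdorff|exact: compact_cbox].
have S : Defs.support (tensor u) `<=` cbox a b.
  rewrite [X in _ `<=` X]((closure_id _).1 clo); apply: closure_subset => x /=.
  by move=> /prodf_neq0 h i; apply: u0; exact: h.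
split.
- by move=> k; exact: class_C_tensor.
- by apply: (@subclosed_compact _ _ (cbox a b)) => //; [exact: closed_closure|exact: compact_cbox].
- exact: subset_trans S abO.
Qed.

Definition bumps (a b : 'rV[R]_n) (m : nat) : 'I_n -> R -> R :=
  fun i => cutoff (a ord0 i) (b ord0 i) m.

Lemma smooth_bumps a b m k i : smooth k (bumps a b m i).
Proof. exact: smooth_bump. Qed.

Lemma tensor_bumps_ge0 a b m x : 0 <= tensor (bumps a b m) x.
Proof. by apply: prodr_ge0 => i _; exact: bump_ge0. Qed.

Lemma tensor_bumps_le1 a b m x : tensor (bumps a b m) x <= 1.
Proof.
by apply: prodr_ile1 => i _; rewrite bump_ge0 bump_le1.
Qed.

Lemma cvg_tensor_bumps (a b : 'rV[R]_n) x :
  tensor (bumps a b m) x @[m --> \oo] --> (\1_(box a b) x : R).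
Proof.
have -> : \1_(box a b) x = \prod_i (\1_`]a ord0 i, b ord0 i[ (x ord0 i) : R).
  rewrite indicE; have [xab|xab] := boolP (x \in box a b).
    rewrite big1// => i _; rewrite indicE mem_set//=.
    by rewrite in_itv /=; move: xab; rewrite inE; apply.
  apply/eqP; rewrite eq_sym; apply: contraNT xab => /prodf_neq0 h.
  rewrite inE => i; have := h i isT; rewrite indicE pnatr_eq0 eqb0 negbK inE /=.
  by rewrite in_itv.
rewrite /tensor; elim: (index_enum _) => [|i s IH].
  by under eq_fun do rewrite big_nil; rewrite big_nil; exact: cvg_cst.
under eq_fun do rewrite big_cons; rewrite big_cons.
by apply: cvgM => //; exact: cvg_bump.
Qed.

End tensor_products.

(** * Fundamental lemma of the calculus of variations *)

Section fundamental_lemma.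
Variables (R : realType) (n : nat).
Local Notation mu := (lebesgue_rV R n).
Implicit Types (a b x : 'rV[R]_n) (O : set 'rV[R]_n) (h : 'rV[R]_n -> R).

Lemma measurable_tensor (u : 'I_n -> R -> R) : (forall k i, smooth k (u i)) ->
  measurable_fun setT (tensor u).
Proof.
move=> su; apply: continuous_measurable_rV; apply: continuous_tensor => i.
exact: smooth_continuous (su 0%N i).
Qed.

Lemma integrable_bounded_mul h (p : 'rV[R]_n -> R) (M : R) :
  mu.-integrable setT (EFin \o h) -> measurable_fun setT p ->
  (forall x, `|p x| <= M) ->
  mu.-integrable setT (fun x => (h x * p x)%:E).
Proof.
move=> ih mp pM.
have ih' := integrableZl measurableT M ih.
apply: le_integrable ih' => //.
  apply/measurable_EFinP; apply: measurable_funM => //.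
  by apply/measurable_EFinP; exact: measurable_int ih.
move=> x _ /=; rewrite lee_fin !normrM mulrC.
by rewrite ler_wpM2r// (le_trans (pM x))// ler_norm.
Qed.

(** The cutoffs tend to the indicator of the box, and |h| dominates the integrands. *)
Lemma integral_box_eq0 h a b : mu.-integrable setT (EFin \o h) ->
  (forall m, \int[mu]_x (h x * tensor (bumps a b m) x) = 0) ->
  (\int[mu]_(x in box a b) (h x)%:E = 0)%E.
Proof.
move=> ih h0.
have mh : measurable_fun setT h by apply/measurable_EFinP; exact: measurable_int ih.
have it m : mu.-integrable setT (fun x => (h x * tensor (bumps a b m) x)%:E).
  apply: (@integrable_bounded_mul _ _ 1) => //.
    by apply: measurable_tensor => k i; exact: smooth_bumps.
  by move=> x; rewrite ger0_norm ?tensor_bumps_ge0// tensor_bumps_le1.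
have ih' : mu.-integrable setT (fun x => `|(h x)%:E|)%E.
  exact: integrable_abse ih.
have [] := @dominated_convergence _ _ R mu setT measurableT
  (fun m x => (h x * tensor (bumps a b m) x)%:E)
  (fun x => (h x * \1_(box a b) x)%:E) (fun x => `|(h x)%:E|)%E.
- by move=> m; exact: measurable_int (it m).
- apply/measurable_EFinP; apply: measurable_funM => //.
  by apply: measurable_indic; exact: measurable_box.
- apply: aeW => x _; apply: cvg_EFin; first exact: nearW.
  by apply: cvgM; [exact: cvg_cst|exact: cvg_tensor_bumps].
- exact: ih'.
- apply: aeW => x m _; rewrite /= lee_fin normrM ler_piMr//.
  by rewrite ger0_norm ?tensor_bumps_ge0// tensor_bumps_le1.
move=> _ _; set I := (\int[_]_(x in _) _)%E => cI.
have : (fun m => \int[mu]_x (h x * tensor (bumps a b m) x)%:E)%E @ \oo --> (0 : \bar R)%E.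
  apply: cvg_near_cst; apply: nearW => m; apply/eqP.
  have /eqP := h0 m; rewrite /Rintegral fine_eq0//.
  exact: integrable_fin_num (it m).
move=> /(cvg_unique _ cI) I0; rewrite -[RHS]I0 // integral_mkcond.
apply: eq_integral => x _; rewrite restrict_EFin; congr EFin.
by rewrite /patch indicE; case: ifPn; rewrite ?mulr1 ?mulr0.
Qed.

Lemma box_eq0_ae h a b : mu.-integrable setT (EFin \o h) ->
  (forall a' b', (forall i, a ord0 i <= a' ord0 i) ->
    (forall i, b' ord0 i <= b ord0 i) ->
    (\int[mu]_(x in box a' b') (h x)%:E = 0)%E) ->
  {ae mu, forall x, box a b x -> h x = 0}.
Proof.
move=> ih h0; have mB := measurable_box a b.
have ihB : mu.-integrable (box a b) (EFin \o h).
  exact: integrableS ih.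
(* Dynkin induction over the pi-system of boxes: the sets whose trace on [box a b] carries zero
   integral are stable under complement, because the whole box does, and under countable disjoint
   union. *)
have H A : measurable A -> (\int[mu]_(x in A `&` box a b) (h x)%:E = 0)%E.
  rewrite measurable_boxes; move: A; apply: dynkin_induction.
  - exact: measurable_boxes.
  - by move=> _ _ [a1 [b1 ->]] [a2 [b2 ->]]; rewrite box_setI; do 2 eexists.
  - by rewrite setTI; apply: h0.
  - move=> _ [a1 [b1 ->]]; rewrite box_setI; apply: h0 => i.
      by rewrite mxE le_max lexx orbT.
    by rewrite mxE ge_min lexx orbT.
  - move=> S mS S0.
    have := h0 a b (fun=> lexx _) (fun=> lexx _).
    rewrite -{1}[box a b](setIT) -(setUv S) setIUr integral_setU//.
    + by rewrite [box a b `&` S]setIC S0 add0e setIC.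
    + exact: measurableI.
    + by apply: measurableI => //; exact: measurableC.
    + by rewrite -setIUr setUv setIT; exact: measurable_int ihB.
    + by apply/disj_setPS => x [[_ ?] [_ ?]].
  - move=> F mF tF F0; rewrite setI_bigcupl integral_bigcup.
    + by rewrite eseries0// => i _ _; exact: F0.
    + exact: trivIset_setIr.
    + by move=> k; exact: measurableI.
    + apply: integrableS ih => //; apply: bigcup_measurable => k _.
      exact: measurableI.
have : ae_eq mu (box a b) (EFin \o h) (cst 0%E).
  apply: integral_ae_eq => // E EB mE.
  by rewrite integral0 -[E](setIidl EB) H.
by apply: filterS => x /= + xB => /(_ xB) [].
Qed.

(** Countably many cubes with closure in [O] cover it, so it suffices that [h] vanishes almost
    everywhere in each. There every sub-box again has its closure in [O], hence yields admissible
    test functions. *)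
Lemma fundamental_lemma h O : open O -> mu.-integrable setT (EFin \o h) ->
  (forall a b m, cbox a b `<=` O ->
    \int[mu]_x (h x * tensor (bumps a b m) x) = 0) ->
  {ae mu, forall x, O x -> h x = 0}.
Proof.
move=> oO ih h0.
have H k : mu.-negligible [set x | cbox (qbox R n k).1 (qbox R n k).2 `<=` O /\
    box (qbox R n k).1 (qbox R n k).2 x /\ h x != 0].
  have [kO|kO] := pselect (cbox (qbox R n k).1 (qbox R n k).2 `<=` O); last first.
    by apply: (negligibleS _ (negligible_set0 mu)) => x [/kO].
  have : {ae mu, forall x, box (qbox R n k).1 (qbox R n k).2 x -> h x = 0}.
    apply: box_eq0_ae => // a' b' aa' bb'; apply: integral_box_eq0 => // m.
    apply: h0 => x xab; apply: kO => i; have /andP[? ?] := xab i.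
    by rewrite (le_trans (aa' i))//= (le_trans _ (bb' i)).
  apply: negligibleS => x [_ [xk hx]] /= /(_ xk); exact/eqP.
apply: (negligibleS _ (negligible_bigcup H)) => x /= /not_implyP[Ox /eqP hx].
by have [k [kx kO]] := qbox_cover oO Ox; exists k.
Qed.

End fundamental_lemma.

(** * Derivatives of tensors along lines *)

Section compactly_supported_tensors.
Variable R : realType.

Lemma derive1_supp (u : R -> R) (a b t : R) :
  (forall s, u s != 0 -> a <= s <= b) -> derive1 u t != 0 -> a <= t <= b.
Proof.
move=> u0; apply: contraNT; rewrite negb_and -!ltNge => tab.
rewrite derive1E (_ : 'D_1 u t = 'D_1 (cst 0) t); first by rewrite derive_val.
apply: near_eq_derive; case/orP: tab => tab.
  near=> s; apply/eqP; apply: contraT => us; have /andP[+ _] := u0 s us.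
  by rewrite leNgt => /negP h; exfalso; apply: h; near: s; exact: lt_nbhsl.
near=> s; apply/eqP; apply: contraT => us; have /andP[_] := u0 s us.
by rewrite leNgt => /negP h; exfalso; apply: h; near: s; exact: lt_nbhsr.
Unshelve. all: by end_near. Qed.

Lemma bounded_supp (u : R -> R) (a b : R) : continuous u ->
  (forall s, u s != 0 -> a <= s <= b) -> exists M, forall t, `|u t| <= M.
Proof.
move=> cu u0.
have [ab|ba] := leP a b; last first.
  exists 0 => t; have [->|/u0 /andP[at_ tb]] := eqVneq (u t) 0; first by rewrite normr0.
  by move: ba; rewrite ltNge (le_trans at_ tb).
have [c _ hc] := @EVT_max R (fun t => `|u t|) a b ab
  (continuous_subspaceT (fun t => continuous_comp (cu t) (@norm_continuous _ _ (u t)))).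
exists `|u c| => t; have [->|/u0 tab] := eqVneq (u t) 0; first by rewrite normr0.
by apply: hc; rewrite in_itv.
Qed.

Lemma derive1_shift (u : R -> R) (c t : R) :
  derive1 (fun s => u (s - c)) t = derive1 u (t - c).
Proof.
rewrite /derive1; set f1 := (fun h : R => _); set f2 := (fun h : R => _).
by suff -> : f1 = f2 by []; apply/funext => h; rewrite /f1 /f2 addrA.
Qed.

Variable n : nat.
Implicit Types (u : 'I_n -> R -> R) (x y e : 'rV[R]_n).

Lemma tensor_bounded u (a b : 'rV[R]_n) : (forall i, continuous (u i)) ->
  (forall i t, u i t != 0 -> a ord0 i <= t <= b ord0 i) ->
  exists M, forall x, `|tensor u x| <= M.
Proof.
move=> cu u0.
have /choice[M hM] i : exists M, forall t, `|u i t| <= M.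
  exact: bounded_supp (cu i) (u0 i).
exists (\prod_i M i) => x; rewrite /tensor normr_prod.
by apply: ler_prod => i _; rewrite normr_ge0 hM.
Qed.

Lemma dtensor_supp u (a b : 'rV[R]_n) j :
  (forall i t, u i t != 0 -> a ord0 i <= t <= b ord0 i) ->
  forall i t, dtensor j u i t != 0 -> a ord0 i <= t <= b ord0 i.
Proof.
move=> u0 i t; rewrite /dtensor; case: ifP => _; last exact: u0.
by apply: derive1_supp => s; exact: u0.
Qed.

(** The derivative of [tensor u] at [y] in the direction [e], written through partial derivatives so
    that the weak gradient can be tested term by term. *)
Definition dline e u y : R := \sum_j e ord0 j * tensor (dtensor j u) y.

Lemma dline_bounded e u (a b : 'rV[R]_n) : (forall k i, smooth k (u i)) ->
  (forall i t, u i t != 0 -> a ord0 i <= t <= b ord0 i) ->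
  exists M, forall x, `|dline e u x| <= M.
Proof.
move=> su u0.
have /choice[M hM] j : exists M, forall x, `|tensor (dtensor j u) x| <= M.
  apply: (@tensor_bounded _ a b); last exact: dtensor_supp.
  by move=> i; exact: smooth_continuous (smooth_dtensor j su 0%N i).
exists (\sum_j `|e ord0 j| * M j) => x.
apply: le_trans (ler_norm_sum _ _ _) _; apply: ler_sum => j _.
by rewrite normrM ler_wpM2l.
Qed.

Lemma continuous_dline e u : (forall k i, smooth k (u i)) -> continuous (dline e u).
Proof.
move=> su; rewrite /dline; elim: (index_enum _) => [|j s IH].
  rewrite (_ : (fun _ => _) = cst 0); first exact: cst_continuous.
  by apply/funext => y; rewrite big_nil.
rewrite (_ : (fun _ => _) = (fun y => e ord0 j * tensor (dtensor j u) y) +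
    (fun y => \sum_(j <- s) e ord0 j * tensor (dtensor j u) y)); last first.
  by apply/funext => y; rewrite big_cons.
move=> y; apply: continuousD; last exact: IH.
apply: continuousM; first exact: cst_continuous.
apply: continuous_tensor => i.
exact: smooth_continuous (smooth_dtensor j su 0%N i).
Qed.

Definition shift_fam u (w : 'rV[R]_n) : 'I_n -> R -> R :=
  fun i s => u i (s - w ord0 i).

Lemma smooth_shift_fam u w : (forall k i, smooth k (u i)) ->
  forall k i, smooth k (shift_fam u w i).
Proof.
move=> su k i; have := @smooth_affine _ k (u i) 1 (- w ord0 i) (su k i).
by rewrite /shift_fam; under eq_fun do rewrite mul1r.
Qed.

Lemma tensor_shift u w y : tensor (shift_fam u w) y = tensor u (y - w).
Proof. by apply: eq_bigr => i _; rewrite /shift_fam !mxE. Qed.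

Lemma dtensor_shift j u w y :
  tensor (dtensor j (shift_fam u w)) y = tensor (dtensor j u) (y - w).
Proof.
apply: eq_bigr => i _; rewrite /dtensor !mxE; case: eqP => // _.
by rewrite derive1_shift.
Qed.

Lemma shift_fam_supp u w (a b : 'rV[R]_n) :
  (forall i t, u i t != 0 -> a ord0 i <= t <= b ord0 i) ->
  forall i t, shift_fam u w i t != 0 -> (a + w) ord0 i <= t <= (b + w) ord0 i.
Proof. by move=> u0 i t /u0; rewrite !mxE lerBrDr lerBlDr. Qed.

Lemma continuous_line y e : continuous (fun t : R => y - t *: e).
Proof.
by move=> t; apply: cvgB; [exact: cvg_cst|apply: cvgZr_tmp; exact: cvg_id].
Qed.

(** The function [- tensor u (y - t *: e)] is a primitive in t; moving backwards along [e] supplies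
    the minus sign. The indicator prepares an application of Fubini on the whole line. *)
Lemma Rintegral_dline (tau : R) e u y : 0 < tau -> (forall k i, smooth k (u i)) ->
  \int[lebesgue_measure]_t (\1_`[0, tau] t * dline e u (y - t *: e)) =
  tensor u y - tensor u (y - tau *: e).
Proof.
move=> tau0 su.
have du i t : derivable (u i) t 1 by case: (su 1%N i).
have D (t : R) : is_derive t 1 (fun t : R => - tensor u (y - t *: e)) (dline e u (y - t *: e)).
  by have := is_deriveN (is_derive_tensor_line y e t du); rewrite opprK.
have cf : continuous (fun t : R => dline e u (y - t *: e)).
  move=> t; apply: continuous_comp; first exact: continuous_line.
  exact: continuous_dline.
have cF : continuous (fun t : R => - tensor u (y - t *: e)).
  move=> t; apply: differentiable_continuous; apply/derivable1_diffP.
  exact: (@ex_derive _ _ _ _ _ _ _ (D t)).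
have := @continuous_FTC2 R (fun t => dline e u (y - t *: e))
  (fun t => - tensor u (y - t *: e)) 0 tau tau0 (continuous_subspaceT cf).
rewrite scale0r subr0 -EFinB opprK addrC => h.
rewrite /Rintegral (_ : (\int[_]_x _)%E = (tensor u y - tensor u (y - tau *: e))%:E)//.
rewrite -h.
- rewrite [RHS]integral_mkcond; apply: eq_integral => t _.
  by rewrite /patch indicE; case: ifP => _; rewrite ?mul1r ?mul0r.
- split.
  + by move=> t _; exact: (@ex_derive _ _ _ _ _ _ _ (D t)).
  + have := cF 0; rewrite /continuous_at scale0r subr0.
    exact: cvg_at_right_filter.
  + by apply: cvg_at_left_filter; exact: cF.
- move=> t _; rewrite derive1E.
  exact: (@derive_val _ _ _ _ _ _ _ (D t)).
Qed.

End compactly_supported_tensors.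

(** * Absolute continuity along lines *)

Section real_scaling.
Context d (T : measurableType d) (R : realType) (m : {measure set T -> \bar R}).

Lemma ge0_integralZ_real (k : R) (f : T -> R) : 0 <= k -> measurable_fun setT f ->
  (forall x, 0 <= f x) ->
  (\int[m]_x (k * f x)%:E = k%:E * \int[m]_x (f x)%:E)%E.
Proof.
move=> k0 mf f0; under eq_integral do rewrite EFinM.
by rewrite ge0_integralZl_EFin// => [x _|]; [rewrite lee_fin|exact/measurable_EFinP].
Qed.

(** For k > 0 an infinite part stays infinite after scaling, and [fine] then gives 0 on both sides.
    This serves slices that are known to be integrable only almost everywhere. *)
Lemma ge0_RintegralZl (k : R) (f : T -> R) : 0 <= k -> measurable_fun setT f ->
  \int[m]_x (k * f x) = k * \int[m]_x f x.
Proof.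
rewrite le_eqVlt => /predU1P[<-|k0] mf.
  under eq_Rintegral do rewrite mul0r.
  by rewrite Rintegral_cst// !mul0r.
rewrite /Rintegral integralE [in RHS]integralE.
have -> : (\int[m]_x (fun x => (k * f x)%:E)^\+ x = k%:E * \int[m]_x (EFin \o f)^\+ x)%E.
  rewrite -ge0_integralZl_EFin//; last 2 first.
  - by apply: measurable_funepos; exact/measurable_EFinP.
  - exact: ltW.
  by apply: eq_integral => x _; rewrite !funeposE /= EFinM maxe_pMr ?lee_fin ?ltW// mule0.
have -> : (\int[m]_x (fun x => (k * f x)%:E)^\- x = k%:E * \int[m]_x (EFin \o f)^\- x)%E.
  rewrite -ge0_integralZl_EFin//; last 2 first.
  - by apply: measurable_funeneg; exact/measurable_EFinP.
  - exact: ltW.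
  by apply: eq_integral => x _; rewrite !funenegE /= -mulrN EFinM maxe_pMr ?lee_fin ?ltW// mule0.
set a := (\int[m]_x _)%E; set b := (\int[m]_x _)%E.
have a0 : (0 <= a)%E by exact: integral_ge0.
have b0 : (0 <= b)%E by exact: integral_ge0.
move: a b a0 b0 => [a| |] [b| |]//= _ _; rewrite ?gt0_mulye ?gt0_muley ?lte_fin//=.
- by rewrite mulrBr.
- by rewrite mulr0.
- by rewrite mulr0.
- by rewrite mulr0.
Qed.

End real_scaling.

Section line_formula.
Variables (R : realType) (n : nat).
Local Notation mu := (lebesgue_rV R n).
Local Notation lam := (@lebesgue_measure R).
Implicit Types (x y e : 'rV[R]_n).

Lemma Rintegral_sum (I : Type) (s : seq I) (h : I -> 'rV[R]_n -> R) :
  (forall i, mu.-integrable setT (EFin \o h i)) ->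
  \int[mu]_x (\sum_(i <- s) h i x) = \sum_(i <- s) \int[mu]_x h i x.
Proof.
move=> ih; elim: s => [|i s IH].
  under eq_Rintegral do rewrite big_nil.
  by rewrite big_nil Rintegral_cst// mul0r.
under eq_Rintegral do rewrite big_cons.
rewrite big_cons RintegralD ?IH//.
rewrite (_ : _ \o _ = (fun x => \sum_(j <- s) (h j x)%:E)%E).
  by apply: integrable_sum => // i0 _; exact: ih.
by apply/funext => x /=; rewrite sumEFin.
Qed.

Lemma lebesgue_measure_itv_lty (a b : R) : (lam `[a, b]%classic < +oo)%E.
Proof. by rewrite lebesgue_measure_itv/=; case: ifPn => _; rewrite // -EFinB ltry. Qed.

(** Supplies the finiteness hypothesis of Fubini: each slice has L1 norm at most [c], and nothing
    survives outside [0, tau]. *)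
Lemma iterated_integral_lty (tau c : R) (H : 'rV[R]_n * measurableTypeR R -> R) :
  measurable_fun setT H ->
  (forall t, (\int[mu]_x `|H (x, t)|%:E <= (c * \1_`[0, tau] t)%:E)%E) ->
  (\int[lam]_t \int[mu]_x `|H (x, t)|%:E < +oo)%E.
Proof.
move=> mH Hc.
have mI : measurable_fun setT (\1_`[0, tau] : R -> R).
  by apply: measurable_indic; exact: measurable_itv.
have c1 t : t \in `[0, tau] -> 0 <= c.
  move=> tt; have := Hc t; rewrite indicE mem_set//= mulr1 -lee_fin.
  by apply: le_trans; exact: integral_ge0.
apply: (@le_lt_trans _ _ (\int[lam]_t (`|c| * \1_`[0, tau] t)%:E)%E).
  apply: ge0_le_integral => //.
  - by move=> t _; exact: integral_ge0.
  - apply: (@measurable_fun_fubini_tonelli_G _ _ _ _ _ mu (fun p => `|H p|%:E)) => //.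
    by apply/measurable_EFinP; apply: measurableT_comp.
  - by apply/measurable_EFinP; apply: measurable_funM.
  - move=> t _; apply: le_trans (Hc t) _; rewrite lee_fin ler_wpM2r// ?ler_norm//.
rewrite ge0_integralZ_real// integral_indic//.
by rewrite setIT lte_mul_pinfty//; exact: lebesgue_measure_itv_lty.
Qed.

Variables (Omega : set 'rV[R]_n) (F : 'rV[R]_n -> R) (G : 'I_n -> 'rV[R]_n -> R).
Hypothesis iF : mu.-integrable setT (EFin \o F).
Hypothesis iG : forall i, mu.-integrable setT (EFin \o G i).
Hypothesis weakG : forall i phi, test_function Omega phi ->
  \int[mu]_x (F x * partial i phi x) = - \int[mu]_x (G i x * phi x).

Definition dirder (G : 'I_n -> 'rV[R]_n -> R) e x : R := \sum_i e ord0 i * G i x.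

Let mF : measurable_fun setT F.
Proof. by apply/measurable_EFinP; exact: measurable_int iF. Qed.

Lemma integrable_dirder e : mu.-integrable setT (EFin \o dirder G e).
Proof.
rewrite (_ : _ \o _ = (fun x => \sum_j (e ord0 j)%:E * (G j x)%:E)%E).
  by apply: integrable_sum => // i _; apply: integrableZl => //; exact: iG.
by apply/funext => x /=; rewrite /dirder -sumEFin.
Qed.

Let mGe e : measurable_fun setT (dirder G e).
Proof. by apply/measurable_EFinP; exact: measurable_int (integrable_dirder e). Qed.

Lemma Rintegral_dirder_mul e (p : 'rV[R]_n -> R) (M : R) : measurable_fun setT p ->
  (forall x, `|p x| <= M) ->
  \int[mu]_x (dirder G e x * p x) = \sum_j e ord0 j * \int[mu]_x (G j x * p x).
Proof.
move=> mp pM.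
have i1 j : mu.-integrable setT (EFin \o (fun x => G j x * p x)).
  exact: (integrable_bounded_mul (iG j) mp pM).
under eq_Rintegral do rewrite /dirder mulr_suml.
rewrite (@Rintegral_sum _ _ (fun j x => e ord0 j * G j x * p x)); last first.
  move=> j; have := integrableZl measurableT (e ord0 j) (i1 j).
  by apply: eq_integrable => // x _ /=; rewrite -EFinM mulrA.
apply: eq_bigr => j _; under eq_Rintegral do rewrite -mulrA.
by rewrite RintegralZl.
Qed.

Lemma weak_dline e (u : 'I_n -> R -> R) (a b : 'rV[R]_n) :
  (forall k i, smooth k (u i)) ->
  (forall i t, u i t != 0 -> a ord0 i <= t <= b ord0 i) -> cbox a b `<=` Omega ->
  \int[mu]_x (F x * dline e u x) = - \int[mu]_x (dirder G e x * tensor u x).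
Proof.
move=> su u0 abO.
have cu i : continuous (u i) by exact: smooth_continuous (su 0%N i).
have [M hM] := tensor_bounded cu u0.
rewrite (Rintegral_dirder_mul _ (measurable_tensor su) hM).
have i1 j : mu.-integrable setT (EFin \o (fun x => F x * tensor (dtensor j u) x)).
  have [|M' hM'] := @tensor_bounded R n (dtensor j u) a b _ (dtensor_supp u0).
    by move=> i; exact: smooth_continuous (smooth_dtensor j su 0%N i).
  apply: (integrable_bounded_mul iF _ hM').
  exact: measurable_tensor (smooth_dtensor j su).
under eq_Rintegral do rewrite /dline mulr_sumr.
rewrite (@Rintegral_sum _ _ (fun j x => F x * (e ord0 j * tensor (dtensor j u) x))); last first.
  move=> j; have := integrableZl measurableT (e ord0 j) (i1 j).
  by apply: eq_integrable => // x _ /=; rewrite -EFinM mulrCA.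
rewrite -sumrN; apply: eq_bigr => j _; under eq_Rintegral do rewrite mulrCA.
rewrite RintegralZl// -mulrN -weakG; last exact: test_tensor u0 abO.
by rewrite partial_tensor// => i t; case: (su 1%N i).
Qed.

Definition line_integral (tau : R) e x : R :=
  \int[lam]_t (\1_`[0, tau] t * dirder G e (x + t *: e)).

Lemma measurable_line_kernel (tau : R) e (h : 'rV[R]_n -> R) : measurable_fun setT h ->
  measurable_fun setT (fun p : 'rV[R]_n * measurableTypeR R =>
    \1_`[0, tau] p.2 * h (p.1 + p.2 *: e)).
Proof.
move=> mh; apply: measurable_funM.
  apply: (measurableT_comp _ measurable_snd).
  by apply: measurable_indic; exact: measurable_itv.
exact: (measurableT_comp mh (measurable_rV_addZ e)).
Qed.

Lemma line_kernel_bound (tau : R) e t :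
  (\int[mu]_x `|(\1_`[0, tau] t * dirder G e (x + t *: e))|%:E <=
   (fine (\int[mu]_x `|dirder G e x|%:E) * \1_`[0, tau] t)%:E)%E.
Proof.
have ig := integrable_dirder e.
have fin : (\int[mu]_x `|dirder G e x|%:E)%E \is a fin_num.
  exact: (integrable_fin_num measurableT (integrable_abse ig)).
under eq_integral do rewrite normrM.
rewrite ge0_integralZ_real//; last first.
  apply: measurableT_comp => //.
  exact: (measurableT_comp (mGe e) (measurable_rV_shift (t *: e))).
rewrite (@ge0_integral_shift _ _ (t *: e) (fun x => `|dirder G e x|%:E))//; last first.
  by apply/measurable_EFinP; apply: measurableT_comp.
by rewrite mulrC EFinM fineK// ger0_norm.
Qed.

Lemma integrable_line_integral (tau : R) e :
  mu.-integrable setT (EFin \o line_integral tau e).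
Proof.
have := @integrable_Rintegral1 _ _ _ _ R mu lam
  (fun p => \1_`[0, tau] p.2 * dirder G e (p.1 + p.2 *: e)).
apply; first exact: measurable_line_kernel.
exact: (iterated_integral_lty (measurable_line_kernel tau e (mGe e))
  (line_kernel_bound tau e)).
Qed.

(** The translation is moved onto the cutoff phi, leaving F(y) times phi(y - tau e) - phi(y), which
    is minus the integral over t of the derivative of phi at y - te. For each fixed t the weak
    gradient is tested against the translate of phi by te, and shifting back places e . G at x +
    te. *)
Lemma line_formula_test (tau : R) e (O : set 'rV[R]_n) (a b : 'rV[R]_n) m : 0 < tau ->
  (forall x t, O x -> 0 <= t <= tau -> Omega (x + t *: e)) -> cbox a b `<=` O ->
  \int[mu]_x ((F (x + tau *: e) - F x - line_integral tau e x) *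
    tensor (bumps a b m) x) = 0.
Proof.
move=> tau0 OOm abO; set u := bumps a b m.
have su k i : smooth k (u i) by exact: smooth_bumps.
have u0 i t : u i t != 0 -> a ord0 i <= t <= b ord0 i.
  by move=> /bump_neq0 /andP[/ltW -> /ltW ->].
have mphi : measurable_fun setT (tensor u) by exact: measurable_tensor.
have phi1 x : `|tensor u x| <= 1.
  by rewrite ger0_norm ?tensor_bumps_ge0// tensor_bumps_le1.
have mphis w : measurable_fun setT (fun x => tensor u (x - w)).
  exact: (measurableT_comp mphi (measurable_rV_shift (- w))).
have [M hM] := dline_bounded e su u0.
have mdl : measurable_fun setT (dline e u).
  by apply: continuous_measurable_rV; exact: continuous_dline.
have M0 : 0 <= M by apply: le_trans (hM 0).
have iFa : mu.-integrable setT (EFin \o (fun x => F (x + tau *: e))).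
  exact: (integrable_shift (tau *: e) iF).
have I1 := integrable_bounded_mul iFa mphi phi1.
have I2 := integrable_bounded_mul iF mphi phi1.
have I3 := integrable_bounded_mul (integrable_line_integral tau e) mphi phi1.
under eq_Rintegral do rewrite !mulrBl.
rewrite RintegralB//; last by have := integrableB measurableT I1 I2.
rewrite RintegralB//; apply/eqP; rewrite subr_eq0; apply/eqP.
have -> : \int[mu]_x (F (x + tau *: e) * tensor u x) =
    \int[mu]_y (F y * tensor u (y - tau *: e)).
  rewrite -[RHS](Rintegral_shift (tau *: e)); last by apply: measurable_funM.
  by under [RHS]eq_Rintegral do rewrite addrK.
rewrite -RintegralB//; last first.
  apply: (integrable_bounded_mul (M := 1)) => //; exact: mphis.
(* [H1] and [H2] are the integrands before and after the integration by parts; for each fixed t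
   their integrals over space agree. *)
pose H1 (p : 'rV[R]_n * measurableTypeR R) : R :=
  - F p.1 * (\1_`[0, tau] p.2 * dline e u (p.1 - p.2 *: e)).
pose H2 (p : 'rV[R]_n * measurableTypeR R) : R :=
  tensor u p.1 * (\1_`[0, tau] p.2 * dirder G e (p.1 + p.2 *: e)).
have mI : measurable_fun setT (\1_`[0, tau] : R -> R).
  by apply: measurable_indic; exact: measurable_itv.
have mH1 : measurable_fun setT H1.
  apply: measurable_funM.
    by apply: measurableT_comp => //; exact: (measurableT_comp mF measurable_fst).
  apply: measurable_funM; first exact: (measurableT_comp mI measurable_snd).
  exact: (measurableT_comp mdl (measurable_rV_subZ e)).
have mH2 : measurable_fun setT H2.
  apply: measurable_funM; first exact: (measurableT_comp mphi measurable_fst).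
  exact: measurable_line_kernel.
have fH1 : (\int[lam]_t \int[mu]_x `|H1 (x, t)|%:E < +oo)%E.
  apply: (@iterated_integral_lty tau (M * fine (\int[mu]_x `|F x|%:E)%E)) => // t.
  have fin : (\int[mu]_x `|F x|%:E)%E \is a fin_num.
    exact: (integrable_fin_num measurableT (integrable_abse iF)).
  apply: (@le_trans _ _ (\int[mu]_x ((M * \1_`[0, tau] t) * `|F x|)%:E)%E).
    apply: ge0_le_integral => //.
    - apply/measurable_EFinP; apply: measurableT_comp => //.
      exact: (measurableT_comp mH1 (measurable_pair2 t)).
    - by apply/measurable_EFinP; apply: measurable_funM => //; apply: measurableT_comp.
    - move=> x _; rewrite lee_fin /H1 /= mulrC !normrM normrN.
      rewrite ler_wpM2r// [M * _]mulrC [`|\1__ _|]ger0_norm// ler_wpM2l//.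
  rewrite ge0_integralZ_real//; [|by rewrite mulr_ge0|exact: measurableT_comp].
  by rewrite -[X in (_ * X <= _)%E](fineK fin) -EFinM mulrAC.
have fH2 : (\int[lam]_t \int[mu]_x `|H2 (x, t)|%:E < +oo)%E.
  apply: (@iterated_integral_lty tau (fine (\int[mu]_x `|dirder G e x|%:E)%E)) => // t.
  apply: le_trans (line_kernel_bound tau e t); apply: ge0_le_integral => //.
  - apply/measurable_EFinP; apply: measurableT_comp => //.
    exact: (measurableT_comp mH2 (measurable_pair2 t)).
  - apply/measurable_EFinP; apply: measurableT_comp => //.
    exact: (measurableT_comp (measurable_line_kernel tau e (mGe e)) (measurable_pair2 t)).
  - by move=> x _; rewrite lee_fin /H2 /= normrM ler_piMl.
transitivity (\int[mu]_y \int[lam]_t H1 (y, t)).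
  apply: eq_Rintegral => y _; rewrite -mulrBr -opprB mulrN -mulNr.
  rewrite -(Rintegral_dline e y tau0 su) /H1 /= RintegralZl//.
  have : lam.-integrable setT (fun t => (M * \1_`[0, tau] t)%:E).
    apply: (@integrableZl _ _ _ lam setT measurableT M (EFin \o \1_`[0, tau])).
    apply/integrableP; split; first exact/measurable_EFinP.
    under eq_integral do rewrite gee0_abs ?lee_fin//.
    by rewrite integral_indic// setIT; exact: lebesgue_measure_itv_lty.
  apply: le_integrable => //.
    apply/measurable_EFinP; apply: measurable_funM => //.
    exact: (measurableT_comp mdl (measurableT_comp (measurable_rV_subZ e) (measurable_pair1 y))).
  by move=> t _ /=; rewrite lee_fin !normrM mulrC ler_wpM2r// (le_trans (hM _))// ler_norm.
rewrite (Fubini_Rintegral mH1 fH1).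
transitivity (\int[lam]_t \int[mu]_x H2 (x, t)); last first.
  rewrite -(Fubini_Rintegral mH2 fH2); apply: eq_Rintegral => x _.
  rewrite /H2 /= ge0_RintegralZl ?tensor_bumps_ge0//; first by rewrite mulrC.
  exact: (measurableT_comp (measurable_line_kernel tau e (mGe e)) (measurable_pair1 x)).
apply: eq_Rintegral => t _; rewrite /H1 /H2 /= indicE.
have [|_] := boolP (t \in `[0, tau]%classic); last first.
  under eq_Rintegral do rewrite mul0r mulr0.
  by under [RHS]eq_Rintegral do rewrite mul0r mulr0.
rewrite inE /= in_itv /= => tt.
(* The translated cutoff lives in the box shifted by te, which [OOm] keeps inside [Omega] for t in
   [0, tau]; for other t the indicator has already removed the term. *)
have W : \int[mu]_x (F x * dline e (shift_fam u (t *: e)) x) =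
    - \int[mu]_x (dirder G e x * tensor (shift_fam u (t *: e)) x).
  apply: weak_dline; [exact: smooth_shift_fam|exact: shift_fam_supp u0|].
  move=> x xab; rewrite -[x](subrK (t *: e)); apply: OOm => //; apply: abO => i.
  by have := xab i; rewrite !mxE lerBrDr lerBlDr.
transitivity (\int[mu]_x (-1 * (F x * dline e (shift_fam u (t *: e)) x))).
  apply: eq_Rintegral => x _; rewrite mul1r mulN1r mulNr; congr (- (_ * _)).
  by apply: eq_bigr => j _; rewrite dtensor_shift.
rewrite RintegralZl//; last first.
  have := dline_bounded e (smooth_shift_fam (t *: e) su) (shift_fam_supp (w := t *: e) u0).
  move=> [M' hM']; apply: (integrable_bounded_mul iF _ hM').
  apply: continuous_measurable_rV; apply: continuous_dline.
  exact: smooth_shift_fam.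
rewrite W mulN1r opprK -(Rintegral_shift (t *: e)); last first.
  apply: measurable_funM => //; apply: measurable_tensor; exact: smooth_shift_fam.
by apply: eq_Rintegral => x _; rewrite tensor_shift addrK mul1r mulrC.
Qed.

(** The exceptional null set depends on [tau] and [e]; this is enough because the estimates below
    integrate over space at a fixed length before any averaging. *)
Lemma line_formula (tau : R) e (O : set 'rV[R]_n) : 0 < tau -> open O ->
  (forall x t, O x -> 0 <= t <= tau -> Omega (x + t *: e)) ->
  {ae mu, forall x, O x -> F (x + tau *: e) - F x = line_integral tau e x}.
Proof.
move=> tau0 oO OOm.
have iD : mu.-integrable setT
    (EFin \o (fun x => F (x + tau *: e) - F x - line_integral tau e x)).
  have iFa : mu.-integrable setT (EFin \o (fun x => F (x + tau *: e))).
    exact: (integrable_shift (tau *: e) iF).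
  have := integrableB measurableT (integrableB measurableT iFa iF)
    (integrable_line_integral tau e).
  by [].
have := fundamental_lemma oO iD (fun a b m => line_formula_test m tau0 OOm).
by apply: filterS => x h Ox; apply/eqP; rewrite -subr_eq0 (h Ox).
Qed.

End line_formula.

(** * Weighted translation estimate *)

Section weighted_translation.
Variables (R : realType).
Local Notation lam := (@lebesgue_measure R).

Lemma sqr_sum_le (I : finType) (a : I -> R) :
  (\sum_i a i) ^+ 2 <= #|I|%:R * \sum_i a i ^+ 2.
Proof.
have -> : #|I|%:R * \sum_i a i ^+ 2 = \sum_i \sum_j (a i ^+ 2 + a j ^+ 2) / 2.
  under [RHS]eq_bigr do rewrite -mulr_suml big_split/= sumr_const.
  rewrite -mulr_suml big_split/= sumr_const sumrMnl.
  set S := \sum_i a i ^+ 2; rewrite -[S *+ _]mulr_natl.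
  by lra.
rewrite expr2 big_distrlr/=; apply: ler_sum => i _; apply: ler_sum => j _.
by have := sqr_ge0 (a i - a j); rewrite sqrrB; lra.
Qed.

(** Stated in the extended reals because the right-hand side may be infinite on exceptional lines.
    When it is finite, |k| <= 1 + k^2 gives integrability on [0, tau]. *)
Lemma Jensen_sqr (tau : R) (k : R -> R) : 0 < tau -> measurable_fun setT k ->
  (((\int[lam]_t (\1_`[0, tau] t * k t)) ^+ 2)%:E <=
   tau%:E * \int[lam]_t (\1_`[0, tau] t * k t ^+ 2)%:E)%E.
Proof.
move=> tau0 mk.
have mI : measurable_fun setT (\1_`[0, tau] : R -> R).
  by apply: measurable_indic; exact: measurable_itv.
have mk2 : measurable_fun setT (fun t => \1_`[0, tau] t * k t ^+ 2).
  by apply: measurable_funM => //; exact: measurable_funX.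
set A := (X in (_ <= _ * X)%E).
have A0 : (0 <= A)%E.
  by apply: integral_ge0 => t _; rewrite lee_fin mulr_ge0// sqr_ge0.
have [->|Aoo] := eqVneq A +oo%E; first by rewrite gt0_muley ?leey.
have Afin : A \is a fin_num by rewrite ge0_fin_numE// lt_neqAle Aoo leey.
have iI : lam.-integrable setT (EFin \o \1_`[0, tau]).
  apply/integrableP; split; first exact/measurable_EFinP.
  under eq_integral do rewrite gee0_abs ?lee_fin//.
  by rewrite integral_indic// setIT; exact: lebesgue_measure_itv_lty.
have iA : lam.-integrable setT (EFin \o (fun t => \1_`[0, tau] t * k t ^+ 2)).
  apply/integrableP; split; first exact/measurable_EFinP.
  rewrite (_ : (\int[_]_x _)%E = A); first by rewrite -ge0_fin_numE.
  by apply: eq_integral => t _ /=; rewrite ger0_norm// mulr_ge0// sqr_ge0.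
have ik : lam.-integrable setT (EFin \o (fun t => \1_`[0, tau] t * k t)).
  apply: le_integrable (integrableD measurableT iI iA) => //.
    by apply/measurable_EFinP; exact: measurable_funM.
  move=> t _ /=; rewrite lee_fin normrM [leRHS]ger0_norm; last first.
    by rewrite addr_ge0// mulr_ge0// sqr_ge0.
  rewrite ger0_norm// -{2}[\1_`[0, tau] t]mulr1 -mulrDr ler_wpM2l//.
  have E : `|k t| ^+ 2 = k t ^+ 2 by rewrite real_normK ?num_real.
  by have := sqr_ge0 (`|k t| - 2^-1); rewrite sqrrB E; lra.
set c := \int[lam]_t _.
(* [l] is the mean of [k] on [0, tau]; integrating (k - l)^2 >= 0 gives 2 l c <= A + l^2 tau, that
   is c^2 <= tau A. *)
pose l := c / tau.
have : \int[lam]_t (2 * l * (\1_`[0, tau] t * k t)) <=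
    \int[lam]_t (\1_`[0, tau] t * k t ^+ 2 + l ^+ 2 * \1_`[0, tau] t).
  apply: le_Rintegral => //.
  - by have := integrableZl measurableT (2 * l) ik.
  - by have := integrableD measurableT iA (integrableZl measurableT (l ^+ 2) iI).
  - move=> t _; have := sqr_ge0 (k t - l); rewrite sqrrB => h.
    rewrite mulrCA [_ * \1__ t]mulrC -mulrDr ler_wpM2l//; lra.
rewrite RintegralZl// RintegralD//; last by have := integrableZl measurableT (l ^+ 2) iI.
rewrite RintegralZl// -/c.
have -> : \int[lam]_t \1_`[0, tau] t = tau.
  have L : lam `[0, tau]%classic = tau%:E.
    by rewrite lebesgue_measure_itv/= lte_fin tau0 -EFinB subr0.
  by rewrite /Rintegral integral_indic// setIT; exact: (congr1 fine L).
rewrite -[X in X + _]/(fine A) => h.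
rewrite -[A]fineK// -EFinM lee_fin.
have lc : l * tau = c by rewrite /l divfK// gt_eqF.
rewrite -lc in h *; nra.
Qed.

Variable (n : nat).
Local Notation mu := (lebesgue_rV R n).
Variables (Omega : set 'rV[R]_n) (F : 'rV[R]_n -> R) (G : 'I_n -> 'rV[R]_n -> R).
Hypothesis iF : mu.-integrable setT (EFin \o F).
Hypothesis iG : forall i, mu.-integrable setT (EFin \o G i).
Hypothesis weakG : forall i phi, test_function Omega phi ->
  \int[mu]_x (F x * partial i phi x) = - \int[mu]_x (G i x * phi x).

Lemma dirder_sqr_le (e : 'rV[R]_n) (rho : R) x : (forall i, `|e ord0 i| <= rho) ->
  dirder G e x ^+ 2 <= n%:R * rho ^+ 2 * \sum_i G i x ^+ 2.
Proof.
move=> eB; apply: le_trans (sqr_sum_le _) _.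
rewrite card_ord -mulrA ler_wpM2l// mulr_sumr; apply: ler_sum => i _.
rewrite exprMn ler_wpM2r ?sqr_ge0// -[leLHS]ger0_norm ?sqr_ge0// normrX.
by rewrite lerXn2r ?nnegrE ?normr_ge0//; exact: le_trans (eB i).
Qed.

(** Jensen bounds the squared increment by an integral of (e . G)^2 along the segment. After Tonelli
    and the substitution y = x + te, only the weight at y - te still depends on t, so a singular
    weight is harmless once its line integrals are bounded. *)
Lemma weighted_translation (tau M rho : R) (e : 'rV[R]_n) (O : set 'rV[R]_n)
    (w : 'rV[R]_n -> R) : 0 < tau -> 0 <= M -> open O ->
  (forall x t, O x -> 0 <= t <= tau -> Omega (x + t *: e)) ->
  measurable_fun setT w -> (forall x, 0 <= w x) -> (forall x, w x != 0 -> O x) ->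
  (forall i, `|e ord0 i| <= rho) ->
  (forall y, \int[lam]_t (\1_`[0, tau] t * w (y - t *: e))%:E <= M%:E)%E ->
  (\int[mu]_x (w x * (F (x + tau *: e) - F x) ^+ 2)%:E <=
   (tau * M * (n%:R * rho ^+ 2))%:E * \int[mu]_x (\sum_i G i x ^+ 2)%:E)%E.
Proof.
move=> tau0 M0 oO OOm mw w0 wO eB wM.
have mF : measurable_fun setT F by apply/measurable_EFinP; exact: measurable_int iF.
have mG i : measurable_fun setT (G i) by apply/measurable_EFinP; exact: measurable_int (iG i).
have mGe : measurable_fun setT (dirder G e).
  by apply/measurable_EFinP; exact: measurable_int (integrable_dirder iG e).
have mGe2 : measurable_fun setT (fun x => dirder G e x ^+ 2) by exact: measurable_funX.
have mI : measurable_fun setT (\1_`[0, tau] : R -> R).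
  by apply: measurable_indic; exact: measurable_itv.
have mK : measurable_fun setT (line_integral G tau e).
  by apply/measurable_EFinP; exact: measurable_int (integrable_line_integral iG tau e).
pose J (p : 'rV[R]_n * measurableTypeR R) : R :=
  tau * w p.1 * (\1_`[0, tau] p.2 * dirder G e (p.1 + p.2 *: e) ^+ 2).
pose J' (p : 'rV[R]_n * measurableTypeR R) : R :=
  tau * dirder G e p.1 ^+ 2 * (\1_`[0, tau] p.2 * w (p.1 - p.2 *: e)).
have tau0' := ltW tau0.
have J0 p : 0 <= J p.
  by apply: mulr_ge0; [rewrite mulr_ge0|rewrite mulr_ge0// sqr_ge0].
have J'0 p : 0 <= J' p.
  by apply: mulr_ge0; [rewrite mulr_ge0// sqr_ge0|rewrite mulr_ge0].
have mJ : measurable_fun setT J.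
  apply: measurable_funM; last exact: measurable_line_kernel mGe2.
  by apply: measurable_funM => //; exact: (measurableT_comp mw measurable_fst).
have mJ' : measurable_fun setT J'.
  apply: measurable_funM.
    by apply: measurable_funM => //; exact: (measurableT_comp mGe2 measurable_fst).
  apply: measurable_funM; first exact: (measurableT_comp mI measurable_snd).
  exact: (measurableT_comp mw (measurable_rV_subZ e)).
apply: (@le_trans _ _ (\int[mu]_x \int[lam]_t (J (x, t))%:E)%E).
  apply: ae_ge0_le_integral => //.
  - by move=> x _; rewrite lee_fin mulr_ge0// sqr_ge0.
  - apply/measurable_EFinP; apply: measurable_funM => //; apply: measurable_funX.
    apply: measurable_funB => //.
    exact: (measurableT_comp mF (measurable_rV_shift (tau *: e))).
  - by move=> x _; apply: integral_ge0 => t _; rewrite lee_fin.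
  - apply: (@measurable_fun_fubini_tonelli_F _ _ _ _ _ lam (fun p => (J p)%:E)) => //.
    exact/measurable_EFinP.
  have := line_formula iF iG weakG tau0 oO OOm; apply: filterS => x hx _.
  rewrite /J /= ge0_integralZ_real; last 3 first.
  - by rewrite mulr_ge0// ltW.
  - exact: (measurableT_comp (measurable_line_kernel tau e mGe2) (measurable_pair1 x)).
  - by move=> t; rewrite mulr_ge0// sqr_ge0.
  (* The line formula is available only on [O]; where the weight vanishes both sides are 0. *)
  have [->|wx] := eqVneq (w x) 0; first by rewrite mul0r mulr0 mul0e.
  rewrite (hx (wO _ wx)) [(tau * _)%R]mulrC !EFinM -muleA lee_pmul2l ?fin_numE//; last first.
    by rewrite lte_fin lt_neqAle eq_sym wx w0.
  apply: Jensen_sqr => //.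
  exact: (measurableT_comp mGe (measurableT_comp (measurable_rV_addZ e) (measurable_pair1 x))).
rewrite (@fubini_tonelli _ _ _ _ _ mu lam (fun p => (J p)%:E))//; last exact/measurable_EFinP.
have -> : (\int[lam]_t \int[mu]_x (J (x, t))%:E = \int[lam]_t \int[mu]_x (J' (x, t))%:E)%E.
  apply: eq_integral => t _.
  rewrite -(@ge0_integral_shift _ _ (- (t *: e)) (fun x => (J (x, t))%:E)).
  - apply: eq_integral => x _; rewrite /J /J' /= subrK; congr EFin; ring.
  - apply/measurable_EFinP; exact: (measurableT_comp mJ (measurable_pair2 t)).
  - by move=> x; rewrite lee_fin.
rewrite -(@fubini_tonelli _ _ _ _ _ mu lam (fun p => (J' p)%:E))//; last exact/measurable_EFinP.
have mS : measurable_fun setT (fun x => \sum_i G i x ^+ 2).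
  by apply: measurable_sum => i; exact: measurable_funX.
rewrite -ge0_integralZ_real//; last 2 first.
- by apply: mulr_ge0; [exact: mulr_ge0|rewrite mulr_ge0// sqr_ge0].
- by move=> x; apply: sumr_ge0 => i _; exact: sqr_ge0.
apply: ge0_le_integral => //.
- by move=> x _; apply: integral_ge0 => t _; rewrite lee_fin.
- apply: (@measurable_fun_fubini_tonelli_F _ _ _ _ _ lam (fun p => (J' p)%:E)) => //.
  exact/measurable_EFinP.
- by apply/measurable_EFinP; exact: measurable_funM.
move=> x _; rewrite /J' /= ge0_integralZ_real; last 3 first.
- by rewrite mulr_ge0// sqr_ge0.
- apply: measurable_funM => //.
  exact: (measurableT_comp mw (measurableT_comp (measurable_rV_subZ e) (measurable_pair1 x))).
- by move=> t; rewrite mulr_ge0.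
apply: (@le_trans _ _ ((tau * dirder G e x ^+ 2)%:E * M%:E)%E).
  by rewrite lee_wpmul2l// lee_fin mulr_ge0// sqr_ge0.
rewrite -EFinM lee_fin mulrAC -[leRHS]mulrA ler_wpM2l//; first exact: mulr_ge0.
exact: dirder_sqr_le.
Qed.

End weighted_translation.

(** * Extension by zero outside the domain *)

Section extension_by_zero.
Variables (R : realType) (n : nat) (Omega : set 'rV[R]_n).
Local Notation mu := (lebesgue_rV R n).
Hypotheses (oO : open Omega) (bO : bounded_set Omega).

Let mO : measurable Omega. Proof. exact: open_measurable_rV. Qed.

Lemma patch_sqr (h : 'rV[R]_n -> R) x :
  (h \_ Omega) x ^+ 2 = ((fun x => h x ^+ 2) \_ Omega) x.
Proof. by rewrite /patch; case: ifP => // _; rewrite expr0n. Qed.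

Lemma integral_patch_sqr (h : 'rV[R]_n -> R) :
  (\int[mu]_x ((h \_ Omega) x ^+ 2)%:E = \int[mu]_(x in Omega) (h x ^+ 2)%:E)%E.
Proof.
rewrite [RHS]integral_mkcond; apply: eq_integral => x _.
by rewrite patch_sqr /patch; case: ifP.
Qed.

(** |h| <= 1 + h^2, and a bounded open set has finite measure. *)
Lemma square_integrable_integrable (h : 'rV[R]_n -> R) :
  square_integrable Omega h -> mu.-integrable setT (EFin \o (h \_ Omega)).
Proof.
move=> [mh h2].
have mh2 : measurable_fun Omega (fun x => h x ^+ 2) by exact: measurable_funX.
have i1 : mu.-integrable Omega (cst (1%:E : \bar R)).
  apply/integrableP; split => //; rewrite integral_cst//= normr1 mul1e.
  exact: bounded_lebesgue_lty.
have i2 : mu.-integrable Omega (EFin \o (fun x => h x ^+ 2)).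
  apply/integrableP; split; first exact/measurable_EFinP.
  apply: le_lt_trans h2; rewrite le_eqVlt; apply/orP; left; apply/eqP.
  by apply: eq_integral => x _ /=; rewrite ger0_norm// sqr_ge0.
have : mu.-integrable Omega (EFin \o h).
  apply: le_integrable (integrableD mO i1 i2) => //; first exact/measurable_EFinP.
  move=> x _ /=; rewrite lee_fin [leRHS]ger0_norm ?addr_ge0 ?sqr_ge0//.
  have E : `|h x| ^+ 2 = h x ^+ 2 by rewrite real_normK ?num_real.
  by have := sqr_ge0 (`|h x| - 2^-1); rewrite sqrrB E; lra.
move/(integrable_mkcond _ mO); apply: eq_integrable => // x _.
by rewrite /patch /=; case: ifP.
Qed.

Variable f : 'rV[R]_n -> R.
Hypothesis fW : W12 Omega f.

Lemma grad_weak_gradient : weak_gradient Omega f (grad Omega f).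
Proof.
by case: fW => _ [G hG]; exact: (@xgetPex _ (fun _ _ => 0) [set G | weak_gradient Omega f G] (ex_intro _ G hG)).
Qed.

Local Notation F := (f \_ Omega).
Local Notation G := (fun i => grad Omega f i \_ Omega).

Lemma W12_integrable : mu.-integrable setT (EFin \o F).
Proof. by apply: square_integrable_integrable; case: fW. Qed.

Lemma W12_integrable_grad i : mu.-integrable setT (EFin \o G i).
Proof.
by apply: square_integrable_integrable; case: (grad_weak_gradient i).
Qed.

(** The zero extension may jump across the boundary; the identity survives because both integrands
    vanish outside [Omega] and test functions are supported inside. *)
Lemma W12_weak i phi : test_function Omega phi ->
  \int[mu]_x (F x * partial i phi x) = - \int[mu]_x (G i x * phi x).
Proof.
move=> tphi; have [_ /(_ phi tphi)] := grad_weak_gradient i.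
rewrite Rintegral_mkcond [X in - X]Rintegral_mkcond => h.
transitivity (\int[mu]_x ((fun x => f x * partial i phi x) \_ Omega) x).
  by apply: eq_Rintegral => x _; rewrite /patch; case: ifP => // _; rewrite mul0r.
rewrite h; congr (- _).
by apply: eq_Rintegral => x _; rewrite /patch; case: ifP => // _; rewrite mul0r.
Qed.

Lemma W12_L2_norm : (\int[mu]_x (F x ^+ 2)%:E = (L2_norm Omega f ^+ 2)%:E)%E.
Proof.
rewrite integral_patch_sqr /L2_norm sqr_sqrtr; last first.
  by apply: Rintegral_ge0 => x _; exact: sqr_ge0.
case: fW => -[mf f2] _; rewrite /Rintegral fineK// ge0_fin_numE//.
by apply: integral_ge0 => x _; rewrite lee_fin sqr_ge0.
Qed.

Lemma W12_dirichlet :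
  (\int[mu]_x (\sum_i G i x ^+ 2)%:E = (dirichlet_form Omega f)%:E)%E.
Proof.
have sq i := (grad_weak_gradient i).1.
transitivity (\int[mu]_(x in Omega) (\sum_i grad Omega f i x ^+ 2)%:E)%E.
  rewrite [RHS]integral_mkcond; apply: eq_integral => x _.
  under eq_bigr do rewrite patch_sqr.
  rewrite /patch; case: ifP => // _.
  by rewrite big1.
rewrite /dirichlet_form /Rintegral fineK// ge0_fin_numE; last first.
  by apply: integral_ge0 => x _; rewrite lee_fin; apply: sumr_ge0 => i _; exact: sqr_ge0.
under eq_integral do rewrite -sumEFin.
rewrite ge0_integral_sum//; last 2 first.
- by move=> i; apply/measurable_EFinP; apply: measurable_funX; case: (sq i).
- by move=> i x _; rewrite lee_fin sqr_ge0.
by apply: lte_sum_pinfty => i _; case: (sq i).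
Qed.

Lemma dirichlet_form_ge0 : 0 <= dirichlet_form Omega f.
Proof.
by apply: Rintegral_ge0 => x _; apply: sumr_ge0 => i _; exact: sqr_ge0.
Qed.

Lemma W12_measurable : measurable_fun setT F.
Proof. by apply/measurable_EFinP; exact: measurable_int W12_integrable. Qed.

Lemma W12_weighted_translation (tau M rho : R) (e : 'rV[R]_n) (O : set 'rV[R]_n)
    (w : 'rV[R]_n -> R) : 0 < tau -> 0 <= M -> open O ->
  (forall x t, O x -> 0 <= t <= tau -> Omega (x + t *: e)) ->
  measurable_fun setT w -> (forall x, 0 <= w x) -> (forall x, w x != 0 -> O x) ->
  (forall i, `|e ord0 i| <= rho) ->
  (forall y, \int[lebesgue_measure]_t (\1_`[0%R, tau] t * w (y - t *: e)%R)%:E <= M%:E)%E ->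
  (\int[mu]_x (w x * (F (x + tau *: e) - F x) ^+ 2)%:E <=
   (tau * M * (n%:R * rho ^+ 2) * dirichlet_form Omega f)%:E)%E.
Proof.
move=> tau0 M0 oO' h1 h2 h3 h4 h5 h6.
rewrite EFinM -W12_dirichlet.
apply: (@weighted_translation _ _ Omega F G _ _ _ tau M rho e O) => //.
- exact: W12_integrable.
- exact: W12_integrable_grad.
- exact: W12_weak.
Qed.

End extension_by_zero.

(** * Euclidean norm and distance to the boundary *)

Section euclidean_norm.
Variable R : realType.

Lemma enorm_ge0 n (x : 'rV[R]_n) : 0 <= enorm x.
Proof. exact: sqrtr_ge0. Qed.

Lemma enorm_sqr n (x : 'rV[R]_n) : enorm x ^+ 2 = \sum_i x ord0 i ^+ 2.
Proof. by rewrite sqr_sqrtr// sumr_ge0// => i _; exact: sqr_ge0. Qed.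

Lemma enormN n (x : 'rV[R]_n) : enorm (- x) = enorm x.
Proof. by rewrite /enorm; under eq_bigr do rewrite mxE sqrrN. Qed.

Lemma enormB n (x y : 'rV[R]_n) : enorm (x - y) = enorm (y - x).
Proof. by rewrite -enormN opprB. Qed.

Lemma enormZ n (c : R) (x : 'rV[R]_n) : enorm (c *: x) = `|c| * enorm x.
Proof.
rewrite /enorm; under eq_bigr do rewrite mxE exprMn.
by rewrite -mulr_sumr sqrtrM ?sqr_ge0// sqrtr_sqr.
Qed.

Lemma coord_le_enorm n (x : 'rV[R]_n) i : `|x ord0 i| <= enorm x.
Proof.
rewrite -sqrtr_sqr ler_wsqrtr// (bigD1 i)//= lerDl.
by apply: sumr_ge0 => j _; exact: sqr_ge0.
Qed.

Lemma enorm_le n (x : 'rV[R]_n) (r : R) : 0 <= r ->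
  (forall i, `|x ord0 i| <= r) -> enorm x <= Num.sqrt n%:R * r.
Proof.
move=> r0 h; rewrite -[X in _ * X]ger0_norm// -sqrtr_sqr -sqrtrM// ler_wsqrtr//.
apply: (@le_trans _ _ (\sum_(i < n) r ^+ 2)).
  apply: ler_sum => i _; rewrite -[leLHS]ger0_norm ?sqr_ge0// normrX.
  by rewrite lerXn2r ?nnegrE.
by rewrite sumr_const card_ord mulr_natl.
Qed.

Lemma enorm_triangle n (x y : 'rV[R]_n) : enorm (x + y) <= enorm x + enorm y.
Proof.
(* Cauchy-Schwarz, from summing (|y| x_i - |x| y_i)^2 >= 0 and dividing by 2 |x| |y|; zero norms are
   treated apart. *)
have CS : \sum_i x ord0 i * y ord0 i <= enorm x * enorm y.
  have [x0|x0] := eqVneq (enorm x) 0.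
    rewrite x0 mul0r big1// => i _.
    by have := coord_le_enorm x i; rewrite x0 normr_le0 => /eqP ->; rewrite mul0r.
  have [y0|y0] := eqVneq (enorm y) 0.
    rewrite y0 mulr0 big1// => i _.
    by have := coord_le_enorm y i; rewrite y0 normr_le0 => /eqP ->; rewrite mulr0.
  have xp : 0 < enorm x by rewrite lt_neqAle eq_sym x0 enorm_ge0.
  have yp : 0 < enorm y by rewrite lt_neqAle eq_sym y0 enorm_ge0.
  suff : 2 * (enorm x * enorm y) * (\sum_i x ord0 i * y ord0 i) <=
      2 * (enorm x * enorm y) * (enorm x * enorm y).
    by rewrite ler_pM2l// mulr_gt0// mulr_gt0.
  rewrite [leRHS](_ : _ = enorm y ^+ 2 * enorm x ^+ 2 + enorm x ^+ 2 * enorm y ^+ 2); last by ring.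
  rewrite [X in _ <= _ * X + _]enorm_sqr [X in _ <= _ + _ * X]enorm_sqr !mulr_sumr -big_split/=.
  apply: ler_sum => i _.
  have := sqr_ge0 (enorm y * x ord0 i - enorm x * y ord0 i).
  by rewrite sqrrB !exprMn; lra.
rewrite -[leRHS]ger0_norm ?addr_ge0 ?enorm_ge0// -sqrtr_sqr ler_wsqrtr//.
rewrite sqrrD !enorm_sqr; under eq_bigr do rewrite mxE sqrrD.
rewrite big_split/= big_split/= lerD2r lerD2l sumrMnl.
by rewrite lerMn2r.
Qed.

Lemma enorm_orthogonal n (x : 'rV[R]_n) (P : 'M[R]_n) : P *m P^T = 1%:M ->
  enorm (x *m P) = enorm x.
Proof.
move=> PP; have E (z : 'rV[R]_n) : \sum_i z ord0 i ^+ 2 = (z *m z^T) ord0 ord0.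
  by rewrite mxE; apply: eq_bigr => i _; rewrite mxE expr2.
by rewrite /enorm !E trmx_mul mulmxA -(mulmxA x) PP mulmx1.
Qed.

Lemma ball_enorm n (x y : 'rV[R]_n) (e : R) : enorm (x - y) < e -> ball x e y.
Proof.
move=> h; apply/ball_rVP; first exact: le_lt_trans (enorm_ge0 _) h.
by move=> i; have := coord_le_enorm (x - y) i; rewrite !mxE => /le_lt_trans; apply.
Qed.

Lemma nbhs_enorm n (x : 'rV[R]_n) (A : set 'rV[R]_n) : nbhs x A ->
  exists2 r : R, 0 < r & forall y, enorm (x - y) < r -> A y.
Proof.
move=> /nbhs_ballP[r /= r0 xrA]; exists r => // y /ball_enorm; exact: xrA.
Qed.

Lemma near_enorm n (x : 'rV[R]_n) (r : R) : 0 < r ->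
  \forall y \near x, enorm (x - y) < r.
Proof.
move=> r0; pose s := r / (Num.sqrt n%:R + 1).
have q0 : 0 < Num.sqrt n%:R + 1 :> R by rewrite ltr_wpDl.
have s0 : 0 < s by rewrite divr_gt0.
apply/nbhs_ballP; exists s => //= y /(ball_rVP _ _ s0) h.
apply: (@le_lt_trans _ _ (Num.sqrt n%:R * s)).
  by apply: enorm_le (ltW s0) _ => i; rewrite !mxE ltW.
by rewrite /s mulrCA gtr_pMr// ltr_pdivrMr// mul1r ltrDl.
Qed.

Lemma open_enorm_ball n (x : 'rV[R]_n) (r : R) : open [set y | enorm (x - y) < r].
Proof.
rewrite openE => y /= xy; rewrite /interior.
have : 0 < r - enorm (x - y) by rewrite subr_gt0.
move=> /(near_enorm y); apply: filterS => z /= yz.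
rewrite -[x - z](subrKA y); apply: le_lt_trans (enorm_triangle _ _) _.
by move: yz; rewrite ltrBrDl.
Qed.

End euclidean_norm.

(** * Distance to the boundary of a bounded open set *)

Section distance_to_boundary.
Variables (R : realType) (n : nat) (Omega : set 'rV[R]_n.+1).
Hypotheses (O0 : Omega !=set0) (oO : open Omega) (bO : bounded_set Omega).
Implicit Types x y : 'rV[R]_n.+1.
Local Notation dist := (dist_boundary Omega).

Lemma boundary_notin y : boundary Omega y -> ~ Omega y.
Proof. by move=> [_]; rewrite (interior_id _).1. Qed.

(** If the segment from x to y missed the boundary, its part in [Omega] would be open and closed in
    [0, 1], hence everything, against y not in [Omega]. *)
Lemma segment_boundary x y : Omega x -> ~ Omega y ->
  exists2 z, boundary Omega z & enorm (x - z) <= enorm (x - y).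
Proof.
move=> Ox Oy.
pose g (t : R) := x + t *: (y - x).
have cg : continuous g.
  by move=> t; apply: cvgD; [exact: cvg_cst|apply: cvgZr_tmp; exact: cvg_id].
apply: contrapT => hz.
have nb t : `[0, 1]%classic t -> ~ boundary Omega (g t).
  rewrite /= in_itv/= => /andP[t0 t1] gt; apply: hz; exists (g t) => //.
  rewrite /g opprD addNKr enormN enormZ ger0_norm// enormB ler_piMl//.
  exact: enorm_ge0.
have : `[0, 1]%classic `&` g @^-1` Omega = `[0, 1]%classic.
  apply: (@segment_connected R 0 1).
  - by exists 0; split; rewrite /= ?in_itv/= ?lexx ?ler01// /g scale0r addr0.
  - by exists (g @^-1` Omega) => //; apply: open_comp => // t _; exact: cg.
  - exists (g @^-1` closure Omega).
      by apply: closed_comp; [move=> t _; exact: cg|exact: closed_closure].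
    apply/seteqP; split => t /= [tt gt]; split => //.
      exact: subset_closure.
    apply: contrapT => ngt; apply: (nb t tt); split => //.
    by rewrite (interior_id _).1.
move=> /seteqP[_ /(_ 1)] /=; rewrite in_itv/= ler01 lexx => /(_ isT)[_].
by rewrite /g scale1r addrC subrK.
Qed.

(** A corner of a large cube lies outside [Omega], the dimension being at least 1. Nonemptiness
    keeps the infimum in [dist_boundary] from being a default value. *)
Lemma boundary_nonempty : boundary Omega !=set0.
Proof.
have [k Ok] := bounded_sbox bO.
have [x Ox] := O0.
have : ~ Omega (const_mx k%:R).
  move=> /Ok /(_ ord0); rewrite !mxE ltxx andbF //.
by move=> /(segment_boundary Ox)[z bz _]; exists z.
Qed.

Let dset x := [set enorm (x - y) | y in boundary Omega].

Let has_inf_dset x : has_inf (dset x).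
Proof.
split; first by have [y by_] := boundary_nonempty; exists (enorm (x - y)), y.
by exists 0 => _ [y _ <-]; exact: enorm_ge0.
Qed.

Lemma dist_le x y : boundary Omega y -> dist x <= enorm (x - y).
Proof.
by move=> by_; apply: ge_inf; [case: (has_inf_dset x)|exists y].
Qed.

Lemma dist_ge x r : (forall y, boundary Omega y -> r <= enorm (x - y)) -> r <= dist x.
Proof.
move=> h; apply: lb_le_inf; first by case: (has_inf_dset x).
by move=> _ [y by_ <-]; exact: h.
Qed.

Lemma dist_lt x r : dist x < r -> exists2 y, boundary Omega y & enorm (x - y) < r.
Proof.
by move=> /(inf_lt (has_inf_dset x).1)[_ [y by_ <-] yr]; exists y.
Qed.

Lemma dist_gt0 x : Omega x -> 0 < dist x.
Proof.
move=> Ox; have [r r0 h] := nbhs_enorm (open_nbhs_nbhs (conj oO Ox)).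
apply: lt_le_trans r0 _; apply: dist_ge => y /boundary_notin Oy.
by rewrite leNgt; apply/negP => /h.
Qed.

Lemma dist_notin x y : Omega x -> ~ Omega y -> dist x <= enorm (x - y).
Proof.
by move=> Ox /(segment_boundary Ox)[z bz]; apply: le_trans; exact: dist_le.
Qed.

Lemma dist_Lipschitz x y : dist x <= dist y + enorm (x - y).
Proof.
rewrite -lerBlDr; apply: dist_ge => z bz; rewrite lerBlDr.
apply: le_trans (dist_le x bz) _.
by rewrite -(subrKA y) addrC; exact: enorm_triangle.
Qed.

Lemma continuous_dist : continuous dist.
Proof.
move=> x; apply/(@cvgrPdist_lt _ _ _ _ (nbhs_filter x)) => e e0.
have := near_enorm x e0; apply: filterS => y xy.
have := dist_Lipschitz x y; have := dist_Lipschitz y x; rewrite (enormB y).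
by rewrite ltr_norml => ? ?; apply/andP; split; lra.
Qed.

Lemma measurable_dist : measurable_fun setT dist.
Proof. exact: continuous_measurable_rV continuous_dist. Qed.

Lemma compact_closure : compact (closure Omega).
Proof.
have [k Ok] := bounded_sbox bO.
have ck := @compact_cbox R n.+1 (const_mx (- k%:R)) (const_mx k%:R).
apply: (@subclosed_compact _ _ (cbox (const_mx (- k%:R)) (const_mx k%:R))) => //.
  exact: closed_closure.
have -> : cbox (const_mx (- k%:R)) (const_mx k%:R : 'rV[R]_n.+1) =
    closure (cbox (const_mx (- k%:R)) (const_mx k%:R)).
  by apply/closure_id; apply: compact_closed ck; exact: norm_hausdorff.
by apply: closure_subset => x /Ok; exact: box_cbox.
Qed.

End distance_to_boundary.

(** * Log-Hardy inequality *)

Section one_dimensional_weight.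
Variable R : realType.
Local Notation lam := (@lebesgue_measure R).
Implicit Types (b c t : R).

(* [(c - t)^-b] on [t < c]; the test avoids the junk values of [powR] at
   nonpositive arguments. *)
Definition edge_weight b c t : R := if t < c then (c - t) `^ (- b) else 0.

Lemma edge_weight_ge0 b c t : 0 <= edge_weight b c t.
Proof. by rewrite /edge_weight; case: ifP => // _; exact: powR_ge0. Qed.

Lemma measurable_edge_weight b c : measurable_fun setT (edge_weight b c).
Proof.
apply: measurable_fun_ifT => //.
  by apply: measurable_fun_ltr => //.
apply: (measurableT_comp (measurable_powR _)) => //.
by apply: measurable_funB.
Qed.

Lemma is_derive_edgeV b c t : t < c ->
  is_derive t 1 (fun t => (c - t) `^ b) (b * (c - t) `^ (b - 1) * - 1).
Proof.
move=> tc; have ct : 0 < c - t by rewrite subr_gt0.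
have d1 : is_derive t 1 (fun t : R => c - t) (- 1).
  have := @is_deriveB _ _ _ (cst c) id t 1 0 1 (is_derive_cst _ _ _) (is_derive_id _ _).
  by rewrite sub0r.
exact: (@is_derive1_comp _ (fun x => x `^ b) (fun t => c - t) t _ _
  (is_derive1_powR b ct) d1).
Qed.

Lemma is_derive_edge b c t : 0 < b < 1 -> t < c ->
  is_derive t 1 (fun t => - ((1 - b)^-1 * (c - t) `^ (1 - b))) ((c - t) `^ (- b)).
Proof.
move=> /andP[b0 b1] tc; have := is_derive_edgeV (1 - b) tc.
move=> /(is_deriveZ (- (1 - b)^-1)); congr is_derive.
  by apply/funext => s /=; rewrite /GRing.scale /= mulNr.
rewrite /GRing.scale /= mulrN1 mulrNN mulrA mulVf ?mul1r ?subr_eq0 ?gt_eqF//.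
by rewrite addrAC subrr add0r.
Qed.

(** The integrand blows up at t = c, so it is integrated up to c - c/(k+2) by an explicit primitive,
    and k tends to infinity by monotone convergence. The bound involves only [c'] because the end
    point [c] will vary from line to line. *)
Lemma integral_edge_weight b c c' (T : R) : 0 < b < 1 -> 0 <= c' -> c <= c' ->
  (\int[lam]_t (\1_`[0, T] t * edge_weight b c t)%:E <=
   ((1 - b)^-1 * c' `^ (1 - b))%:E)%E.
Proof.
move=> b01 c'0 cc'; have /andP[b0 b1] := b01.
have B0 : 0 <= (1 - b)^-1 * c' `^ (1 - b).
  by rewrite mulr_ge0 ?powR_ge0// invr_ge0 subr_ge0 ltW.
have [c0|c0] := leP c 0.
  rewrite integral0_eq// => t _; rewrite indicE /edge_weight.
  have [|_] := boolP (t \in _); last by rewrite mul0r.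
  rewrite inE /= in_itv /= => /andP[t0 _].
  by rewrite ltNge (le_trans c0 t0) mulr0.
(* k + 2 rather than k + 1, so that the interval for k = 0 is already nondegenerate. *)
pose S k : set (measurableTypeR R) := `[0, c - c / k.+2%:R]%classic.
have ck k : c / k.+2%:R < c by rewrite ltr_pdivrMr// ltr_pMr// ltr1n.
have mS k : measurable (S k) by exact: measurable_itv.
have mI : measurable_fun setT (\1_`[0, T] : R -> R).
  by apply: measurable_indic; exact: measurable_itv.
have mh : measurable_fun setT (edge_weight b c) by exact: measurable_edge_weight.
apply: (@le_trans _ _ (\int[lam]_(t in \bigcup_k S k) (edge_weight b c t)%:E)%E).
  rewrite [leRHS]integral_mkcond; apply: ge0_le_integral => //.
  - by move=> t _; rewrite lee_fin mulr_ge0 ?edge_weight_ge0.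
  - by apply/measurable_EFinP; apply: measurable_funM.
  - have mU : measurable (\bigcup_k S k) by apply: bigcup_measurable => k _; exact: mS.
    apply/(measurable_restrictT (fun t => (edge_weight b c t)%:E) mU).
    by apply: measurable_funTS; exact/measurable_EFinP.
  move=> t _; rewrite /patch indicE.
  have [|_] := boolP (t \in `[0, T]%classic); last first.
    by rewrite mul0r; case: ifP => _ //; rewrite lee_fin edge_weight_ge0.
  rewrite inE /= in_itv /= => /andP[t0 _]; rewrite mul1r.
  case: ifPn => // /negP tS; rewrite lee_fin /edge_weight ltNge.
  case: (leP c t) => //= tc; exfalso; apply: tS; rewrite inE.
  have tc' : 0 < c - t by rewrite subr_gt0.
  exists (Num.truncn (c / (c - t))) => //; rewrite /S /= in_itv /= t0 /=.
  rewrite lerBrDr -lerBrDl ler_pdivrMr// mulrC -ler_pdivrMr// ltW//.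
  by apply: (lt_trans (truncnS_gt _)); rewrite ltr_nat.
have ndS : nondecreasing_seq S.
  move=> k m km; apply/subsetPset => t; rewrite /S /= !in_itv /= => /andP[-> /=].
  move=> /le_trans; apply; rewrite lerD2l lerN2 ler_pM2l// lef_pV2 ?posrE//.
  by rewrite ler_nat.
have C := @ge0_nondecreasing_set_cvg_integral _ (measurableTypeR R) R S (fun t => (edge_weight b c t)%:E) lam ndS mS
  (fun i => measurable_funTS (proj2 (measurable_EFinP _ _) mh)) (fun i t _ => edge_weight_ge0 b c t).
rewrite -(cvg_lim _ C)//; apply: lime_le; first exact: cvgP C.
apply: nearW => k.
have k0 : 0 < c - c / k.+2%:R by rewrite subr_gt0.
have W t : t \in `[0, c - c / k.+2%:R] -> t < c.
  by rewrite in_itv /= => /andP[_ /le_lt_trans]; apply; rewrite ltrBlDr ltrDl divr_gt0.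
have cF t : t < c -> {for t, continuous (fun t => - ((1 - b)^-1 * (c - t) `^ (1 - b)))}.
  move=> tc; apply: differentiable_continuous; apply/derivable1_diffP.
  exact: (@ex_derive _ _ _ _ _ _ _ (is_derive_edge b01 tc)).
have := @continuous_FTC2 R (fun t => (c - t) `^ (- b))
  (fun t => - ((1 - b)^-1 * (c - t) `^ (1 - b))) 0 (c - c / k.+2%:R) k0.
have E : (\int[lam]_(t in S k) (edge_weight b c t)%:E =
    \int[lam]_(t in S k) ((c - t) `^ (- b))%:E)%E.
  by apply: eq_integral => t; rewrite inE => /W tc; rewrite /edge_weight tc.
rewrite E => ->.
- rewrite -EFinB lee_fin subr0 opprK addrC -mulrBr ler_wpM2l ?invr_ge0 ?subr_ge0 ?(ltW b1)//.
  apply: (@le_trans _ _ (c `^ (1 - b))); first by rewrite lerBlDr lerDl powR_ge0.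
  by apply: ge0_ler_powR; rewrite ?nnegrE ?subr_ge0// ltW.
- apply: continuous_in_subspaceT => t; rewrite inE => /W tc.
  apply: differentiable_continuous; apply/derivable1_diffP.
  exact: (@ex_derive _ _ _ _ _ _ _ (is_derive_edgeV _ tc)).
- split.
  + move=> t; rewrite in_itv /= => /andP[t0 tk].
    apply: (@ex_derive _ _ _ _ _ _ _ (is_derive_edge b01 (W _ _))).
    by rewrite in_itv /= !ltW.
  + apply: cvg_at_right_filter; apply: cF; apply: W; by rewrite in_itv /= lexx ltW.
  + apply: cvg_at_left_filter; apply: cF; apply: W; by rewrite in_itv /= lexx ltW.
- move=> t; rewrite in_itv /= => /andP[t0 tk]; rewrite derive1E.
  apply: (@derive_val _ _ _ _ _ _ _ (is_derive_edge b01 (W _ _))).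
  by rewrite in_itv /= !ltW.
Qed.

End one_dimensional_weight.

(** * From the logarithmic modulus of the graph to the weight *)

Section logarithmic_modulus.
Variable R : realType.
Implicit Types (A alpha beta d s q rho l : R).

(** This is y <= e^y at y = l/(2 alpha), raised to the power alpha. *)
Lemma powR_le_expR alpha l : 0 < alpha -> 0 <= l ->
  l `^ alpha <= (2 * alpha) `^ alpha * expR (l / 2).
Proof.
move=> a0 l0; pose y := l / (2 * alpha).
have a20 : 0 < 2 * alpha by rewrite mulr_gt0.
have y0 : 0 <= y by rewrite divr_ge0// ltW.
have -> : l = (2 * alpha) * y by rewrite mulrC divfK// gt_eqF.
rewrite powRM ?(ltW a20)// ler_wpM2l ?powR_ge0//.
have -> : (2 * alpha) * y / 2 = y * alpha by field.
rewrite expRM; apply: ge0_ler_powR; rewrite ?nnegrE ?expR_ge0 ?(ltW a0)//.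
by apply: le_trans (expR_ge1Dx y); rewrite lerDr.
Qed.

(** The first term pays for |ln q| >= |ln d|/2, the second for rho < sqrt d <= (2 alpha)^alpha |ln
    d|^(-alpha). *)
Definition log_modulus_cst A alpha := `|A| * 2 `^ alpha + (2 * alpha) `^ alpha.

Lemma log_modulus_cst_gt0 A alpha : 0 < alpha -> 0 < log_modulus_cst A alpha.
Proof. by move=> a0; rewrite ltr_wpDl ?mulr_ge0 ?powR_ge0// powR_gt0 ?mulr_gt0. Qed.

(** To be used with [d] the distance of a point to the boundary, [rho] its distance to an
    approximately nearest boundary point and [q] the horizontal part of the latter. From q <= rho
    and rho^2 < d, a positive q satisfies |ln q| >= |ln d|/2. *)
Lemma log_modulus A alpha d s q rho : 0 < alpha -> 0 < d < expR (- 1) ->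
  0 <= q <= rho -> 0 < rho -> rho ^+ 2 < d ->
  s <= A * `|ln q| `^ (- alpha) + rho ->
  s <= log_modulus_cst A alpha * `|ln d| `^ (- alpha).
Proof.
move=> a0 /andP[d0 d1] /andP[q0 qr] r0 rd sA.
pose l := - ln d.
have l1 : 1 < l by rewrite /l ltrNr -[ltRHS]expRK ltr_ln ?posrE ?expR_gt0.
have l0 : 0 < l by exact: lt_trans l1.
have dl : `|ln d| = l by rewrite -normrN gtr0_norm.
have lr : l / 2 < - ln rho.
  have := rd; rewrite -ltr_ln ?posrE ?exprn_gt0// lnXn// => h.
  by move: h; rewrite /l mulr2n; lra.
have Lq : `|ln q| `^ (- alpha) <= (l / 2) `^ (- alpha).
  (* At q = 0 the convention ln 0 = 0 would spoil the lower bound on |ln q|, but the power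
     0^(-alpha) is then itself 0. *)
  have [->|qn0] := eqVneq q 0.
    by rewrite ln0// normr0 powR0 ?powR_ge0// oppr_eq0 gt_eqF.
  have qp : 0 < q by rewrite lt_neqAle eq_sym qn0.
  have lq : l / 2 <= `|ln q|.
    rewrite -normrN; apply: le_trans (ler_norm _).
    apply: le_trans (ltW lr) _; rewrite lerN2 ler_ln ?posrE//.
  rewrite !powRN lef_pV2 ?posrE ?powR_gt0 ?divr_gt0//; last first.
    by apply: lt_le_trans lq; rewrite divr_gt0.
  by apply: ge0_ler_powR; rewrite ?nnegrE ?(ltW a0) ?divr_ge0 ?(ltW l0).
have Lr : rho <= (2 * alpha) `^ alpha * l `^ (- alpha).
  apply: (@le_trans _ _ (expR (- (l / 2)))).
    by rewrite -[leLHS]lnK ?posrE// ler_expR lerNr ltW.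
  rewrite powRN ler_pdivlMr ?powR_gt0// expRN mulrC ler_pdivrMr ?expR_gt0//.
  exact: powR_le_expR (ltW l0).
rewrite dl; apply: le_trans sA _; rewrite /log_modulus_cst mulrDl lerD//.
apply: (@le_trans _ _ (`|A| * `|ln q| `^ (- alpha))).
  by rewrite ler_wpM2r ?powR_ge0// ler_norm.
rewrite -mulrA ler_wpM2l//; apply: le_trans Lq _.
rewrite powRM ?(ltW l0)// mulrC ler_wpM2r ?powR_ge0//.
by rewrite -powR_inv1// -powRrM mulN1r opprK.
Qed.

(** Raise s <= A |ln d|^(-alpha) to the power beta. The condition d < 1/e makes |ln d| > 1, whence s
    <= A. *)
Lemma log_weight_le A alpha beta d s : 0 < alpha -> 0 < beta -> 0 < d < expR (- 1) ->
  0 < s -> s <= A * `|ln d| `^ (- alpha) -> 0 < A ->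
  s <= A /\ `|ln d| `^ (alpha * beta) <= A `^ beta * s `^ (- beta).
Proof.
move=> a0 b0 /andP[d0 d1] s0 sA A0.
pose l := `|ln d|; rewrite -/l in sA *.
have l1 : 1 < l.
  rewrite /l -normrN; apply: lt_le_trans (ler_norm _).
  by rewrite ltrNr -[ltRHS]expRK ltr_ln ?posrE ?expR_gt0.
have l0 : 0 < l by exact: lt_trans l1.
split.
  apply: le_trans sA _; rewrite ler_piMr ?(ltW A0)// powRN invf_le1 ?powR_gt0//.
  by rewrite -(powRr0 l) ler_powR ?(ltW l1) ?(ltW a0).
rewrite powRN ler_pdivlMr ?powR_gt0//.
apply: (@le_trans _ _ (l `^ (alpha * beta) * (A * l `^ (- alpha)) `^ beta)).
  rewrite ler_wpM2l ?powR_ge0//; apply: ge0_ler_powR; rewrite ?nnegrE ?(ltW b0) ?(ltW s0)//.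
  by rewrite mulr_ge0 ?powR_ge0// ltW.
rewrite powRM ?powR_ge0 ?(ltW A0)// mulrCA -powRrM -powRD; last first.
  by apply/implyP => _; rewrite gt_eqF.
by rewrite mulNr subrr powRr0 mulr1.
Qed.

End logarithmic_modulus.

Section averaging.
Variables (R : realType) (n : nat) (Omega : set 'rV[R]_n).
Local Notation mu := (lebesgue_rV R n).
Local Notation lam := (@lebesgue_measure R).
Hypotheses (oO : open Omega) (bO : bounded_set Omega).

(* Averaging f(x)^2 <= 2 f(x + te)^2 + 2 (f(x + te) - f(x))^2 over t in [0, T]. *)
Lemma weighted_average (T M rho : R) (e : 'rV[R]_n) (O : set 'rV[R]_n)
    (w f : 'rV[R]_n -> R) : W12 Omega f -> 0 < T -> 0 <= M -> open O ->
  (forall x t, O x -> 0 <= t <= T -> Omega (x + t *: e)) ->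
  measurable_fun setT w -> (forall x, 0 <= w x) -> (forall x, w x != 0 -> O x) ->
  (forall i, `|e ord0 i| <= rho) ->
  (forall y, \int[lam]_t (\1_`[0%R, T] t * w (y - t *: e)%R)%:E <= M%:E)%E ->
  (\int[mu]_x (w x * (f \_ Omega) x ^+ 2)%:E <=
   (2 * M / T * L2_norm Omega f ^+ 2 +
    2 * T * M * (n%:R * rho ^+ 2) * dirichlet_form Omega f)%:E)%E.
Proof.
move=> fW T0 M0 oO' hO mw w0 wO eB wM.
set F := f \_ Omega.
have mF : measurable_fun setT F by exact: W12_measurable.
have mFs (v : 'rV[R]_n) : measurable_fun setT (fun x : 'rV[R]_n => F (x + v)).
  exact: (measurableT_comp mF (measurable_rV_shift v)).
have mI t : measurable_fun setT (\1_`[0, t] : R -> R).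
  by apply: measurable_indic; exact: measurable_itv.
set I := (\int[mu]_x _)%E.
have I0 : (0 <= I)%E by apply: integral_ge0 => x _; rewrite lee_fin mulr_ge0// sqr_ge0.
pose J (t : R) := (\int[mu]_x (w x * F (x + t *: e) ^+ 2)%:E)%E.
have J0 t : (0 <= J t)%E by apply: integral_ge0 => x _; rewrite lee_fin mulr_ge0// sqr_ge0.
set Q := dirichlet_form Omega f.
have Q0 : 0 <= Q by exact: dirichlet_form_ge0.
pose K := 2 * (T * M * (n%:R * rho ^+ 2) * Q).
have nr0 : 0 <= n%:R * rho ^+ 2 by rewrite mulr_ge0// sqr_ge0.
have K0 : 0 <= K by rewrite mulr_ge0// mulr_ge0// mulr_ge0// mulr_ge0// ltW.
(* The pointwise inequality integrated against [w] for a fixed t; t = 0 is separate because the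
   translation estimate wants a positive length. *)
have step t : 0 <= t <= T -> (I <= 2%:E * J t + K%:E)%E.
  move=> /andP[]; rewrite le_eqVlt => /predU1P[<- _|t0 tT].
    rewrite /J; under [in leRHS]eq_integral do rewrite scale0r addr0.
    rewrite -/I; apply: (@le_trans _ _ (2%:E * I)%E); last by rewrite leeDl// lee_fin.
    by rewrite -[leLHS]mul1e lee_wpmul2r// lee_fin ler1n.
  apply: (@le_trans _ _ (2%:E * J t +
      2%:E * \int[mu]_x (w x * (F (x + t *: e) - F x) ^+ 2)%:E)%E); last first.
    rewrite leeD2l// /K EFinM lee_wpmul2l//.
    apply: le_trans (W12_weighted_translation (M := M) (rho := rho) (O := O) oO bO fW t0 M0 oO' _ mw w0 wO eB _) _.
    - by move=> x u Ox /andP[u0 ut]; apply: hO => //; rewrite u0 (le_trans ut).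
    - move=> y; apply: le_trans (wM y); apply: ge0_le_integral => //.
      + by move=> u _; rewrite lee_fin mulr_ge0.
      + apply/measurable_EFinP; apply: measurable_funM => //.
        exact: (measurableT_comp mw (measurableT_comp (measurable_rV_subZ e) (measurable_pair1 y))).
      + apply/measurable_EFinP; apply: measurable_funM => //.
        exact: (measurableT_comp mw (measurableT_comp (measurable_rV_subZ e) (measurable_pair1 y))).
      + move=> u _; rewrite lee_fin ler_wpM2r// !indicE ler_nat.
        have [|//] := boolP (u \in `[0, t]%classic); rewrite inE /= in_itv /= => /andP[u0 ut].
        by rewrite mem_set//= in_itv /= u0 (le_trans ut).
    have E u : u * M * (n%:R * rho ^+ 2) * Q = u * (M * (n%:R * rho ^+ 2) * Q) by ring.
    by rewrite lee_fin !E ler_wpM2r// mulr_ge0// mulr_ge0.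
  rewrite -!ge0_integralZ_real//; last 4 first.
  - apply: measurable_funM => //; apply: measurable_funX.
    exact: measurable_funB.
  - by move=> x; rewrite mulr_ge0// sqr_ge0.
  - by apply: measurable_funM => //; exact: measurable_funX.
  - by move=> x; rewrite mulr_ge0// sqr_ge0.
  rewrite -ge0_integralD//; last 4 first.
  - by move=> x _; rewrite lee_fin mulr_ge0// mulr_ge0// sqr_ge0.
  - apply/measurable_EFinP; apply: measurable_funM => //; apply: measurable_funM => //.
    exact: measurable_funX.
  - by move=> x _; rewrite lee_fin mulr_ge0// mulr_ge0// sqr_ge0.
  - apply/measurable_EFinP; apply: measurable_funM => //; apply: measurable_funM => //.
    by apply: measurable_funX; exact: measurable_funB.
  apply: ge0_le_integral => //.
  - by move=> x _; rewrite lee_fin mulr_ge0// sqr_ge0.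
  - apply/measurable_EFinP; apply: measurable_funM => //; exact: measurable_funX.
  - apply/measurable_EFinP; apply: measurable_funD.
      apply: measurable_funM => //; apply: measurable_funM => //; exact: measurable_funX.
    apply: measurable_funM => //; apply: measurable_funM => //.
    by apply: measurable_funX; exact: measurable_funB.
  move=> x _; rewrite -EFinD lee_fin.
  set u := F (x + t *: e); set v := F x.
  have uv : v ^+ 2 <= 2 * u ^+ 2 + 2 * (u - v) ^+ 2.
    by have := sqr_ge0 (2 * u - v); rewrite !expr2; lra.
  apply: le_trans (ler_wpM2l (w0 x) uv) _.
  by rewrite le_eqVlt; apply/orP; left; apply/eqP; ring.
pose H (p : 'rV[R]_n * measurableTypeR R) : R :=
  w p.1 * (\1_`[0, T] p.2 * F (p.1 + p.2 *: e) ^+ 2).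
pose H' (p : 'rV[R]_n * measurableTypeR R) : R :=
  F p.1 ^+ 2 * (\1_`[0, T] p.2 * w (p.1 - p.2 *: e)).
have mF2 : measurable_fun setT (fun x => F x ^+ 2) by exact: measurable_funX.
have mH : measurable_fun setT H.
  apply: measurable_funM; first exact: (measurableT_comp mw measurable_fst).
  exact: measurable_line_kernel mF2.
have mH' : measurable_fun setT H'.
  apply: measurable_funM; first exact: (measurableT_comp mF2 measurable_fst).
  apply: measurable_funM; first exact: (measurableT_comp (mI T) measurable_snd).
  exact: (measurableT_comp mw (measurable_rV_subZ e)).
have H0 p : 0 <= H p by rewrite mulr_ge0// mulr_ge0// sqr_ge0.
have H'0 p : 0 <= H' p by rewrite mulr_ge0// ?sqr_ge0// mulr_ge0.
(* Shifting by -te puts F^2 at a point independent of t and leaves the line integral of the weight,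
   at most [M]. *)
have key : (\int[lam]_t ((\1_`[0, T] t)%:E * J t) <= (M * L2_norm Omega f ^+ 2)%:E)%E.
  have -> : (\int[lam]_t ((\1_`[0, T] t)%:E * J t) = \int[lam]_t \int[mu]_x (H' (x, t))%:E)%E.
    apply: eq_integral => t _; rewrite /J -ge0_integralZ_real//; last 2 first.
    - by apply: measurable_funM => //; exact: measurable_funX.
    - by move=> x; rewrite mulr_ge0// sqr_ge0.
    rewrite -(@ge0_integral_shift _ _ (- (t *: e)) (fun x => (\1_`[0, T] t * (w x * F (x + t *: e) ^+ 2))%:E)).
    - by apply: eq_integral => x _; rewrite /H' /= subrK; congr EFin; ring.
    - apply/measurable_EFinP; apply: measurable_funM => //.
      by apply: measurable_funM => //; exact: measurable_funX.
    - by move=> x; rewrite lee_fin mulr_ge0// mulr_ge0// sqr_ge0.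
  rewrite -(@fubini_tonelli _ _ _ _ _ mu lam (fun p => (H' p)%:E))//; last exact/measurable_EFinP.
  rewrite EFinM -(W12_L2_norm fW) -ge0_integralZ_real//; last first.
    by move=> x; exact: sqr_ge0.
  apply: ge0_le_integral => //.
  - by move=> x _; apply: integral_ge0 => t _; rewrite lee_fin.
  - apply: (@measurable_fun_fubini_tonelli_F _ _ _ _ _ lam (fun p => (H' p)%:E)) => //.
    exact/measurable_EFinP.
  - by apply/measurable_EFinP; exact: measurable_funM.
  move=> x _; rewrite /H' /= ge0_integralZ_real ?sqr_ge0//; last 2 first.
  - apply: measurable_funM => //.
    exact: (measurableT_comp mw (measurableT_comp (measurable_rV_subZ e) (measurable_pair1 x))).
  - by move=> t; rewrite mulr_ge0.
  by rewrite [leRHS]EFinM [leRHS]muleC lee_wpmul2l// lee_fin sqr_ge0.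
have mJ : measurable_fun setT J.
  apply: (@measurable_fun_fubini_tonelli_G _ _ _ _ _ mu
    (fun p : 'rV[R]_n * measurableTypeR R => (w p.1 * F (p.1 + p.2 *: e) ^+ 2)%:E)) => //.
    apply/measurable_EFinP; apply: measurable_funM.
      exact: (measurableT_comp mw measurable_fst).
    exact: (measurableT_comp mF2 (measurable_rV_addZ e)).
  by move=> p; rewrite lee_fin mulr_ge0// sqr_ge0.
have LT : lam `[0, T]%classic = T%:E.
  by rewrite lebesgue_measure_itv/= lte_fin T0 -EFinB subr0.
have intI : (\int[lam]_t (\1_`[0%R, T] t)%:E = T%:E)%E.
  by rewrite integral_indic// setIT.
have mIE : measurable_fun setT (fun t => (\1_`[0, T] t)%:E : \bar R).
  exact/measurable_EFinP.
have TI : (T%:E * I <= 2%:E * (M * L2_norm Omega f ^+ 2)%:E + (K * T)%:E)%E.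
  rewrite -intI muleC -ge0_integralZl//.
  apply: (@le_trans _ _ (\int[lam]_t (2%:E * ((\1_`[0%R, T] t)%:E * J t) + K%:E * (\1_`[0%R, T] t)%:E))%E).
    apply: ge0_le_integral => //.
    - by move=> t _; rewrite mule_ge0.
    - exact: emeasurable_funM.
    - apply: emeasurable_funD; last exact: emeasurable_funM.
      by apply: emeasurable_funM => //; exact: emeasurable_funM.
    move=> t _; rewrite indicE.
    have [|_] := boolP (t \in `[0, T]%classic); last first.
      by rewrite mule0 mul0e !mule0 adde0.
    by rewrite inE /= in_itv /= mule1 mul1e mule1 => /step.
  rewrite ge0_integralD//; last 4 first.
  - by move=> t _; rewrite mule_ge0// mule_ge0// lee_fin.
  - by apply: emeasurable_funM => //; exact: emeasurable_funM.
  - by move=> t _; rewrite mule_ge0 ?lee_fin.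
  - exact: emeasurable_funM.
  rewrite [(K * T)%:E]EFinM -intI; apply: leeD.
    rewrite ge0_integralZl//; last 2 first.
    - exact: emeasurable_funM.
    - by move=> t _; rewrite mule_ge0// lee_fin.
    by rewrite lee_wpmul2l.
  by rewrite ge0_integralZl// lee_fin.
(* [TI] bounds T times [I] by a real number, which rules out an infinite [I] before T is divided
   out. *)
move: TI I0 {step}; case: (I) => [r| |] //=; last by rewrite gt0_muley ?lte_fin.
rewrite -!EFinM -EFinD !lee_fin => TI _.
rewrite -(ler_pM2l T0); apply: le_trans TI _.
rewrite le_eqVlt; apply/orP; left; apply/eqP; rewrite /K.
by field; rewrite gt_eqF.
Qed.

End averaging.

(** * Graph coordinates *)

Section coordinates.
Variables (R : realType) (n : nat).
Implicit Types x y : 'rV[R]_n.+1.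

Lemma enorm_init_le x : enorm (rV_init x) <= enorm x.
Proof.
rewrite ler_wsqrtr// [leRHS]big_ord_recr/= (_ : \sum_i _ = \sum_(i < n) x ord0 (widen_ord (leqnSn n) i) ^+ 2).
  by rewrite lerDl sqr_ge0.
apply: eq_bigr => i _; rewrite mxE; congr (x ord0 _ ^+ 2); apply: val_inj.
by rewrite /= /bump leqNgt ltn_ord.
Qed.

Lemma last_le_enorm x : `|rV_last x| <= enorm x.
Proof. exact: coord_le_enorm. Qed.

Lemma rV_initB x y : rV_init (x - y) = rV_init x - rV_init y.
Proof. by apply/rowP => i; rewrite !mxE. Qed.

Lemma rV_lastB x y : rV_last (x - y) = rV_last x - rV_last y.
Proof. by rewrite /rV_last !mxE. Qed.

Lemma enorm_change_coord (P : 'M[R]_n.+1) c x y : P *m P^T = 1%:M ->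
  enorm (change_coord P c x - change_coord P c y) = enorm (x - y).
Proof.
move=> PP; rewrite -mulmxBl (enorm_orthogonal _ PP); congr enorm.
by rewrite opprB addrA subrK.
Qed.

(** The vector that the linear part of [change_coord] sends to minus the last basis vector: rows are
    multiplied by [P] on the right, and P^T undoes this. [Omega] lies below the graph, so the
    direction is inward. *)
Definition down (P : 'M[R]_n.+1) : 'rV[R]_n.+1 := - (delta_mx ord0 ord_max *m P^T).

Lemma change_coord_down (P : 'M[R]_n.+1) c x t : P *m P^T = 1%:M ->
  change_coord P c (x + t *: down P) =
  change_coord P c x - t *: delta_mx ord0 ord_max.
Proof.
move=> /mulmx1C PP; rewrite /change_coord addrAC mulmxDl; congr (_ + _).
by rewrite -scalemxAl mulNmx -mulmxA PP mulmx1 scalerN.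
Qed.

Lemma rV_init_down x t : rV_init (x - t *: delta_mx ord0 ord_max) = rV_init x.
Proof.
apply/rowP => i; rewrite !mxE eqxx/= (_ : _ == _ = false) ?mulr0 ?subr0//.
by apply/negbTE; rewrite eq_sym; exact: neq_lift.
Qed.

Lemma rV_last_down x t : rV_last (x - t *: delta_mx ord0 ord_max) = rV_last x - t.
Proof. by rewrite /rV_last !mxE !eqxx mulr1. Qed.

Lemma down_le1 (P : 'M[R]_n.+1) i : P *m P^T = 1%:M -> `|down P ord0 i| <= 1.
Proof.
move=> /mulmx1C PP; apply: le_trans (coord_le_enorm _ _) _.
rewrite enormN enorm_orthogonal ?trmxK// /enorm (bigD1 ord_max)//= mxE !eqxx.
rewrite big1 => [|j jm]; first by rewrite addr0 expr1n sqrtr1.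
by rewrite mxE eqxx/= (negPf jm) expr0n.
Qed.

End coordinates.

(** * Local log-Hardy inequalities and their globalization *)

Section boundary_estimate.
Variables (R : realType) (n : nat) (Omega : set 'rV[R]_n.+1) (alpha beta : R).
Local Notation mu := (lebesgue_rV R n.+1).
Local Notation lam := (@lebesgue_measure R).
Local Notation dist := (dist_boundary Omega).
Hypotheses (O0 : Omega !=set0) (oO : open Omega) (bO : bounded_set Omega).
Hypotheses (alpha0 : 0 < alpha) (beta01 : 0 < beta < 1).

Definition log_weight x : R := `|ln (dist_boundary Omega x)| `^ (alpha * beta).

Lemma log_weight_ge0 x : 0 <= log_weight x.
Proof. exact: powR_ge0. Qed.

Lemma measurable_log_weight : measurable_fun setT log_weight.
Proof.
apply: (measurableT_comp (measurable_powR _)).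
apply: measurableT_comp => //; apply: measurableT_comp => //.
exact: measurable_dist.
Qed.

(** A property of open sets with a constant independent of [f], so that it passes to finite unions
    and compactness of the closure applies. *)
Definition hardy_on (W : set 'rV[R]_n.+1) := open W /\ exists2 C : R, 0 <= C &
  forall f, W12 Omega f ->
    (\int[mu]_(x in Omega `&` W) (log_weight x * `|f x| ^+ 2)%:E <=
     (C * (dirichlet_form Omega f + L2_norm Omega f ^+ 2))%:E)%E.

Lemma integral_OmegaI (W : set 'rV[R]_n.+1) (w f : 'rV[R]_n.+1 -> R) :
  (\int[mu]_(x in Omega `&` W) (w x * `|f x| ^+ 2)%:E =
   \int[mu]_x ((\1_(Omega `&` W) x * w x) * (f \_ Omega) x ^+ 2)%:E)%E.
Proof.
rewrite integral_mkcond; apply: eq_integral => x _; rewrite /patch indicE.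
have [|_] := boolP (x \in Omega `&` W); last by rewrite mul0r mul0r.
rewrite inE => -[Ox Wx]; rewrite mem_set// mul1r; congr (_ * _)%:E.
by rewrite real_normK ?num_real.
Qed.

(** Extracts from the graph all that averaging needs. On a line parallel to [e] the horizontal
    coordinates are constant, so the height below the graph at [y - t *: e] is exactly c - t, and
    the weight becomes a one-dimensional power with a single edge. *)
Lemma boundary_flattening a : boundary Omega a -> log_regular alpha Omega a ->
  exists (r T S : R) (e : 'rV[R]_n.+1),
  [/\ 0 < r, 0 < T, 0 <= S, (forall i, `|e ord0 i| <= 1) &
   [/\ forall x t, Omega x -> enorm (a - x) < r -> 0 <= t <= T -> Omega (x + t *: e) &
   forall y, exists2 c, c <= S + T & forall t, 0 <= t <= T ->
     Omega (y - t *: e) -> enorm (a - (y - t *: e)) < r ->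
     log_weight (y - t *: e) <= S `^ beta * edge_weight beta c t]].
Proof.
move=> ba [V [P [c [g [A [[oV Va] PP OV [Ba Ga] [g0 gA]]]]]]].
set U := (X in Omega `&` V = _ @^-1` X) in OV.
set Tr := change_coord P c in OV Ba Ga *.
have UO x : U (Tr x) -> Omega x.
  by move=> Ux; suff [] : (Omega `&` V) x by []; rewrite OV.
have {OV}UP x : V x -> Omega x <-> U (Tr x).
  move=> Vx; split; last exact: UO.
  by move=> Ox; have : (Omega `&` V) x by []; rewrite OV.
have [rV rV0 hV] := nbhs_enorm (open_nbhs_nbhs (conj oV Va)).
(* Half the height of [a]: nearby points have height above T, so sliding them down by at most T
   keeps them above the bottom of the cell. *)
pose T := rV_last (Tr a) / 2.
have T0 : 0 < T by rewrite divr_gt0// Ga g0.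
have q0 : 0 < 2^-1 - enorm (rV_init (Tr a)) by rewrite subr_gt0.
pose r1 := Num.min rV (Num.min T (2^-1 - enorm (rV_init (Tr a)))).
have r10 : 0 < r1 by rewrite !lt_min rV0 T0 q0.
have near_a z : enorm (a - z) < r1 ->
    [/\ V z, half_ball (rV_init (Tr z)) & T < rV_last (Tr z)].
  rewrite !lt_min => /andP[zV /andP[zT zq]]; split; first exact: hV.
    rewrite /half_ball /= -[X in enorm X](subrK (rV_init (Tr a))).
    apply: le_lt_trans (enorm_triangle _ _) _.
    rewrite -ltrBrDr; apply: le_lt_trans zq.
    rewrite -rV_initB; apply: le_trans (enorm_init_le _) _.
    by rewrite enorm_change_coord// enormB.
  have := last_le_enorm (Tr a - Tr z); rewrite enorm_change_coord// => h.
  have := le_lt_trans h zT; rewrite rV_lastB => /ltr_normlW.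
  by rewrite /T; lra.
(* The first two bounds keep a boundary point within sqrt r of x in the r1-neighbourhood of [a]; the
   third gives |ln d| > 1. *)
pose r := Num.min (Num.min (r1 / 2) ((r1 / 2) ^+ 2)) (expR (- 1)).
have r0 : 0 < r by rewrite !lt_min expR_gt0 exprn_gt0 divr_gt0.
have [rr1 rr2 re] : [/\ r <= r1 / 2, r <= (r1 / 2) ^+ 2 & r <= expR (- 1)].
  by split; rewrite /r !ge_min lexx ?orbT.
have e1 : expR (- 1) < 1 :> R by rewrite -[ltRHS]expR0 ltr_expR oppr_lt0.
pose S := log_modulus_cst A alpha.
have S0 : 0 < S by exact: log_modulus_cst_gt0.
have half_lt z : enorm (a - z) < r -> enorm (a - z) < r1.
  by move=> /lt_le_trans; apply; apply: le_trans rr1 _; lra.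
have weight x : Omega x -> enorm (a - x) < r ->
    let s := g (rV_init (Tr x)) - rV_last (Tr x) in
    [/\ 0 < s, s <= S & log_weight x <= S `^ beta * s `^ (- beta)].
  move=> Ox xr s.
  have [Vx Bx Tx] := near_a _ (half_lt _ xr).
  have [_ /andP[_ sx]] := (UP _ Vx).1 Ox.
  have s0 : 0 < s by rewrite subr_gt0.
  have d0 : 0 < dist x by exact: dist_gt0.
  have dr : dist x < r by apply: le_lt_trans xr; rewrite enormB; exact: dist_le.
  have de : dist x < expR (- 1) by exact: lt_le_trans re.
  (* d < 1 leaves room between d and sqrt d, so some boundary point lies within sqrt d of x. *)
  have sd : dist x < Num.sqrt (dist x).
    rewrite -[ltLHS]ger0_norm ?(ltW d0)// -sqrtr_sqr ltr_sqrt//.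
    by rewrite expr2 gtr_pMr//; exact: lt_trans e1.
  have [y by_ xy] := dist_lt O0 oO bO sd.
  have Oy : ~ Omega y by exact: boundary_notin by_.
  set rho := enorm (x - y) in xy.
  have rho0 : 0 < rho by apply: lt_le_trans d0 _; exact: dist_notin.
  have rho2 : rho ^+ 2 < dist x.
    by rewrite -[ltRHS](sqr_sqrtr (ltW d0)) ltrXn2r ?nnegrE ?sqrtr_ge0 ?(ltW rho0).
  have ya : enorm (a - y) < r1.
    rewrite -[a - y](subrKA x); apply: le_lt_trans (enorm_triangle _ _) _.
    rewrite -/rho [ltRHS](_ : r1 = r1 / 2 + r1 / 2); last by lra.
    rewrite ltrD//; first exact: lt_le_trans rr1.
    apply: lt_le_trans xy _; rewrite -[leRHS]ger0_norm ?divr_ge0 ?(ltW r10)//.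
    by rewrite -sqrtr_sqr ler_wsqrtr// (le_trans (ltW dr)).
  have [Vy By Ty] := near_a _ ya.
  (* [y] is outside [Omega] but in the cell's neighbourhood and above its bottom, so only the upper
     inequality can fail: [y] is on or above the graph. *)
  have gy : g (rV_init (Tr y)) <= rV_last (Tr y).
    rewrite leNgt; apply/negP => h; apply: Oy; apply/(UP _ Vy); split => //.
    by rewrite h (lt_trans T0 Ty).
  set q := enorm (rV_init (Tr x) - rV_init (Tr y)).
  have qr : q <= rho.
    by rewrite /q -rV_initB; apply: le_trans (enorm_init_le _) _; rewrite enorm_change_coord.
  (* s = (g(x') - g(y')) + (g(y') - x_N), and g(y') <= y_N bounds the second bracket by rho. *)
  have sA : s <= A * `|ln q| `^ (- alpha) + rho.
    have h1 := le_trans (ler_norm _) (gA _ _ Bx By).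
    have h2 : rV_last (Tr y) - rV_last (Tr x) <= rho.
      rewrite /rho enormB -(enorm_change_coord c y x PP).
      apply: le_trans (last_le_enorm _); apply: le_trans (ler_norm _).
      by rewrite rV_lastB.
    by move: h1 h2 gy; rewrite /s /q; lra.
  have dd : 0 < dist x < expR (- 1) by rewrite d0.
  have qq : 0 <= q <= rho by rewrite enorm_ge0 qr.
  have H := log_modulus alpha0 dd qq rho0 rho2 sA.
  have /andP[b0 _] := beta01.
  by have [h1 h2] := log_weight_le alpha0 b0 dd s0 H S0; split.
exists r, T, S, (down P); split => //.
- exact: ltW.
- by move=> i; exact: down_le1.
split.
- move=> x t Ox xr /andP[t0 tT].
  have [Vx Bx Tx] := near_a _ (half_lt _ xr).
  have [_ /andP[x0 xg]] := (UP _ Vx).1 Ox.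
  apply: UO; rewrite /Tr change_coord_down// -/(Tr x); split; rewrite ?rV_init_down//.
  rewrite rV_last_down subr_gt0 (le_lt_trans tT)//=.
  by apply: le_lt_trans xg; rewrite gerBl.
- move=> y; pose c0 := g (rV_init (Tr y)) - rV_last (Tr y).
  have sE t : g (rV_init (Tr (y - t *: down P))) - rV_last (Tr (y - t *: down P)) = c0 - t.
    rewrite -scaleNr /Tr change_coord_down// -/(Tr y) rV_init_down rV_last_down /c0.
    by rewrite opprK; lra.
  (* The minimum only serves the uniform bound: wherever the estimate is used, c0 = s + t <= S +
     T. *)
  exists (Num.min c0 (S + T)); first by rewrite ge_min lexx orbT.
  move=> t /andP[t0 tT] Oyt yr.
  have [s0 sS] := weight _ Oyt yr; rewrite sE in s0 sS *.
  move=> h; have -> : Num.min c0 (S + T) = c0.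
    by apply/min_idPl; move: sS tT; lra.
  by rewrite /edge_weight -subr_gt0 s0.
Qed.

Lemma measurable_local_weight (W : set 'rV[R]_n.+1) : open W ->
  measurable_fun setT (fun x => \1_(Omega `&` W) x * log_weight x).
Proof.
move=> oW; apply: measurable_funM; last exact: measurable_log_weight.
by apply: measurable_indic; apply: open_measurable_rV; exact: openI.
Qed.

Lemma hardy_boundary a : boundary Omega a -> log_regular alpha Omega a ->
  exists2 W, hardy_on W & W a.
Proof.
move=> ba reg; have [r [T [S [e [r0 T0 S0 e1 [hO hw]]]]]] := boundary_flattening ba reg.
pose W := [set x | enorm (a - x) < r].
have oW : open W by exact: open_enorm_ball.
exists W; last by rewrite /W /= subrr /enorm big1 ?sqrtr0// => i _; rewrite mxE expr0n.
split => //.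
have /andP[b0 b1] := beta01.
(* S^beta comes from the pointwise bound on the weight, the rest from integrating (c - t)^(-beta)
   with c <= S + T. *)
pose M := S `^ beta * ((1 - beta)^-1 * (S + T) `^ (1 - beta)).
have M0 : 0 <= M.
  by rewrite mulr_ge0 ?powR_ge0// mulr_ge0 ?powR_ge0// invr_ge0 subr_ge0 ltW.
have T0' := ltW T0.
have c10 : 0 <= 2 * M / T by rewrite divr_ge0// mulr_ge0.
have c20 : 0 <= 2 * T * M * (n.+1%:R * 1 ^+ 2).
  by rewrite mulr_ge0 // mulr_ge0 // mulr_ge0.
exists (2 * M / T + 2 * T * M * (n.+1%:R * 1 ^+ 2)); first exact: addr_ge0.
move=> f fW; rewrite integral_OmegaI.
have Q0 : 0 <= dirichlet_form Omega f by exact: dirichlet_form_ge0.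
have mw := measurable_local_weight oW.
apply: le_trans (@weighted_average _ _ Omega oO bO T M 1 e (Omega `&` W) _ f fW T0 M0 _ _ mw _ _ e1 _) _.
- exact: openI.
- by move=> x t [Ox Wx] /hO; exact.
- by move=> x; rewrite mulr_ge0 ?log_weight_ge0.
- by move=> x; rewrite indicE; have [|] := boolP (x \in _); rewrite ?mul0r ?eqxx// inE.
- move=> y; have [c cST hc] := hw y.
  have ST0 : 0 <= S + T by rewrite addr_ge0// ltW.
  apply: le_trans (_ : (\int[lam]_t (S `^ beta * (\1_`[0%R, T] t * edge_weight beta c t))%:E <= _)%E).
    apply: ge0_le_integral => //.
    - by move=> t _; rewrite lee_fin mulr_ge0// mulr_ge0 ?log_weight_ge0.
    - apply/measurable_EFinP; apply: measurable_funM.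
        by apply: measurable_indic; exact: measurable_itv.
      exact: (measurableT_comp mw (measurableT_comp (measurable_rV_subZ e) (measurable_pair1 y))).
    - apply/measurable_EFinP; apply: measurable_funM => //; apply: measurable_funM.
        by apply: measurable_indic; exact: measurable_itv.
      exact: measurable_edge_weight.
    move=> t _; rewrite lee_fin [leRHS]mulrCA [\1_`[0, T] t]indicE.
    have [tT|_] := boolP (t \in `[0, T]%classic); last by rewrite !mul0r.
    rewrite !mul1r.
    rewrite indicE; have [|_] := boolP (_ \in Omega `&` W); last first.
      by rewrite mul0r mulr_ge0 ?powR_ge0 ?edge_weight_ge0.
    rewrite inE mul1r => -[Oy Wy]; apply: hc => //.
    by move: tT; rewrite inE /= in_itv.
  rewrite ge0_integralZ_real ?powR_ge0//; last 2 first.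
  - apply: measurable_funM; last exact: measurable_edge_weight.
    by apply: measurable_indic; exact: measurable_itv.
  - by move=> t; rewrite mulr_ge0 ?edge_weight_ge0.
  rewrite /M EFinM lee_wpmul2l ?lee_fin ?powR_ge0//.
  exact: integral_edge_weight.
rewrite lee_fin; move: c10 c20; set c1 := 2 * M / T; set c2 := _ * (_ * _) => c10 c20.
have := mulr_ge0 c10 Q0; have := mulr_ge0 c20 (sqr_ge0 (L2_norm Omega f)).
by rewrite mulrDr !mulrDl; lra.
Qed.

(** On the ball of radius d/2 the distance to the boundary stays between d/2 and 3d/2, so the weight
    is bounded and the L2 norm alone suffices. *)
Lemma hardy_interior x : Omega x -> exists2 W, hardy_on W & W x.
Proof.
move=> Ox; have d0 : 0 < dist x by exact: dist_gt0.
set d := dist x in d0.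
pose W := [set y | enorm (x - y) < d / 2].
exists W; last first.
  rewrite /W /= subrr /enorm big1 ?sqrtr0 ?divr_gt0// => i _.
  by rewrite mxE expr0n.
have oW : open W by exact: open_enorm_ball.
split => //.
have /andP[b0 b1] := beta01.
pose L := `|ln (d / 2)| + `|ln (2 * d)|.
have L0 : 0 <= L by rewrite addr_ge0.
exists (L `^ (alpha * beta)); first exact: powR_ge0.
move=> f fW; rewrite integral_OmegaI.
have Q0 : 0 <= dirichlet_form Omega f by exact: dirichlet_form_ge0.
have mF : measurable_fun setT (f \_ Omega) by exact: W12_measurable.
apply: (@le_trans _ _ (\int[mu]_x (L `^ (alpha * beta) * (f \_ Omega) x ^+ 2)%:E)%E).
  apply: ge0_le_integral => //.
  - by move=> y _; rewrite lee_fin mulr_ge0 ?sqr_ge0// mulr_ge0 ?log_weight_ge0.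
  - apply/measurable_EFinP; apply: measurable_funM; last exact: measurable_funX.
    exact: measurable_local_weight.
  - by apply/measurable_EFinP; apply: measurable_funM => //; exact: measurable_funX.
  move=> y _; rewrite lee_fin ler_wpM2r ?sqr_ge0// indicE.
  have [|_] := boolP (y \in _); last by rewrite mul0r powR_ge0.
  rewrite inE mul1r => -[Oy Wy].
  have ab0 : 0 <= alpha * beta by rewrite mulr_ge0 ?ltW.
  rewrite /log_weight; apply: ge0_ler_powR; rewrite ?nnegrE//.
  have h1 := dist_Lipschitz O0 oO bO x y; have h2 := dist_Lipschitz O0 oO bO y x.
  rewrite -/d in h1 h2; rewrite (enormB y) in h2.
  move: Wy; rewrite /W /= => Wy.
  have l1 : ln (d / 2) <= ln (dist y).
    by rewrite ler_ln ?posrE ?divr_gt0//; lra.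
  have l2 : ln (dist y) <= ln (2 * d).
    by rewrite ler_ln ?posrE ?mulr_gt0//; lra.
  have n1 := ler_norm (- ln (d / 2)); rewrite normrN in n1.
  have n2 := ler_norm (ln (2 * d)).
  have n3 := normr_ge0 (ln (d / 2)); have n4 := normr_ge0 (ln (2 * d)).
  by rewrite /L ler_norml; apply/andP; split; lra.
rewrite ge0_integralZ_real ?powR_ge0//; last 2 first.
- exact: measurable_funX.
- by move=> y; exact: sqr_ge0.
rewrite (W12_L2_norm fW) -EFinM lee_fin ler_wpM2l ?powR_ge0//.
by rewrite lerDr.
Qed.

Lemma hardy_set0 : hardy_on set0.
Proof.
split; first exact: open0.
exists 0 => // f fW; rewrite setI0 integral_set0 mul0r.
by [].
Qed.

Lemma hardy_setU W1 W2 : hardy_on W1 -> hardy_on W2 -> hardy_on (W1 `|` W2).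
Proof.
move=> [ ow1 [C1 C10 h1]] [ ow2 [C2 C20 h2]]; split; first exact: openU.
exists (C1 + C2); first exact: addr_ge0.
move=> f fW; rewrite mulrDl EFinD; apply: le_trans (leeD (h1 f fW) (h2 f fW)).
rewrite !integral_OmegaI.
have mF2 : measurable_fun setT (fun x => (f \_ Omega) x ^+ 2).
  by apply: measurable_funX; exact: W12_measurable.
have w0 W x : 0 <= \1_(Omega `&` W) x * log_weight x * (f \_ Omega) x ^+ 2.
  by rewrite mulr_ge0 ?sqr_ge0// mulr_ge0 ?log_weight_ge0.
have mw W : open W -> measurable_fun setT
    (fun x => \1_(Omega `&` W) x * log_weight x * (f \_ Omega) x ^+ 2).
  by move=> oW; apply: measurable_funM => //; exact: measurable_local_weight.
rewrite -ge0_integralD//; last 4 first.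
- by move=> x _; rewrite lee_fin.
- by apply/measurable_EFinP; exact: mw.
- by move=> x _; rewrite lee_fin.
- by apply/measurable_EFinP; exact: mw.
apply: ge0_le_integral => //.
- by move=> x _; rewrite lee_fin.
- by apply/measurable_EFinP; apply: mw; exact: openU.
- by apply: emeasurable_funD; apply/measurable_EFinP; exact: mw.
move=> x _; rewrite -EFinD lee_fin -!mulrDl ler_wpM2r ?sqr_ge0// ler_wpM2r ?log_weight_ge0//.
rewrite !indicE -natrD ler_nat setIUr in_setU.
by case: (_ \in _); case: (_ \in _).
Qed.

Lemma hardy_everywhere :
  (forall a, boundary Omega a -> log_regular alpha Omega a) ->
  exists2 C : R, 0 <= C & forall f, W12 Omega f ->
    (\int[mu]_(x in Omega) (log_weight x * `|f x| ^+ 2)%:E <=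
     (C * (dirichlet_form Omega f + L2_norm Omega f ^+ 2))%:E)%E.
Proof.
move=> reg.
(* [choice] wants a set for every x, so points outside the closure receive the empty set and the
   claim is guarded by an implication. *)
have loc x : exists W, closure Omega x -> hardy_on W /\ W x.
  have [cx|ncx] := pselect (closure Omega x); last by exists set0.
  have [Ox|Ox] := pselect (Omega x).
    by have [W hW Wx] := hardy_interior Ox; exists W.
  have bx : boundary Omega x by split => //; rewrite (interior_id _).1.
  by have [W hW Wx] := hardy_boundary bx (reg _ bx); exists W.
have [W hW] := choice loc.
have := compact_closure bO; rewrite compact_cover => /(_ _ (closure Omega) W).
case.
- by move=> x /hW[[]].
- by move=> x cx; exists x => //; case: (hW x cx).
move=> D DO cov.
have : hardy_on (\big[setU/set0]_(x <- finmap.enum_fset D) W x).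
  rewrite big_seq; elim/big_ind : _ => [|W1 W2|x xD].
  - exact: hardy_set0.
  - exact: hardy_setU.
  - by have := DO x xD; rewrite inE => /hW[].
move=> [_ [C C0 hC]]; exists C => // f fW.
have := hC f fW; rewrite setIidl// => x Ox.
have [y yD Wy] := cov x (subset_closure Ox).
by rewrite -bigcup_seq; exists y.
Qed.

End boundary_estimate.

(** * Log-Sobolev inequality *)

Section scale_estimate.
Variables (R : realType) (n : nat) (Omega : set 'rV[R]_n.+1).
Local Notation mu := (lebesgue_rV R n.+1).
Local Notation lam := (@lebesgue_measure R).
Local Notation dist := (dist_boundary Omega).
Hypotheses (O0 : Omega !=set0) (oO : open Omega) (bO : bounded_set Omega).

Lemma lebesgue_rV_cube (t : R) : 0 < t ->
  mu (box 0 (const_mx t)) = (t ^+ n.+1)%:E.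
Proof.
move=> t0; rewrite lebesgue_rV_boxE.
rewrite (eq_bigr (fun=> t%:E)) => [|i _]; last first.
  by rewrite !mxE lebesgue_measure_itv/= lte_fin t0 -EFinB subr0.
by rewrite prodEFin prodr_const card_ord.
Qed.

(** With s = sqrt N t and N = n + 1, all displacements with |v_i| <= t keep a point of this set
    inside [Omega]. *)
Definition deep (s : R) : set 'rV[R]_n.+1 := Omega `&` [set x | s < dist x].

Lemma open_deep s : open (deep s).
Proof.
apply: openI => //.
have -> : [set x | s < dist x] = dist @^-1` [set y | s < y] by [].
by apply: open_comp => [x _|]; [exact: continuous_dist|exact: open_gt].
Qed.

(** The weighted estimate with unit length, direction [v] and an indicator as weight, whose line
    integrals over [0, 1] are at most 1. *)
Lemma translation_estimate f (t : R) (v : 'rV[R]_n.+1) : W12 Omega f -> 0 < t ->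
  (forall i, `|v ord0 i| <= t) ->
  (\int[mu]_x (\1_(deep (Num.sqrt n.+1%:R * t)) x *
     ((f \_ Omega) (x + v) - (f \_ Omega) x) ^+ 2)%:E <=
   (n.+1%:R * t ^+ 2 * dirichlet_form Omega f)%:E)%E.
Proof.
move=> fW t0 vt; set D := deep _.
have oD : open D by exact: open_deep.
have mD : measurable_fun setT (\1_D : 'rV[R]_n.+1 -> R).
  by apply: measurable_indic; exact: open_measurable_rV.
have := @W12_weighted_translation _ _ Omega oO bO f fW 1 1 t v D (\1_D) ltr01 ler01 oD _ mD.
rewrite scale1r !mul1r; apply => //.
- move=> x u [Ox Dx] /andP[u0 u1]; apply: contrapT => Oxu.
  have := dist_notin O0 oO bO Ox Oxu; rewrite opprD addNKr enormN enormZ ger0_norm//.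
  apply/negP; rewrite -ltNge; apply: le_lt_trans Dx.
  have h := enorm_le (ltW t0) vt; apply: le_trans h.
  by rewrite ler_piMl ?enorm_ge0.
- by move=> x; rewrite indicE; case: (boolP (x \in D)); rewrite ?eqxx// inE.
- move=> y; apply: (@le_trans _ _ (\int[lam]_u (\1_`[0%R, 1%R] u)%:E)%E).
    apply: ge0_le_integral => //.
    + apply/measurable_EFinP; apply: measurable_funM.
        by apply: measurable_indic; exact: measurable_itv.
      exact: (measurableT_comp mD (measurableT_comp (measurable_rV_subZ v) (measurable_pair1 y))).
    + by apply/measurable_EFinP; apply: measurable_indic; exact: measurable_itv.
    + by move=> u _; rewrite lee_fin ler_piMr// indicE; case: (_ \in D).
  have L : lam `[0, 1]%classic = 1%:E :> \bar R.
    by rewrite lebesgue_measure_itv/= lte_fin ltr01 -EFinB subr0.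
  by rewrite integral_indic// setIT; move: L => /= ->.
Qed.

(** The threshold makes the mean of F^2 over a cube of side t, which is at most t^(-N) times the
    squared norm, no larger than F(x)^2 / 4, so that it can be absorbed. *)
Definition scale_set (f : 'rV[R]_n.+1 -> R) (t : R) : set 'rV[R]_n.+1 :=
  [set x | deep (Num.sqrt n.+1%:R * t) x /\
    4 * L2_norm Omega f ^+ 2 <= t ^+ n.+1 * (f \_ Omega) x ^+ 2].

Lemma measurable_scale_set f t : W12 Omega f -> measurable (scale_set f t).
Proof.
move=> fW; rewrite [scale_set f t](_ : _ = deep (Num.sqrt n.+1%:R * t) `&`
  [set x | 4 * L2_norm Omega f ^+ 2 <= t ^+ n.+1 * (f \_ Omega) x ^+ 2])//.
apply: measurableI; first by apply: open_measurable_rV; exact: open_deep.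
rewrite -[X in measurable X]setTI.
have -> : [set x | 4 * L2_norm Omega f ^+ 2 <= t ^+ n.+1 * (f \_ Omega) x ^+ 2] =
    (fun x => t ^+ n.+1 * (f \_ Omega) x ^+ 2) @^-1`
      `[4 * L2_norm Omega f ^+ 2, +oo[%classic.
  by apply/seteqP; split => x /=; rewrite in_itv/= andbT.
have mh : measurable_fun setT (fun x => t ^+ n.+1 * (f \_ Omega) x ^+ 2).
  by apply: measurable_funM => //; apply: measurable_funX; exact: W12_measurable.
exact: mh.
Qed.

Lemma scale_estimate f (t : R) : W12 Omega f -> 0 < t ->
  (\int[mu]_x (\1_(scale_set f t) x * (f \_ Omega) x ^+ 2)%:E <=
   (4 * n.+1%:R * t ^+ 2 * dirichlet_form Omega f)%:E)%E.
Proof.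
move=> fW t0; have mA := measurable_scale_set t fW; move: mA.
set A := scale_set f t => mA; set F := f \_ Omega.
pose m := L2_norm Omega f ^+ 2.
set Q := dirichlet_form Omega f; pose D := deep (Num.sqrt n.+1%:R * t).
have Q0 : 0 <= Q by exact: dirichlet_form_ge0.
have mF : measurable_fun setT F by exact: W12_measurable.
have mF2 : measurable_fun setT (fun x => F x ^+ 2) by exact: measurable_funX.
have tn0 : 0 < t ^+ n.+1 by rewrite exprn_gt0.
have mD : measurable D by apply: open_measurable_rV; exact: open_deep.
pose cb : set 'rV[R]_n.+1 := box 0 (const_mx t).
have mcb : measurable cb by exact: measurable_box.
have icb : (\int[mu]_v (\1_cb v)%:E = (t ^+ n.+1)%:E)%E.
  by rewrite integral_indic// setIT; exact: lebesgue_rV_cube.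
have mIcb : measurable_fun setT (\1_cb : 'rV[R]_n.+1 -> R) by exact: measurable_indic.
have mID : measurable_fun setT (\1_D : 'rV[R]_n.+1 -> R) by exact: measurable_indic.
have mIA : measurable_fun setT (\1_A : 'rV[R]_n.+1 -> R) by exact: measurable_indic.
pose X (p : 'rV[R]_n.+1 * 'rV[R]_n.+1) : R := \1_cb p.2 * (F (p.1 + p.2) - F p.1) ^+ 2.
have X0 p : 0 <= X p by rewrite mulr_ge0// sqr_ge0.
have mX : measurable_fun setT X.
  apply: measurable_funM; first exact: (measurableT_comp mIcb measurable_snd).
  apply: measurable_funX; apply: measurable_funB.
    have := measurableT_comp mF (@measurable_rV_add R n.+1). by [].
  exact: (measurableT_comp mF measurable_fst).
pose DX (p : 'rV[R]_n.+1 * 'rV[R]_n.+1) : R := \1_D p.1 * X p.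
have DX0 p : 0 <= DX p by rewrite mulr_ge0.
have mDX : measurable_fun setT DX.
  by apply: measurable_funM => //; exact: (measurableT_comp mID measurable_fst).
have mshift (x : 'rV[R]_n.+1) : measurable_fun setT (fun v : 'rV[R]_n.+1 => F (x + v)).
  by under eq_fun do rewrite addrC; exact: (measurableT_comp mF (measurable_rV_shift x)).
(* Average F(x)^2 <= 2 (F(x + v) - F(x))^2 + 2 F(x + v)^2 over the cube; the last term yields at
   most 2 m <= t^N F(x)^2 / 2, absorbed on the left. *)
have point x : A x ->
    ((t ^+ n.+1 * F x ^+ 2)%:E <= 4%:E * \int[mu]_v (DX (x, v))%:E)%E.
  move=> [Dx Fx]; rewrite -/F -/m in Fx.
  have -> : (\int[mu]_v (DX (x, v))%:E = \int[mu]_v (X (x, v))%:E)%E.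
    by apply: eq_integral => v _; rewrite /DX /= indicE mem_set// mul1r.
  have i0 : (0 <= \int[mu]_v (X (x, v))%:E)%E.
    by apply: integral_ge0 => v _; rewrite lee_fin.
  have : ((t ^+ n.+1 * F x ^+ 2)%:E <= 2%:E * \int[mu]_v (X (x, v))%:E + 2%:E * m%:E)%E.
    have -> : (t ^+ n.+1 * F x ^+ 2)%:E = (\int[mu]_v (F x ^+ 2 * \1_cb v)%:E)%E.
      rewrite ge0_integralZ_real ?sqr_ge0// icb.
      by rewrite mulrC EFinM.
    have -> : m%:E = (\int[mu]_v (F (x + v) ^+ 2)%:E)%E.
      rewrite -(W12_L2_norm fW).
      rewrite -(@ge0_integral_shift _ _ x (fun v => (F v ^+ 2)%:E)).
      - by apply: eq_integral => v _; rewrite addrC.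
      - exact/measurable_EFinP.
      - by move=> v; rewrite lee_fin sqr_ge0.
    have mXx : measurable_fun setT (fun v => X (x, v)).
      exact: (measurableT_comp mX (measurable_pair1 x)).
    rewrite -!ge0_integralZ_real//; last 2 first.
    - exact: measurable_funX.
    - by move=> v; exact: sqr_ge0.
    rewrite -ge0_integralD//; last 4 first.
    - by move=> v _; rewrite lee_fin mulr_ge0.
    - by apply/measurable_EFinP; exact: measurable_funM.
    - by move=> v _; rewrite lee_fin mulr_ge0// sqr_ge0.
    - by apply/measurable_EFinP; apply: measurable_funM => //; exact: measurable_funX.
    apply: ge0_le_integral => //.
    - by move=> v _; rewrite lee_fin mulr_ge0// sqr_ge0.
    - by apply/measurable_EFinP; exact: measurable_funM.
    - apply/measurable_EFinP; apply: measurable_funD; first exact: measurable_funM.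
      by apply: measurable_funM => //; exact: measurable_funX.
    move=> v _; rewrite -EFinD lee_fin /X /= indicE; set a := F x; set b := F (x + v).
    have [_|_] := boolP (v \in cb).
      by rewrite mulr1 mul1r; have := sqr_ge0 (2 * b - a); rewrite !expr2; lra.
    by rewrite mulr0 mul0r mulr0 add0r mulr_ge0// sqr_ge0.
  move: i0; case: (\int[mu]_v _)%E => [r| |] //=.
  - by rewrite -!EFinM -EFinD !lee_fin => _; move: Fx; lra.
  - by move=> _ _; rewrite gt0_muley ?lte_fin// leey.
have : ((t ^+ n.+1)%:E * \int[mu]_x (\1_A x * F x ^+ 2)%:E <=
    4%:E * ((t ^+ n.+1) * (n.+1%:R * t ^+ 2 * Q))%:E)%E.
  rewrite -ge0_integralZ_real//; last 3 first.
  - exact: ltW.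
  - exact: measurable_funM.
  - by move=> x; rewrite mulr_ge0// sqr_ge0.
  apply: (@le_trans _ _ (\int[mu]_x (4%:E * \int[mu]_v (DX (x, v))%:E))%E).
    have mDXi : measurable_fun setT (fun x => \int[mu]_v (DX (x, v))%:E)%E.
      apply: (@measurable_fun_fubini_tonelli_F _ _ _ _ _ mu (fun p => (DX p)%:E)) => //.
      exact/measurable_EFinP.
    apply: ge0_le_integral => //.
    - by move=> x _; rewrite lee_fin mulr_ge0 ?(ltW tn0)// mulr_ge0// sqr_ge0.
    - by apply/measurable_EFinP; apply: measurable_funM => //; exact: measurable_funM.
    - exact: emeasurable_funM.
    move=> x _; rewrite [\1_A x]indicE; have [|_] := boolP (x \in A).
      by rewrite inE mul1r => /point.
    rewrite mul0r mulr0 mule_ge0//; apply: integral_ge0 => v _.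
    by rewrite lee_fin.
  rewrite ge0_integralZl//; last 2 first.
  - apply: (@measurable_fun_fubini_tonelli_F _ _ _ _ _ mu (fun p => (DX p)%:E)) => //.
    exact/measurable_EFinP.
  - by move=> x _; apply: integral_ge0 => v _; rewrite lee_fin.
  rewrite lee_wpmul2l//.
  rewrite (@fubini_tonelli _ _ _ _ _ mu mu (fun p => (DX p)%:E))//; last exact/measurable_EFinP.
  apply: (@le_trans _ _ (\int[mu]_v ((n.+1%:R * t ^+ 2 * Q) * \1_cb v)%:E)%E).
    apply: ge0_le_integral => //.
    - by move=> v _; apply: integral_ge0 => x _; rewrite lee_fin.
    - apply: (@measurable_fun_fubini_tonelli_G _ _ _ _ _ mu (fun p => (DX p)%:E)) => //.
      exact/measurable_EFinP.
    - by apply/measurable_EFinP; exact: measurable_funM.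
    move=> v _; rewrite /DX /X /= indicE; have [|_] := boolP (v \in cb); last first.
      rewrite mulr0 integral0_eq// => x _; by rewrite mul0r mulr0.
    rewrite inE mulr1 => vt; under eq_integral do rewrite mul1r.
    apply: translation_estimate => // i; have := vt i; rewrite !mxE => /andP[v0 v1].
    by rewrite ger0_norm ltW.
  rewrite ge0_integralZ_real//; last first.
    by rewrite mulr_ge0// mulr_ge0// sqr_ge0.
  by rewrite icb -EFinM mulrC.
have : (0 <= \int[mu]_x (\1_A x * F x ^+ 2)%:E)%E.
  by apply: integral_ge0 => x _; rewrite lee_fin mulr_ge0// sqr_ge0.
case: (\int[mu]_x _)%E => [r| |] //=; last by rewrite gt0_muley ?lte_fin.
rewrite -!EFinM !lee_fin => _ h; rewrite -(ler_pM2l tn0).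
by apply: le_trans h _; rewrite le_eqVlt; apply/orP; left; apply/eqP; ring.
Qed.

End scale_estimate.

(** * Counting levels *)

Section counting.
Variable R : realType.

(** For y >= a, take J = floor((y - a)/b) + 1: all J levels lie below y, and J exceeds the
    quotient. *)
Lemma count_levels (a b y : R) : 0 < b ->
  exists J, y <= a + b * \sum_(i < J) ((a + b * i%:R <= y)%R)%:R.
Proof.
move=> b0; have [ay|ya] := leP a y; last first.
  by exists 0%N; rewrite big_ord0 mulr0 addr0 ltW.
pose z := (y - a) / b.
have z0 : 0 <= z by rewrite divr_ge0 ?subr_ge0 ?(ltW b0).
have yE : y = a + b * z by rewrite /z mulrC divfK ?gt_eqF// addrC subrK.
have /andP[h1 h2] := truncn_itv z0.
exists (Num.truncn z).+1; rewrite {1}yE lerD2l ler_pM2l//.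
rewrite (eq_bigr (fun=> 1)) => [|i _]; last first.
  rewrite yE lerD2l ler_pM2l// (le_trans _ h1)// ler_nat.
  by rewrite -ltnS.
by rewrite sumr_const card_ord ltW.
Qed.

Lemma count_le (L : R) J : 0 <= L -> \sum_(i < J) ((i.+1%:R <= L)%R)%:R <= L.
Proof.
(* The bound by J is carried along: when the last level counts, J + 1 <= L gives the bound by L. *)
move=> L0; suff : \sum_(i < J) ((i.+1%:R <= L)%R)%:R <= Num.min L J%:R :> R.
  by rewrite le_min => /andP[].
elim: J => [|J IH]; first by rewrite big_ord0 le_min L0 lexx.
rewrite big_ord_recr/=; move: IH; rewrite !le_min => /andP[h1 h2].
have [JL|_] := boolP (J.+1%:R <= L); last first.
  by rewrite addr0 h1/= (le_trans h2)// ler_nat.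
have h3 : \sum_(i < J) ((i.+1%:R <= L)%R)%:R + 1 <= J.+1%:R :> R.
  by rewrite -[J.+1]addn1 natrD lerD2r.
by rewrite h3 (le_trans h3).
Qed.

(** The count vanishes unless k0 <= L, and then it is at most L = L^(1-p) L^p <= k0^(1-p) L^p
    because p > 1. *)
Lemma tail_count (L p : R) (k0 J : nat) : (0 < k0)%N -> 1 < p -> 0 < L ->
  \sum_(i < J) (((k0 + i)%:R <= L)%R)%:R <= k0%:R `^ (1 - p) * L `^ p.
Proof.
move=> k00 p1 L0; have k0R : 0 < k0%:R :> R by rewrite ltr0n.
have [kL|Lk] := leP k0%:R L; last first.
  rewrite big1 ?mulr_ge0 ?powR_ge0// => i _.
  by rewrite leNgt (lt_le_trans Lk)// ler_nat leq_addr.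
apply: (@le_trans _ _ L).
  apply: le_trans (count_le J (ltW L0)); apply: ler_sum => i _.
  have [h|//] := boolP ((k0 + i)%:R <= L); rewrite ler_nat lt0b.
  by apply: le_trans h; rewrite ler_nat -[i.+1]add1n leq_add2r.
have LE : L `^ (1 - p) * L `^ p = L.
  by rewrite -powRD ?subrK ?powRr1 ?(ltW L0)//; apply/implyP => _; rewrite gt_eqF.
rewrite -[leLHS]LE.
rewrite ler_wpM2r ?powR_ge0// -[1 - p]opprB !powRN lef_pV2 ?posrE ?powR_gt0//.
by apply: ge0_ler_powR; rewrite ?nnegrE ?subr_ge0 ?(ltW p1) ?(ltW L0) ?(ltW k0R).
Qed.

Lemma geometric4 J : \sum_(i < J) (4^-1 ^+ i : R) <= 2.
Proof.
suff : \sum_(i < J) (4^-1 ^+ i : R) <= 2 - 2 * 4^-1 ^+ J.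
  by move=> /le_trans; apply; rewrite gerBl mulr_ge0// exprn_ge0// invr_ge0.
elim: J => [|J IH]; first by rewrite big_ord0 expr0 mulr1 subrr.
rewrite big_ord_recr/= exprS; have : 0 <= (4^-1 : R) ^+ J by rewrite exprn_ge0// invr_ge0.
by move: IH; lra.
Qed.

(** For y > 0, ln y >= 1 - 1/y gives y^2 ln y >= y^2 - y >= -1/4; for other y the convention ln y =
    0 applies. It makes the negative part of f^2 ln f integrable on a bounded domain. *)
Lemma sqr_ln_ge (y : R) : - 1 <= y ^+ 2 * ln y.
Proof.
have [y0|y0] := leP y 0; first by rewrite ln0// mulr0 lerN10.
have : 1 - y^-1 <= ln y.
  have h : -1 < y^-1 - 1 by rewrite ltrBrDl subrr invr_gt0.
  have := le_ln1Dx h; rewrite [1 + _]addrC subrK lnV ?posrE//.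
  by lra.
move=> /(ler_wpM2l (sqr_ge0 y)); apply: le_trans.
rewrite mulrBr mulr1 expr2 mulfK ?gt_eqF//.
by have := sqr_ge0 (y - 2^-1); rewrite !expr2; lra.
Qed.

End counting.

(** * Summation over the layers *)

Section layers.
Variables (R : realType) (n : nat) (Omega : set 'rV[R]_n.+1).
Local Notation mu := (lebesgue_rV R n.+1).
Local Notation dist := (dist_boundary Omega).
Hypotheses (O0 : Omega !=set0) (oO : open Omega) (bO : bounded_set Omega).
Variables (f : 'rV[R]_n.+1 -> R) (p H : R) (k0 : nat).
Hypotheses (fW : W12 Omega f) (p1 : 1 < p) (k00 : (0 < k0)%N).
Hypothesis hardy_f :
  (\int[mu]_x (\1_Omega x * `|ln (dist x)| `^ p * (f \_ Omega) x ^+ 2)%:E <= H%:E)%E.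
Local Notation F := (f \_ Omega).
Local Notation m := (L2_norm Omega f ^+ 2).
Local Notation Q := (dirichlet_form Omega f).
Hypothesis m0 : 0 < m.

(* The cube of side [scale k] has diameter [2^-k]. *)
Definition scale (k : nat) : R := 2^-1 ^+ k / Num.sqrt n.+1%:R.

Let N0 : 0 < Num.sqrt n.+1%:R :> R. Proof. by rewrite sqrtr_gt0. Qed.

Lemma scale_gt0 k : 0 < scale k.
Proof. by rewrite divr_gt0// exprn_gt0// invr_gt0. Qed.

Lemma sqrt_scale k : Num.sqrt n.+1%:R * scale k = 2^-1 ^+ k.
Proof. by rewrite /scale mulrC divfK// gt_eqF. Qed.

(** [level0 + level_step * k] is ln (4 / (scale k)^N) with N = n + 1, the logarithm of the threshold
    that F^2 / m must reach on level k. *)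
Definition level0 : R := ln 4 + n.+1%:R * ln (Num.sqrt n.+1%:R).
Definition level_step : R := n.+1%:R * ln 2.

Lemma ln2_gt0 : 0 < ln 2 :> R. Proof. by rewrite ln_gt0// ltr1n. Qed.

Lemma level_step_gt0 : 0 < level_step.
Proof. by rewrite mulr_gt0// ln2_gt0. Qed.

Definition level (k : nat) : set 'rV[R]_n.+1 :=
  [set x | 4 * m <= scale k ^+ n.+1 * F x ^+ 2].

Lemma levelE k x : F x != 0 ->
  (x \in level k) = (level0 + level_step * k%:R <= ln (F x ^+ 2 / m)).
Proof.
move=> Fx; have F2 : 0 < F x ^+ 2 by rewrite exprn_even_gt0.
have sk := scale_gt0 k.
have -> : (x \in level k) = (4 * m <= scale k ^+ n.+1 * F x ^+ 2).
  by apply/idP/idP; rewrite inE.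
pose Y := F x ^+ 2 / m; have Y0 : 0 < Y by exact: divr_gt0.
rewrite -ler_pdivlMr// -mulrA -/Y; have sn0 : 0 < scale k ^+ n.+1 by exact: exprn_gt0.
have -> : (4 <= scale k ^+ n.+1 * Y) = (ln 4 <= ln (scale k ^+ n.+1 * Y)).
  by rewrite ler_ln ?posrE// mulr_gt0.
have -> : ln (scale k ^+ n.+1 * Y) =
    n.+1%:R * (- ln 2 * k%:R - ln (Num.sqrt n.+1%:R)) + ln Y.
  rewrite lnM ?posrE// lnXn// /scale ln_div ?posrE ?exprn_gt0 ?invr_gt0//.
  by rewrite lnXn ?invr_gt0// lnV ?posrE// !mulr_natr mulr_natl.
rewrite /level0 /level_step.
set l2 := ln 2; set l4 := ln 4; set s := ln (Num.sqrt _); set y := ln Y.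
by apply/idP/idP; lra.
Qed.

Definition xlnx x : R := F x ^+ 2 * ln `|F x|.
Definition ln_shift : R := level0 + level_step * k0%:R + ln m.

(** ln |F| is half of ln (F^2 / m) + ln m, and ln (F^2 / m) is at most the threshold of level k0
    plus [level_step] for each level from k0 on that contains x. *)
Lemma xlnx_le x : exists J,
  xlnx x <= 2^-1 * ln_shift * F x ^+ 2 +
    2^-1 * level_step * \sum_(i < J) (\1_(level (k0 + i)) x * F x ^+ 2).
Proof.
have [Fx|Fx] := eqVneq (F x) 0.
  by exists 0%N; rewrite /xlnx Fx expr0n/= !mul0r big_ord0 !mulr0 addr0.
have [J hJ] := count_levels (level0 + level_step * k0%:R) (ln (F x ^+ 2 / m)) level_step_gt0.
exists J; rewrite -mulr_suml.
have E : \sum_(i < J) \1_(level (k0 + i)) x = \sum_(i < J)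
    ((level0 + level_step * k0%:R + level_step * i%:R <= ln (F x ^+ 2 / m))%R)%:R :> R.
  apply: eq_bigr => i _; rewrite indicE levelE// natrD mulrDr addrA.
  by [].
rewrite E; move: hJ; set s := \sum_(i < J) _ => hJ.
have F2 : 0 < F x ^+ 2 by rewrite exprn_even_gt0.
have lnF : ln `|F x| = 2^-1 * (ln (F x ^+ 2 / m) + ln m).
  rewrite ln_div ?posrE// subrK -[F x ^+ 2]real_normK ?num_real// lnXn ?normr_gt0//.
  by rewrite -mulr_natr; lra.
rewrite /xlnx lnF mulrCA [leRHS](_ : _ = F x ^+ 2 * (2^-1 * (ln_shift + level_step * s))); last by ring.
by rewrite mulrCA ler_pM2l// ler_pM2l// /ln_shift; lra.
Qed.

(** The number of levels needed in [xlnx_le] depends on x; the full series of nonnegative terms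
    gives one bound for all x. *)
Definition excess x : \bar R :=
  ((2^-1 * level_step)%:E * \sum_(0 <= i <oo) (\1_(level (k0 + i)) x * F x ^+ 2)%:E)%E.

Let mF : measurable_fun setT F. Proof. exact: W12_measurable. Qed.
Let mF2 : measurable_fun setT (fun x => F x ^+ 2). Proof. exact: measurable_funX. Qed.

Lemma measurable_level k : measurable (level k).
Proof.
rewrite -[X in measurable X]setTI.
have -> : level k = (fun x => scale k ^+ n.+1 * F x ^+ 2) @^-1` `[4 * m, +oo[%classic.
  by apply/seteqP; split => x /=; rewrite in_itv/= andbT.
have mh : measurable_fun setT (fun x => scale k ^+ n.+1 * F x ^+ 2).
  exact: measurable_funM.
exact: mh.
Qed.

Lemma level_term_ge0 k x : 0 <= \1_(level k) x * F x ^+ 2.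
Proof. by rewrite mulr_ge0// sqr_ge0. Qed.

Lemma measurable_level_term k : measurable_fun setT (fun x => \1_(level k) x * F x ^+ 2).
Proof. by apply: measurable_funM => //; apply: measurable_indic; exact: measurable_level. Qed.

Lemma xlnx_le_excess x :
  ((xlnx x)%:E <= (2^-1 * ln_shift * F x ^+ 2)%:E + excess x)%E.
Proof.
have [J hJ] := xlnx_le x.
apply: (@le_trans _ _ ((2^-1 * ln_shift * F x ^+ 2 +
    2^-1 * level_step * \sum_(i < J) (\1_(level (k0 + i)) x * F x ^+ 2))%:E)).
  by rewrite lee_fin.
rewrite EFinD leeD2l// EFinM lee_wpmul2l//.
  by rewrite lee_fin mulr_ge0// ltW// level_step_gt0.
rewrite -sumEFin -(big_mkord xpredT (fun i => (\1_(level (k0 + i)) x * F x ^+ 2)%:E)).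
apply: nneseries_lim_ge => i _ _; rewrite lee_fin; exact: level_term_ge0.
Qed.

Definition shallow (k : nat) : set 'rV[R]_n.+1 :=
  Omega `&` [set x | dist x <= 2^-1 ^+ k].

Lemma measurable_shallow k : measurable (shallow k).
Proof.
apply: measurableI; first exact: open_measurable_rV.
rewrite -[X in measurable X]setTI.
have -> : [set x | dist x <= 2^-1 ^+ k] = dist @^-1` `]-oo, 2^-1 ^+ k]%classic.
  by apply/seteqP; split => x /=; rewrite in_itv.
by apply: (measurable_dist O0 oO bO) => //; exact: measurable_itv.
Qed.

(** A point of the level at depth more than 2^-k meets both conditions of [scale_set], since sqrt N
    times [scale k] is 2^-k; the other points of [Omega] are shallow. *)
Lemma level_split k x : \1_(level k) x * F x ^+ 2 <=
  \1_(scale_set Omega f (scale k)) x * F x ^+ 2 + \1_(shallow k) x * F x ^+ 2.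
Proof.
have [Ox|Ox] := pselect (Omega x); last first.
  by rewrite /patch memNset// expr0n/= !mulr0 addr0.
rewrite -mulrDl ler_wpM2r ?sqr_ge0// indicE.
have [|_] := boolP (x \in level k); last by rewrite addr_ge0.
rewrite inE => Lx; have [dx|dx] := leP (dist x) (2^-1 ^+ k).
  by rewrite [\1_(shallow k) x]indicE mem_set// lerDr.
rewrite [\1_(scale_set _ _ _) x]indicE mem_set ?lerDl//; split => //; split => //.
by rewrite sqrt_scale.
Qed.

(** d <= 2^-k implies k <= |ln d| / ln 2, so the sum counts only integers k0 + i up to that
    number. *)
Lemma shallow_count J x : \sum_(i < J) (\1_(shallow (k0 + i)) x * F x ^+ 2) <=
  (k0%:R `^ (1 - p) * ln 2 `^ (- p)) *
  (\1_Omega x * `|ln (dist x)| `^ p * F x ^+ 2).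
Proof.
rewrite -mulr_suml [leRHS]mulrA ler_wpM2r ?sqr_ge0//.
have [Ox|Ox] := pselect (Omega x); last first.
  rewrite big1 ?mulr_ge0 ?powR_ge0// => i _.
  by rewrite indicE memNset// => -[].
rewrite [\1_Omega x]indicE mem_set// mul1r.
have d0 : 0 < dist x by exact: dist_gt0.
have l2 := ln2_gt0.
pose L := `|ln (dist x)| / ln 2.
have key i : x \in shallow (k0 + i) -> (k0 + i)%:R <= L.
  rewrite inE => -[_ /= dx]; rewrite /L ler_pdivlMr//.
  move: dx; rewrite -ler_ln ?posrE ?exprn_gt0// lnXn// lnV ?posrE// => dx.
  have := ler_norm (- ln (dist x)); rewrite normrN.
  by move: dx; rewrite mulNrn -mulr_natl; lra.
have [L0|L0] := leP L 0.
  rewrite big1 ?mulr_ge0 ?powR_ge0// => i _; rewrite indicE.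
  case: (boolP (x \in shallow (k0 + i))) => // /key h; exfalso.
  have := le_trans h L0; rewrite leNgt ltr0n addn_gt0 k00//.
apply: (@le_trans _ _ (k0%:R `^ (1 - p) * L `^ p)).
  apply: le_trans (tail_count J k00 p1 L0); apply: ler_sum => i _.
  rewrite indicE; case: (boolP (x \in shallow (k0 + i))) => // /key -> //.
rewrite -mulrA ler_wpM2l ?powR_ge0// /L powRM ?invr_ge0 ?(ltW l2)//.
by rewrite -powR_inv1 ?(ltW l2)// -powRrM mulN1r mulrC.
Qed.

(** The 8 is the 4 of [scale_estimate] times the 2 of the geometric series, using N (scale k)^2 =
    4^-k. *)
Definition excess_bound : R := 2^-1 * level_step *
  (8 * 4^-1 ^+ k0 * Q + k0%:R `^ (1 - p) * ln 2 `^ (- p) * H).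

Let Q0 : 0 <= Q. Proof. exact: dirichlet_form_ge0. Qed.

Lemma measurable_excess : measurable_fun setT excess.
Proof.
apply: emeasurable_funM => //; apply: ge0_emeasurable_sum.
- by move=> i x _ _; rewrite lee_fin; exact: level_term_ge0.
- by move=> i _; apply/measurable_EFinP; exact: measurable_level_term.
Qed.

Lemma excess_ge0 x : (0 <= excess x)%E.
Proof.
rewrite mule_ge0//; first by rewrite lee_fin mulr_ge0// ltW// level_step_gt0.
by apply: nneseries_ge0 => i _ _; rewrite lee_fin; exact: level_term_ge0.
Qed.

Lemma integral_excess : (\int[mu]_x excess x <= excess_bound%:E)%E.
Proof.
have ls0 := ltW level_step_gt0.
have mS k : measurable_fun setT (fun x => \1_(shallow k) x * F x ^+ 2).
  by apply: measurable_funM => //; apply: measurable_indic; exact: measurable_shallow.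
have mA k : measurable_fun setT (fun x => \1_(scale_set Omega f (scale k)) x * F x ^+ 2).
  by apply: measurable_funM => //; apply: measurable_indic; exact: measurable_scale_set.
have A0 k x : 0 <= \1_(scale_set Omega f (scale k)) x * F x ^+ 2.
  by rewrite mulr_ge0// sqr_ge0.
have S0 k x : 0 <= \1_(shallow k) x * F x ^+ 2 by rewrite mulr_ge0// sqr_ge0.
rewrite /excess ge0_integralZl//; last 3 first.
- apply: ge0_emeasurable_sum.
    by move=> i x _ _; rewrite lee_fin; exact: level_term_ge0.
  by move=> i _; apply/measurable_EFinP; exact: measurable_level_term.
- by move=> x _; apply: nneseries_ge0 => i _ _; rewrite lee_fin; exact: level_term_ge0.
- by rewrite lee_fin mulr_ge0.
rewrite integral_nneseries//; last 2 first.
- by move=> i; apply/measurable_EFinP; exact: measurable_level_term.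
- by move=> i x _; rewrite lee_fin; exact: level_term_ge0.
rewrite /excess_bound [leRHS]EFinM lee_wpmul2l//; first by rewrite lee_fin mulr_ge0.
apply: lime_le.
  by apply: is_cvg_nneseries => i _ _; apply: integral_ge0 => x _; rewrite lee_fin; exact: level_term_ge0.
apply: nearW => J; rewrite big_mkord.
apply: (@le_trans _ _ (\sum_(i < J) (\int[mu]_x (\1_(scale_set Omega f (scale (k0 + i))) x * F x ^+ 2)%:E +
    \int[mu]_x (\1_(shallow (k0 + i)) x * F x ^+ 2)%:E))%E).
  apply: lee_sum => i _; rewrite -ge0_integralD//; last 4 first.
  - by move=> x _; rewrite lee_fin.
  - exact/measurable_EFinP.
  - by move=> x _; rewrite lee_fin.
  - exact/measurable_EFinP.
  apply: ge0_le_integral => //.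
  - by move=> x _; rewrite lee_fin; exact: level_term_ge0.
  - by apply/measurable_EFinP; exact: measurable_level_term.
  - by apply: emeasurable_funD; exact/measurable_EFinP.
  - by move=> x _; rewrite -EFinD lee_fin; exact: level_split.
(* The deep parts form a geometric series; the shallow parts are summed under the integral, where
   the Hardy bound applies. *)
rewrite big_split/= EFinD; apply: leeD.
  apply: (@le_trans _ _ (\sum_(i < J) (4 * 4^-1 ^+ k0 * Q * 4^-1 ^+ i)%:E)%E).
    apply: lee_sum => i _; apply: le_trans (scale_estimate O0 oO bO fW (scale_gt0 _)) _.
    rewrite lee_fin le_eqVlt; apply/orP; left; apply/eqP.
    have -> : 4 * n.+1%:R * scale (k0 + i) ^+ 2 = 4 * (Num.sqrt n.+1%:R * scale (k0 + i)) ^+ 2.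
      by rewrite [X in _ = 4 * X]exprMn sqr_sqrtr// [RHS]mulrA.
    rewrite sqrt_scale -exprM mulnC exprM.
    have -> : (2^-1 : R) ^+ 2 = 4^-1 by rewrite exprVn -natrX.
    by rewrite exprD; ring.
  rewrite sumEFin lee_fin -mulr_sumr.
  have -> : 8 * 4^-1 ^+ k0 * Q = 4 * 4^-1 ^+ k0 * Q * 2 by ring.
  rewrite ler_wpM2l ?geometric4// mulr_ge0// mulr_ge0// exprn_ge0// invr_ge0//.
rewrite -ge0_integral_sum//; last 2 first.
- by move=> i; exact/measurable_EFinP.
- by move=> i x _; rewrite lee_fin.
have mw : measurable_fun setT (fun x => \1_Omega x * `|ln (dist x)| `^ p * F x ^+ 2).
  apply: measurable_funM => //; apply: measurable_funM.
    by apply: measurable_indic; exact: open_measurable_rV.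
  apply: (measurableT_comp (measurable_powR _)).
  apply: measurableT_comp => //; apply: measurableT_comp => //.
  exact: measurable_dist.
have c0 : 0 <= k0%:R `^ (1 - p) * ln 2 `^ (- p) :> R by rewrite mulr_ge0 ?powR_ge0.
apply: (@le_trans _ _ (\int[mu]_x ((k0%:R `^ (1 - p) * ln 2 `^ (- p)) *
    (\1_Omega x * `|ln (dist x)| `^ p * F x ^+ 2))%:E)%E).
  apply: ge0_le_integral => //.
  - by move=> x _; apply: sume_ge0 => i _; rewrite lee_fin.
  - by apply: emeasurable_sum => i; exact/measurable_EFinP.
  - by apply/measurable_EFinP; exact: measurable_funM.
  - by move=> x _; rewrite sumEFin lee_fin; exact: shallow_count.
rewrite ge0_integralZ_real//; last first.
  by move=> x; rewrite mulr_ge0 ?sqr_ge0// mulr_ge0// powR_ge0.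
by rewrite [leRHS]EFinM lee_wpmul2l.
Qed.

(** Splitting off the multiple of F^2 requires the remainder [u] to be integrable: it lies below
    [excess], and above minus an integrable function since y^2 ln y >= -1 and [Omega] is bounded. *)
Lemma integral_xlnx :
  (\int[mu]_x (xlnx x)%:E <= (excess_bound + 2^-1 * ln_shift * m)%:E)%E.
Proof.
pose c := 2^-1 * ln_shift.
have mG : measurable_fun setT xlnx.
  by apply: measurable_funM => //; apply: measurableT_comp => //; exact: measurableT_comp.
have mO : measurable Omega by exact: open_measurable_rV.
have mIO : measurable_fun setT (\1_Omega : 'rV[R]_n.+1 -> R) by exact: measurable_indic.
pose u x := xlnx x - c * F x ^+ 2.
have mu_ : measurable_fun setT u by apply: measurable_funB => //; exact: measurable_funM.
have uT x : ((u x)%:E <= excess x)%E.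
  rewrite /u EFinB leeBlDl//; exact: xlnx_le_excess.
have iT : mu.-integrable setT excess.
  apply/integrableP; split; first exact: measurable_excess.
  under eq_integral do rewrite gee0_abs ?excess_ge0//.
  by apply: le_lt_trans integral_excess _; rewrite ltry.
have iO : mu.-integrable setT (EFin \o \1_Omega).
  apply/integrableP; split; first exact/measurable_EFinP.
  under eq_integral do rewrite gee0_abs ?lee_fin//.
  by rewrite integral_indic// setIT; exact: bounded_lebesgue_lty.
have iF2 : mu.-integrable setT (EFin \o (fun x => F x ^+ 2)).
  apply/integrableP; split; first exact/measurable_EFinP.
  rewrite (_ : (\int[_]_x _)%E = m%:E) ?ltry//.
  rewrite -(W12_L2_norm fW); apply: eq_integral => x _ /=.
  by rewrite ger0_norm// sqr_ge0.
have iu : mu.-integrable setT (EFin \o u).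
  have ig := integrableD measurableT iT
    (integrableD measurableT iO (integrableZl measurableT `|c| iF2)).
  apply: le_integrable ig => //; first exact/measurable_EFinP.
  move=> x _ /=.
  have r0 : 0 <= \1_Omega x + `|c| * F x ^+ 2.
    by rewrite addr_ge0// mulr_ge0// sqr_ge0.
  rewrite [leRHS]gee0_abs; last by rewrite adde_ge0 ?excess_ge0// -EFinM -EFinD lee_fin.
  have lo : - (\1_Omega x + `|c| * F x ^+ 2) <= u x.
    have h1 : - \1_Omega x <= xlnx x.
      rewrite indicE; have [xO|xO] := boolP (x \in Omega); last first.
        by rewrite /xlnx /patch (negbTE xO) oppr0 expr0n mul0r.
      rewrite /xlnx -[F x ^+ 2]real_normK ?num_real//; exact: sqr_ln_ge.
    have h2 : c * F x ^+ 2 <= `|c| * F x ^+ 2 by rewrite ler_wpM2r ?sqr_ge0// ler_norm.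
    by rewrite /u opprD lerD// lerN2.
  have [u0|u0] := leP 0 (u x).
    rewrite ger0_norm//; apply: le_trans (uT x) _.
    by rewrite leeDl// -EFinM -EFinD lee_fin.
  rewrite ltr0_norm//; apply: (@le_trans _ _ (\1_Omega x + `|c| * F x ^+ 2)%:E).
    by rewrite lee_fin lerNl.
  by rewrite EFinD EFinM leeDr// excess_ge0.
have -> : (\int[mu]_x (xlnx x)%:E = \int[mu]_x ((u x)%:E + c%:E * (F x ^+ 2)%:E))%E.
  by apply: eq_integral => x _; rewrite -EFinM -EFinD /u subrK.
rewrite integralD//; last by have := integrableZl measurableT c iF2.
rewrite integralZl// (W12_L2_norm fW) EFinD EFinM leeD2r//.
by apply: le_trans integral_excess; apply: le_integral => // x _; exact: uT.
Qed.

End layers.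

(** * Choice of the scale and the log-Sobolev inequality *)

Section log_sobolev.
Variables (R : realType) (n : nat) (Omega : set 'rV[R]_n.+1) (p C : R).
Local Notation mu := (lebesgue_rV R n.+1).
Hypotheses (O0 : Omega !=set0) (oO : open Omega) (bO : bounded_set Omega).
Hypotheses (p1 : 1 < p) (C0 : 0 <= C).
Hypothesis hardyC : forall f, W12 Omega f ->
  (\int[mu]_(x in Omega) (`|ln (dist_boundary Omega x)| `^ p * `|f x| ^+ 2)%:E <=
   (C * (dirichlet_form Omega f + L2_norm Omega f ^+ 2))%:E)%E.

Lemma integral_xlnx_ae f : W12 Omega f ->
  {ae mu, forall x, Omega x -> 0 <= f x} ->
  (\int[mu]_(x in Omega) (f x ^+ 2 * ln (f x))%:E =
   \int[mu]_x (xlnx Omega f x)%:E)%E.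
Proof.
move=> fW f0; have mF := W12_measurable oO bO fW.
have mln : measurable_fun setT (fun x => (f \_ Omega) x ^+ 2 * ln ((f \_ Omega) x)).
  by apply: measurable_funM; [exact: measurable_funX|exact: measurableT_comp].
rewrite integral_mkcond.
transitivity (\int[mu]_x ((f \_ Omega) x ^+ 2 * ln ((f \_ Omega) x))%:E)%E.
  apply: eq_integral => x _; rewrite /patch; case: ifP => // _.
  by rewrite expr0n mul0r.
apply: ae_eq_integral => //.
- exact/measurable_EFinP.
- apply/measurable_EFinP; apply: measurable_funM; first exact: measurable_funX.
  by apply: measurableT_comp => //; exact: measurableT_comp.
apply: filterS f0 => x fx _; congr EFin; rewrite /xlnx; congr (_ * ln _).
rewrite ger0_norm// /patch; case: ifPn => // xO; apply: fx.
by rewrite inE in xO.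
Qed.

(** Brings the interior contribution to the order of the boundary one: k^(p-1) <= (2(p-1))^(p-1)
    e^(k/2), and e^(1/2) <= 4 because ln 2 >= 1/2. *)
Lemma quarter_pow_le (k : nat) : (0 < k)%N ->
  4^-1 ^+ k <= (2 * (p - 1)) `^ (p - 1) * k%:R `^ (1 - p) :> R.
Proof.
move=> k0; have kR : 0 < k%:R :> R by rewrite ltr0n.
have p10 : 0 < p - 1 by rewrite subr_gt0.
rewrite -[1 - p]opprB powRN ler_pdivlMr ?powR_gt0//.
have h := powR_le_expR p10 (ltW kR).
have e4 : expR (k%:R / 2) <= 4 ^+ k :> R.
  rewrite expRM_natl lerXn2r ?nnegrE ?expR_ge0//.
  have e0 : 0 < 1 - 2^-1 :> R by lra.
  have e1 : -1 < - 2^-1 :> R by lra.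
  have h1 := le_ln1Dx e1.
  have l12 : ln (1 + - 2^-1) = - ln 2 :> R.
    by rewrite (_ : 1 + - 2^-1 = 2^-1) ?lnV ?posrE//; lra.
  rewrite l12 in h1.
  rewrite -[leRHS]lnK ?posrE// ler_expR.
  have -> : ln 4 = 2 * ln 2 :> R.
    by rewrite (_ : 4 = 2 ^+ 2) ?lnXn ?mulr_natl// -natrX.
  by move: h1; lra.
rewrite exprVn mulrC ler_pdivrMr ?exprn_gt0//.
by apply: le_trans h _; rewrite ler_wpM2l ?powR_ge0.
Qed.

(** Times k0^(1-p), this is the factor of the Dirichlet form once 4^-k0 has been traded for
    k0^(1-p). *)
Definition coef_dirichlet : R := 2^-1 * level_step R n *
  (8 * (2 * (p - 1)) `^ (p - 1) + ln 2 `^ (- p) * C).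

Definition coef_norm : R := 2^-1 * level0 R n + 2^-1 * level_step R n * (ln 2 `^ (- p) * C).

(** Rounding up solves k^(1-p) (coef_dirichlet + 1) <= eps; the 1 makes the base positive, and the
    successor makes k positive. *)
Definition scale_index (eps : R) : nat :=
  (Num.truncn (((coef_dirichlet + 1) / eps) `^ (1 / (p - 1)))).+1.

Definition eta (eps : R) : R := coef_norm + 2^-1 * level_step R n * (scale_index eps)%:R.

Lemma coef_dirichlet_ge0 : 0 <= coef_dirichlet.
Proof.
apply: mulr_ge0; first by rewrite mulr_ge0// ltW// level_step_gt0.
by apply: addr_ge0; apply: mulr_ge0; rewrite ?powR_ge0.
Qed.

Lemma scale_index_powR eps : 0 < eps ->
  (scale_index eps)%:R `^ (1 - p) * (coef_dirichlet + 1) <= eps.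
Proof.
move=> e0; have A0 := coef_dirichlet_ge0.
have A1 : 0 < coef_dirichlet + 1 by rewrite ltr_wpDl.
have p10 : 0 < p - 1 by rewrite subr_gt0.
set k : R := (scale_index eps)%:R.
have kR : 0 < k by rewrite ltr0n.
pose z := ((coef_dirichlet + 1) / eps) `^ (1 / (p - 1)).
have zk : z <= k by rewrite ltW// truncnS_gt.
have zp : z `^ (p - 1) = (coef_dirichlet + 1) / eps.
  by rewrite /z -powRrM mul1r mulVf ?gt_eqF// powRr1// divr_ge0 ?ltW.
have : (coef_dirichlet + 1) / eps <= k `^ (p - 1).
  by rewrite -zp; apply: ge0_ler_powR; rewrite ?nnegrE ?powR_ge0 ?(ltW p10) ?(ltW kR).
rewrite ler_pdivrMr// => h.
by rewrite -[1 - p]opprB powRN mulrC ler_pdivrMr ?powR_gt0// mulrC.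
Qed.

(** [eta] is bounded below whereas - ln eps tends to minus infinity as eps grows, so the bound is
    claimed on (0, eps0], with a constant depending on [eps0] that absorbs ln eps <= |ln eps0|. *)
Lemma eta_le eps0 : 0 < eps0 -> exists b14 : R, 0 < b14 /\
  forall eps, 0 < eps <= eps0 ->
    eta eps <= 2^-1 * level_step R n * (coef_dirichlet + 1) `^ (1 / (p - 1)) *
        eps `^ (- (1 / (p - 1))) - 1 * ln eps + b14.
Proof.
move=> e00; have A0 := coef_dirichlet_ge0.
have A1 : 0 < coef_dirichlet + 1 by rewrite ltr_wpDl.
have ls0 := level_step_gt0 R n.
exists (`|coef_norm| + 2^-1 * level_step R n + `|ln eps0| + 1).
split; first by rewrite ltr_wpDl// addr_ge0// addr_ge0// mulr_ge0// ltW.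
move=> eps /andP[e0 ee0].
set z := ((coef_dirichlet + 1) / eps) `^ (1 / (p - 1)).
have z0 : 0 <= z by exact: powR_ge0.
have zE : z = (coef_dirichlet + 1) `^ (1 / (p - 1)) * eps `^ (- (1 / (p - 1))).
  rewrite /z powRM ?(ltW A1) ?invr_ge0 ?(ltW e0)//; congr (_ * _).
  by rewrite -[eps^-1]powR_inv1 ?(ltW e0)// -powRrM mulN1r.
rewrite -mulrA -zE /eta.
have kz : (scale_index eps)%:R <= z + 1.
  rewrite /scale_index -/z -[_.+1]addn1 natrD lerD2r.
  by have /andP[] := truncn_itv z0.
have h1 : 2^-1 * level_step R n * (scale_index eps)%:R <=
    2^-1 * level_step R n * z + 2^-1 * level_step R n.
  by rewrite -[X in _ + X]mulr1 -mulrDr ler_wpM2l// mulr_ge0// ltW.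
have h2 : ln eps <= `|ln eps0|.
  by apply: le_trans (ler_norm _); rewrite ler_ln ?posrE.
have h3 := ler_norm coef_norm.
by move: h1 h2 h3; lra.
Qed.

Lemma log_sobolev f : W12 Omega f ->
  {ae mu, forall x, Omega x -> 0 <= f x} -> forall eps, 0 < eps ->
  (\int[mu]_(x in Omega) (f x ^+ 2 * ln (f x))%:E <=
   (eps * dirichlet_form Omega f + eta eps * L2_norm Omega f ^+ 2
    + L2_norm Omega f ^+ 2 * ln (L2_norm Omega f))%:E)%E.
Proof.
move=> fW f0 eps e0; rewrite (integral_xlnx_ae fW f0).
have Q0 : 0 <= dirichlet_form Omega f by exact: dirichlet_form_ge0.
have mF := W12_measurable oO bO fW.
(* The levels divide by the squared norm, so a vanishing norm is treated apart: f is then 0 almost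
   everywhere. *)
have [m0|m0] := leP (L2_norm Omega f ^+ 2) 0.
  have mE : L2_norm Omega f ^+ 2 = 0 by apply/eqP; rewrite eq_le m0 sqr_ge0.
  rewrite mE mulr0 mul0r !addr0.
  suff -> : (\int[mu]_x (xlnx Omega f x)%:E = 0)%E by rewrite lee_fin mulr_ge0// ltW.
  have /ae_eq_integral_abs : (\int[mu]_x `|((f \_ Omega) x ^+ 2)%:E| = 0)%E.
    under eq_integral do rewrite gee0_abs ?lee_fin ?sqr_ge0//.
    by rewrite (W12_L2_norm fW) mE.
  move=> /(_ _ _) h; rewrite -[RHS](integral0 mu setT).
  apply: ae_eq_integral => //.
    apply/measurable_EFinP; apply: measurable_funM; first exact: measurable_funX.
    by apply: measurableT_comp => //; exact: measurableT_comp.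
  have : ae_eq mu setT (fun x => ((f \_ Omega) x ^+ 2)%:E) (cst 0%E).
    by apply: h => //; apply/measurable_EFinP; exact: measurable_funX.
  by apply: filterS => x /= /(_ I) [E] _; rewrite /xlnx E mul0r.
set k := scale_index eps; have k0 : (0 < k)%N by [].
set m := L2_norm Omega f ^+ 2 in m0 *; set Q := dirichlet_form Omega f in Q0 *.
have hf : (\int[mu]_x (\1_Omega x * `|ln (dist_boundary Omega x)| `^ p *
    (f \_ Omega) x ^+ 2)%:E <= (C * (Q + m))%:E)%E.
  apply: le_trans (hardyC fW); rewrite [leRHS]integral_mkcond le_eqVlt.
  apply/orP; left; apply/eqP; apply: eq_integral => x _; rewrite /patch indicE.
  case: ifP => _; last by rewrite !mul0r.
  by rewrite mul1r real_normK ?num_real.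
apply: le_trans (integral_xlnx O0 oO bO fW p1 k0 hf m0) _.
rewrite lee_fin -/m -/Q /excess_bound /ln_shift -/Q.
have lnm : ln m = 2 * ln (L2_norm Omega f).
  have L0 : 0 < L2_norm Omega f.
    by rewrite lt_neqAle sqrtr_ge0 andbT eq_sym; apply/eqP => L0; move: m0; rewrite /m L0 expr0n ltxx.
  by rewrite /m lnXn// mulr_natl.
rewrite lnm.
have hq := quarter_pow_le k0.
have hs := scale_index_powR e0; rewrite -/k in hs.
(* In front of the norm k^(1-p) is replaced by 1, so that [coef_norm] does not depend on eps; in
   front of the Dirichlet form its smallness is kept. *)
have K1 : k%:R `^ (1 - p) <= 1.
  rewrite -[1 - p]opprB powRN invf_le1 ?powR_gt0 ?ltr0n//.
  rewrite -[leLHS](powRr0 k%:R) ler_powR ?ler1n// subr_ge0 ltW//.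
have K0 : 0 <= k%:R `^ (1 - p) by exact: powR_ge0.
rewrite /eta -/k.
have ls0 := ltW (level_step_gt0 R n).
move: hs; rewrite /coef_norm /coef_dirichlet.
set b := level_step R n in ls0 *; set a := level0 R n; set l := ln (L2_norm Omega f).
set c2 := ln 2 `^ (- p); have c20 : 0 <= c2 by exact: powR_ge0.
set K := k%:R `^ (1 - p) in hq K0 K1 *; set Cp := _ `^ (p - 1) in hq *.
have Cp0 : 0 <= Cp by exact: powR_ge0.
set q4 := 4^-1 ^+ k in hq *; set kk : R := k%:R => hs.
have b20 : 0 <= 2^-1 * b by rewrite mulr_ge0.
have s1 : 2^-1 * b * (8 * q4 * Q) <= 2^-1 * b * (8 * (Cp * K) * Q).
  by rewrite ler_wpM2l// ler_wpM2r// ler_wpM2l.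
have s2 : 2^-1 * b * (K * c2 * (C * m)) <= 2^-1 * b * (c2 * (C * m)).
  rewrite ler_wpM2l// -mulrA ler_piMl//.
  by rewrite mulr_ge0// mulr_ge0// ltW.
have s3 := ler_wpM2r Q0 hs.
have s4 : 0 <= K * Q by exact: mulr_ge0.
have -> : 2^-1 * b * (8 * q4 * Q + K * c2 * (C * (Q + m))) +
    2^-1 * (a + b * kk + 2 * l) * m =
  2^-1 * b * (8 * q4 * Q) + 2^-1 * b * (K * c2 * (C * m)) +
  2^-1 * b * (K * c2 * (C * Q)) + 2^-1 * (a + b * kk) * m + m * l by field.
apply: le_trans (_ : 2^-1 * b * (8 * (Cp * K) * Q) + 2^-1 * b * (c2 * (C * m)) +
  2^-1 * b * (K * c2 * (C * Q)) + 2^-1 * (a + b * kk) * m + m * l <= _).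
  by rewrite !lerD2r lerD.
have -> : 2^-1 * b * (8 * (Cp * K) * Q) + 2^-1 * b * (c2 * (C * m)) +
  2^-1 * b * (K * c2 * (C * Q)) + 2^-1 * (a + b * kk) * m + m * l =
  (K * (2^-1 * b * (8 * Cp + c2 * C) + 1) * Q - K * Q) +
  (2^-1 * a + 2^-1 * b * (c2 * C) + 2^-1 * b * kk) * m + m * l by ring.
rewrite !lerD2r; apply: le_trans s3.
by rewrite gerBl.
Qed.

End log_sobolev.

Theorem corollary4p4 (R : realType) (n : nat) (Omega : set 'rV[R]_n.+1)
    (alpha beta : R) :
  domain Omega -> bounded_set Omega ->
  0 < alpha ->
  (forall a, boundary Omega a -> log_regular alpha Omega a) ->
  0 < beta < 1 -> 1 < alpha * beta ->
  (exists b11 : R, 0 < b11 /\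
     forall f : 'rV[R]_n.+1 -> R, W12 Omega f ->
       (\int[lebesgue_rV R n.+1]_(x in Omega)
          (`|ln (dist_boundary Omega x)| `^ (alpha * beta) * `|f x| ^+ 2)%:E
        <= (b11 * (dirichlet_form Omega f + L2_norm Omega f ^+ 2))%:E)%E) /\
  (exists (b12 b13 : R) (eta : R -> R),
     [/\ 0 < b12, 0 < b13,
         (forall eps0 : R, 0 < eps0 ->
            exists b14 : R, 0 < b14 /\
              forall eps : R, 0 < eps <= eps0 ->
                eta eps <= b12 * eps `^ (- (1 / (alpha * beta - 1)))
                           - b13 * ln eps + b14) &
         forall f : 'rV[R]_n.+1 -> R, W12 Omega f ->
           {ae lebesgue_rV R n.+1, forall x, Omega x -> 0 <= f x} ->
           forall eps : R, 0 < eps ->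
             (\int[lebesgue_rV R n.+1]_(x in Omega) (f x ^+ 2 * ln (f x))%:E
              <= (eps * dirichlet_form Omega f + eta eps * L2_norm Omega f ^+ 2
                  + L2_norm Omega f ^+ 2 * ln (L2_norm Omega f))%:E)%E]).
Proof.
move=> [] O0 _ oO bO alpha0 reg beta01 ab1.
have [C C0 hC] := hardy_everywhere O0 oO bO alpha0 beta01 reg.
split.
  exists (C + 1); split; first by rewrite ltr_wpDl.
  move=> f fW; apply: le_trans (hC f fW) _; rewrite lee_fin ler_wpM2r ?lerDl//.
  by rewrite addr_ge0 ?sqr_ge0// dirichlet_form_ge0.
exists (2^-1 * level_step R n * (coef_dirichlet n (alpha * beta) C + 1) `^ (1 / (alpha * beta - 1))).
exists 1, (eta n (alpha * beta) C); split => //.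
- apply: mulr_gt0; first by rewrite mulr_gt0 ?invr_gt0// level_step_gt0.
  by apply: powR_gt0; rewrite ltr_wpDl// coef_dirichlet_ge0.
- by move=> eps0 e0; exact: eta_le.
- by move=> f fW f0 eps e0; exact: log_sobolev.
Qed.
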